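(* Let $f,g\in H^\infty(\mathbb{R}^2)$ and set $$\mathcal{L}(f)g=-\frac{1}{2\pi}\int_{\mathbb{R}^2}\frac{\alpha\cdot\nabla_x\Delta_\alpha g}{\langle \Delta_\alpha f\rangle^{3}}\frac{d\alpha}{|\alpha|^2}.$$ Then $$\mathcal{L}(f)g=P(f)g+V(f)\cdot\nabla_x g+R(f,g),$$ where the operator $P(f)$ is defined by $$P(f)g=\frac{1}{2\pi}\int_{\mathbb{R}^2}\frac{\delta_\alpha g}{\langle \check\alpha\cdot\nabla_x f\rangle^3}\frac{d\alpha}{|\alpha|^3},\qquad \check\alpha=\frac{\alpha}{|\alpha|}\in\mathbb{S}^1,$$ the vector field $V(f)$ is given by $$V(f)(x)=\frac{1}{2\pi}\int_{\mathbb{R}^2}\frac12\left(\frac{1}{\langle\Delta_{-\alpha}f(x)\rangle^{3}}-\frac{1}{\langle\Delta_{\alpha}f(x)\rangle^{3}}\right)\alpha\,\frac{d\alpha}{|\alpha|^{3}}\in\mathbb{R}^2,$$ and the remainder term $R(f,g)$ has the form $$R(f,g)(x)=\frac{1}{2\pi}\int_{\mathbb{R}^2}M_\alpha(x)\,\delta_\alpha g(x)\,\frac{d\alpha}{|\alpha|^3},$$ for some symbol $M_\alpha$ satisfying the pointwise bound $$|M_\alpha(x)|\le 6\,\big|\Delta_\alpha f(x)-\check\alpha\cdot\nabla_xf(x)\big|+3\,\big|\nabla_x(\delta_\alpha f)(x)\big|.$$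
   Context: All functions are real-valued on $\mathbb{R}^2$, and $H^\infty(\mathbb{R}^2)=\bigcap_{s\ge0}H^s(\mathbb{R}^2)$. For $\alpha\in\mathbb{R}^2\setminus\{0\}$: $\delta_\alpha u(x)=u(x)-u(x-\alpha)$, $\Delta_\alpha u(x)=\frac{u(x)-u(x-\alpha)}{|\alpha|}$, $\langle a\rangle=\sqrt{1+a^2}$ for $a\in\mathbb{R}$, $\alpha\cdot\nabla_x=\alpha_1\partial_{x_1}+\alpha_2\partial_{x_2}$. Integrals that are not absolutely convergent are understood in the principal value sense, i.e. as limits as $\eta\to0$ of integrals over $\{\eta<|\alpha|<1/\eta\}$. *)

(* Defs.v *)
From HB Require Import structures.
From mathcomp Require Import all_boot all_order all_algebra.
From mathcomp Require Import all_classical all_reals all_analysis.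
Set Implicit Arguments.
Unset Strict Implicit.
Unset Printing Implicit Defensive.
Import Order.TTheory GRing.Theory Num.Theory.
Import numFieldNormedType.Exports.
Local Open Scope classical_set_scope.
Local Open Scope ring_scope.

Section plane.
Variable R : realType.

(* [`|_|] on a product is the max norm, hence the explicit Euclidean norm. *)
Definition dot (a b : R * R) : R := a.1 * b.1 + a.2 * b.2.
Definition enorm (a : R * R) : R := Num.sqrt (dot a a).

Definition leb2 := (@lebesgue_measure R \x @lebesgue_measure R)%E.

Definition grad (u : R * R -> R) (x : R * R) : R * R :=
  ('D_(1, 0) u x, 'D_(0, 1) u x).

(* The transform [\int u(x) e^{-i x.xi} dx] of a real-valued [u], cut off to
   the ball of radius [n], is [fourier_cos n u - i * fourier_sin n u]. *)
Definition fourier_cos (n : nat) (u : R * R -> R) (xi : R * R) : R :=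
  \int[leb2]_(x in [set x | enorm x <= n%:R]) (u x * cos (dot x xi)).
Definition fourier_sin (n : nat) (u : R * R -> R) (xi : R * R) : R :=
  \int[leb2]_(x in [set x | enorm x <= n%:R]) (u x * sin (dot x xi)).

(* [a - i * b] is the (Plancherel) Fourier transform of [u \in L^2], i.e. the
   limit in [L^2] of the transforms of the truncations of [u]. *)
Definition fourier_transform (u a b : R * R -> R) : Prop :=
  ('N[leb2]_2%:E[EFin \o (fourier_cos n u \- a)%R] @[n --> \oo] --> 0)%E /\
  ('N[leb2]_2%:E[EFin \o (fourier_sin n u \- b)%R] @[n --> \oo] --> 0)%E.

Definition L2 (u : R * R -> R) : Prop := u \in Lfun leb2 2%:E.

Definition Sobolev (s : R) (u : R * R -> R) : Prop :=
  L2 u /\ exists a b : R * R -> R,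
    [/\ fourier_transform u a b, L2 a, L2 b,
        L2 (fun xi => (1 + enorm xi ^+ 2) `^ (s / 2) * a xi) &
        L2 (fun xi => (1 + enorm xi ^+ 2) `^ (s / 2) * b xi)].

(* Elements of [H^infty] are classes modulo null sets; each class has exactly
   one continuous representative, which is the one taken here since the
   operators below are evaluated pointwise. *)
Definition Hinfty (u : R * R -> R) : Prop :=
  continuous u /\ forall s : R, 0 <= s -> Sobolev s u.

Definition annulus (eta : R) : set (R * R) :=
  [set a | eta < enorm a /\ enorm a < eta^-1].

Definition abs_convergent (F : R * R -> R) : Prop :=
  leb2.-integrable setT (EFin \o F).

Definition pv_convergent (F : R * R -> R) : Prop :=
  (forall eta, 0 < eta -> leb2.-integrable (annulus eta) (EFin \o F)) /\
  cvg ((\int[leb2]_(a in annulus eta) F a)%R @[eta --> 0^'+]).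

Definition convergent (F : R * R -> R) : Prop :=
  abs_convergent F \/ pv_convergent F.

(* Lebesgue integral over the plane when it converges absolutely, principal
   value otherwise. *)
Definition pv_int (F : R * R -> R) : R :=
  if `[< abs_convergent F >] then \int[leb2]_a F a
  else lim ((\int[leb2]_(a in annulus eta) F a)%R @[eta --> 0^'+]).

Definition jap (a : R) : R := Num.sqrt (1 + a ^+ 2).

Definition delta (al : R * R) (u : R * R -> R) (x : R * R) : R :=
  u x - u (x - al).
Definition Delta (al : R * R) (u : R * R -> R) (x : R * R) : R :=
  (u x - u (x - al)) / enorm al.
Definition direction (al : R * R) : R * R := (enorm al)^-1 *: al.

Definition L_integrand (f g : R * R -> R) (x al : R * R) : R :=
  dot al (grad (Delta al g) x) / jap (Delta al f x) ^+ 3 / enorm al ^+ 2.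
Definition L (f g : R * R -> R) (x : R * R) : R :=
  - (2 * pi)^-1 * pv_int (L_integrand f g x).

Definition P_integrand (f g : R * R -> R) (x al : R * R) : R :=
  delta al g x / jap (dot (direction al) (grad f x)) ^+ 3 / enorm al ^+ 3.
Definition P (f g : R * R -> R) (x : R * R) : R :=
  (2 * pi)^-1 * pv_int (P_integrand f g x).

Definition V_integrand (f : R * R -> R) (x al : R * R) : R * R :=
  (2^-1 * ((jap (Delta (- al) f x) ^+ 3)^-1 - (jap (Delta al f x) ^+ 3)^-1)
    / enorm al ^+ 3) *: al.
Definition V (f : R * R -> R) (x : R * R) : R * R :=
  (2 * pi)^-1 *: (pv_int (fun al => (V_integrand f x al).1),
                  pv_int (fun al => (V_integrand f x al).2)).

Definition Rem_integrand (M : R * R -> R * R -> R) (g : R * R -> R)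
    (x al : R * R) : R :=
  M al x * delta al g x / enorm al ^+ 3.
Definition Rem (M : R * R -> R * R -> R) (g : R * R -> R) (x : R * R) : R :=
  (2 * pi)^-1 * pv_int (Rem_integrand M g x).

End plane.

(* Main.v *)
Require Import Defs.
From HB Require Import structures.
From mathcomp Require Import all_boot all_order all_algebra.
From mathcomp Require Import all_classical all_reals all_analysis.
From mathcomp Require Import measurable_realfun.
From mathcomp Require Import ring lra.
Set Implicit Arguments.
Unset Strict Implicit.
Unset Printing Implicit Defensive.
Import Order.TTheory GRing.Theory Num.Theory.
Import numFieldNormedType.Exports.
Local Open Scope classical_set_scope.
Local Open Scope ring_scope.

(** Write [delta] and [Delta] for the increments and quotients of [f] and [g] at
    a fixed [x], and [c = <Delta_al f> ^ - 3]. The integrand of [L f g] is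
      [al . grad g (x) c / |al| ^ 3 - al . grad g (x - al) c / |al| ^ 3].

    In the first term, exchanging [al] and [- al] replaces [c] by half of its odd
    part: this is the drift [V f . grad g] ([transport_integral]).

    In the second term, [al . grad g (x - al)] is the radial derivative
    [al . grad_al (delta_al g)]. Integrating by parts along the rays moves this
    derivative to [c / |al| ^ 3] and produces
      [delta_al g (c - al . grad_al c) / |al| ^ 3].
    Subtracting the value [<w . grad f> ^ - 3] that [c] takes at the origin in
    the direction [w = al / |al|] splits this into the integrand of [P f g] and
    that of the remainder, whose symbol [symbol] is therefore
      [c - <w . grad f> ^ - 3 - al . grad_al c]
    with [- al . grad_al c = 3 Delta <Delta> ^ - 5 (w . grad f (x - al) - Delta)].
    The bound on the symbol is the Lipschitz bound of [<.> ^ - 3] ([symbol_le]).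

    All this is done exactly on the annuli [eta < |al| < 1 / eta]
    ([L_integral]), where the integration by parts is the fundamental theorem of
    calculus on a segment of each line through the origin, in the polar
    coordinates [polar_transports]. The boundary terms vanish in the limit:
    at the outer circle because [g] is bounded, at the inner one because opposite
    points compensate ([ray_primitive_sym], [cvg_ibp_defect]). The limits of the
    other three integrals exist because the even parts of their integrands are
    bounded by a multiple of [1 / (|al| (1 + |al| ^ 2))], which is integrable in
    the plane ([pv_symmetric_cvg]); the convergence of the integral for [L f g]
    follows from the identity on the annuli.

    These estimates use that [f] and [g] are bounded, with bounded and Lipschitz
    gradients and a quadratic Taylor remainder ([regular]). For a function of
    [H^infty] this comes from the Fourier inversion formula
    ([fourier_inversion]) at every point for a continuous square-integrable
    function with integrable transform: both sides are regularised with the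
    weight [exp (- e |xi_1| - e |xi_2|)], whose transform is the product of two
    Poisson kernels, an approximate identity as [e] tends to [0]. A transform
    with an integrable second moment then gives the bounds under the integral
    sign ([Hinfty_regular]). *)

(** * Measurability in the plane *)

Section plane_measurability.
Variable R : realType.
Implicit Types (U : set (R * R)) (F : R * R -> R).

(** The plane is second countable: an open set is the union of the squares of
    rational centre and radius that it contains. *)
Lemma open_measurable2 U : open U -> measurable U.
Proof.
move=> oU.
pose B (q : rat * rat * rat) : set (R * R) :=
  ball (ratr q.1.1 : R) (ratr q.2 : R) `*` ball (ratr q.1.2 : R) (ratr q.2 : R).
have -> : U = \bigcup_(q : rat * rat * rat) (if `[< B q `<=` U >] then B q else set0).
  apply/seteqP; split => [[x y] Uxy|p [q _]]; last first.
    by case: asboolP => // + Bp; exact.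
  have [e /= e0 eU] : nbhs_ball (x, y) U by apply/nbhs_ballP; exact: open_nbhs_nbhs.
  have [r /itvP rP] := rat_in_itvoo (divr_gt0 e0 (ltr0n _ 2)).
  have r0 : 0 < ratr r :> R by rewrite rP.
  have re : ratr r < e / 2 :> R by rewrite rP.
  have near_rat (z : R) : exists q : rat, `|z - ratr q| < ratr r.
    have [q /itvP qP] : exists q : rat, ratr q \in `]z - ratr r, z + ratr r[.
      by apply: rat_in_itvoo; rewrite ltrBlDr -addrA ltrDl addr_gt0.
    by exists q; rewrite distrC ltr_distl !qP.
  have [q1 xq] := near_rat x; have [q2 yq] := near_rat y.
  exists (q1, q2, r) => //; case: asboolP => [_|]; first by split; rewrite /ball/= distrC.
  case=> -[u v] [/= uq vq]; apply: eU; split; rewrite /ball /=.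
  - have -> : x - u = (x - ratr q1) + (ratr q1 - u) by rewrite addrA subrK.
    by rewrite (le_lt_trans (ler_normD _ _))// (splitr e) ltrD ?(lt_trans xq)// (lt_trans uq).
  - have -> : y - v = (y - ratr q2) + (ratr q2 - v) by rewrite addrA subrK.
    by rewrite (le_lt_trans (ler_normD _ _))// (splitr e) ltrD ?(lt_trans yq)// (lt_trans vq).
apply: countable_bigcupT_measurable => [|q]; first exact: countableP.
case: asboolP => // _.
by apply: measurableX; exact: measurable_ball.
Qed.

Lemma continuous_measurable2 F : continuous F -> measurable_fun setT F.
Proof.
move=> /continuousP cF.
apply: (measurability _ (RGenOpens.measurableE R)) => _ [_ [a [b ->] <-]].
by rewrite setTI; apply: open_measurable2; exact/cF/interval_open.
Qed.

End plane_measurability.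

Lemma measurable_funV_ge0 d (T : measurableType d) (R : realType) (D : set T)
    (F : T -> R) :
  (forall x, 0 <= F x) -> measurable_fun D F -> measurable_fun D (fun x => (F x)^-1).
Proof.
(* a real power is measurable on the whole line, across the singularity at 0 *)
move=> F0 mF; rewrite (_ : (fun _ => _) = (@powR R ^~ (- 1)) \o F).
  exact: measurableT_comp.
by apply/funext => x /=; rewrite powR_inv1.
Qed.

(** The planar measure is sigma-finite: the Fubini theorem will be applied to
    pairs of points of the plane, one in space and one in frequency. *)
Section planar_measure.
Variable R : realType.
Local Notation mu := (@lebesgue_measure R).

HB.instance Definition _ := Measure.copy (@leb2 R) (mu \x mu)%E.

Let leb2_sigma_finite : sigma_finite setT (@leb2 R).
Proof.
have /sigma_finiteP[F [TF ndF Foo]] := sigma_finiteT mu.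
exists (fun n => F n `*` F n).
  rewrite -setXTT TF predeqE => -[x y]; split.
    move=> [/= [n _ Fnx] [k _ Gky]]; exists (maxn n k) => //; split.
    - by move: x Fnx; exact/subsetPset/ndF/leq_maxl.
    - by move: y Gky; exact/subsetPset/ndF/leq_maxr.
  by move=> [n _ []/= ? ?]; split; exists n.
move=> k; have [? ?] := Foo k.
split; first exact: measurableX.
by rewrite /leb2 product_measure1E// lte_mul_pinfty// ge0_fin_numE.
Qed.

HB.instance Definition _ :=
  Measure_isSigmaFinite.Build _ _ _ (@leb2 R) leb2_sigma_finite.

End planar_measure.

(** * Changes of variables *)

Section transport.
Local Open Scope ereal_scope.
Context d1 d2 (T : measurableType d1) (U : measurableType d2) (R : realType).
Variables (mu : {measure set T -> \bar R}) (nu : {measure set U -> \bar R}).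

(** The image under [phi] of the measure of density [w] with respect to [nu]
    is [mu]; testing on nonnegative functions makes this composable through
    the Tonelli theorem. *)
Definition transports (phi : U -> T) (w : U -> R) : Prop :=
  [/\ measurable_fun setT phi, measurable_fun setT w, forall u, (0 <= w u)%R &
      forall G : T -> \bar R, measurable_fun setT G -> (forall x, 0 <= G x) ->
        \int[mu]_x G x = \int[nu]_u (G (phi u) * (w u)%:E)].

Variables (phi : U -> T) (w : U -> R).
Hypothesis tr : transports phi w.

Lemma transports_integral (F : T -> \bar R) : measurable_fun setT F ->
  \int[mu]_x F x = \int[nu]_u (F (phi u) * (w u)%:E).
Proof.
case: tr => mphi mw w0 trG mF.
rewrite integralE [RHS]integralE; congr (_ - _).
- rewrite trG//; last exact: measurable_funepos.
  apply: eq_integral => u _; rewrite !funeposE.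
  by rewrite maxe_pMl// ?lee_fin// mul0e.
- rewrite trG//; last exact: measurable_funeneg.
  apply: eq_integral => u _; rewrite !funenegE.
  by rewrite maxe_pMl// ?lee_fin// mul0e mulNe.
Qed.

Lemma transports_integrable (F : T -> \bar R) : measurable_fun setT F ->
  mu.-integrable setT F <-> nu.-integrable setT (fun u => F (phi u) * (w u)%:E).
Proof.
case: tr => mphi mw w0 trG mF.
have mG : measurable_fun setT (fun u => F (phi u) * (w u)%:E).
  apply: emeasurable_funM; first exact: measurableT_comp.
  exact/measurable_EFinP.
have E : \int[mu]_x `|F x| = \int[nu]_u `|F (phi u) * (w u)%:E|.
  rewrite trG//; last exact: measurableT_comp.
  by apply: eq_integral => u _; rewrite abseM /= ger0_norm.
by split => /integrableP[_ h]; apply/integrableP; split => //; rewrite -?E // E.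
Qed.

Lemma transports_Rintegral (F : T -> R) : measurable_fun setT F ->
  (\int[mu]_x F x = \int[nu]_u (F (phi u) * w u))%R.
Proof.
move=> mF; rewrite /Rintegral transports_integral//; first exact/measurable_EFinP.
Qed.

Lemma transports_Rintegrable (F : T -> R) : measurable_fun setT F ->
  mu.-integrable setT (EFin \o F) <->
  nu.-integrable setT (EFin \o (fun u => F (phi u) * w u)%R).
Proof. by move=> mF; apply: transports_integrable; exact/measurable_EFinP. Qed.

End transport.

Section affine.
Variable R : realType.
Local Notation mu := (@lebesgue_measure R).

Lemma measurable_affine (c d : R) : measurable_fun setT (fun y : R => d + c * y).
Proof. by apply: measurable_funD => //; exact: measurable_funM. Qed.

(** The Lebesgue measure is determined by its values on the intervals. *)
Lemma affine_transports (c d : R) : c != 0 ->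
  transports mu mu (fun y => d + c * y) (cst `|c|).
Proof.
move=> c0; split => //; first exact: measurable_affine.
move=> G mG G0.
have mphi := measurable_affine c d.
pose nu' := mscale (NngNum (normr_ge0 c))
  (pushforward mu (fun y : measurableTypeR R => d + c * y : measurableTypeR R)).
pose nu := nu' mphi.
have muE (A : set R) : measurable A -> mu A = nu A.
  move=> mA; apply: lebesgue_measure_unique => //= _ [[a b]] _ <-.
  rewrite /nu /nu' /mscale /= /pushforward.
  case: (ltrgtP c 0) c0 => // c0 _.
  - rewrite (_ : (fun y : R => d + c * y) @^-1` `]a, b] = `[(b - d) / c, (a - d) / c[%classic); last first.
      apply/seteqP; split => y; rewrite /= !in_itv/= ler_ndivrMr// ltr_ndivlMr//.
        by move=> /andP[h1 h2]; apply/andP; split; lra.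
      by move=> /andP[h1 h2]; apply/andP; split; lra.
    rewrite !lebesgue_measure_itv/= !lte_fin ltr_ndivrMr// divfK ?lt_eqF// ltrD2r.
    case: ifPn => _; last by rewrite mule0.
    by rewrite -!EFinD -EFinM ltr0_norm//; congr EFin; field; rewrite lt_eqF.
  - rewrite (_ : (fun y : R => d + c * y) @^-1` `]a, b] = `](a - d) / c, (b - d) / c]%classic); last first.
      apply/seteqP; split => y; rewrite /= !in_itv/= ler_pdivlMr// ltr_pdivrMr//.
        by move=> /andP[h1 h2]; apply/andP; split; lra.
      by move=> /andP[h1 h2]; apply/andP; split; lra.
    rewrite !lebesgue_measure_itv/= !lte_fin ltr_pdivrMr// divfK ?gt_eqF// ltrD2r.
    case: ifPn => _; last by rewrite mule0.
    by rewrite -!EFinD -EFinM gtr0_norm//; congr EFin; field; rewrite gt_eqF.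
rewrite (eq_measure_integral nu); last by move=> A mA _; exact: muE.
rewrite ge0_integral_mscale//= (@ge0_integral_pushforward _ _ (measurableTypeR R) (measurableTypeR R) _ _ mphi mu setT)//=.
rewrite preimage_setT.
under [in RHS]eq_integral do rewrite muleC.
by rewrite ge0_integralZl//; exact: measurableT_comp.
Qed.

End affine.

Section plane_transport.
Variable R : realType.
Local Notation mu := (@lebesgue_measure R).
Local Notation mu2 := (@leb2 R).

Lemma measurable_affine2 (x : R * R) (c : R) :
  measurable_fun setT (fun y : R * R => x + c *: y).
Proof.
apply: (measurable_fun_pair (f := fun y : R * R => x.1 + c * y.1)
                            (g := fun y : R * R => x.2 + c * y.2)).
- exact: (measurableT_comp (measurable_affine c x.1)).
- exact: (measurableT_comp (measurable_affine c x.2)).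
Qed.

Lemma affine2_transports (x : R * R) (c : R) : c != 0 ->
  transports mu2 mu2 (fun y => x + c *: y) (cst (`|c| * `|c|)).
Proof.
move=> c0; have mphi := measurable_affine2 x c.
split => [//||u|G mG G0]; [exact: measurable_cst|by rewrite mulr_ge0|].
have c0' : (0 <= `|c|%:E)%E by rewrite lee_fin.
have mGx (r : R) : measurable_fun setT (fun s => G (r, s)).
  exact: (measurableT_comp mG (pair1_measurable r)).
have mGphi : measurable_fun setT (fun y : R * R => G (x + c *: y)).
  exact: (measurableT_comp mG mphi).
have mGphi1 (r : R) : measurable_fun setT (fun s : R => G (x + c *: (r, s))).
  exact: (measurableT_comp mGphi (pair1_measurable r)).
have [_ _ _ tr1] := affine_transports x.1 c0.
have [_ _ _ tr2] := affine_transports x.2 c0.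
rewrite /leb2 [LHS]fubini_tonelli1// /fubini_F.
transitivity (\int[mu]_r \int[mu]_s (G (r, (x.2 + c * s)%R) * `|c|%:E))%E.
  by apply: eq_integral => r _; exact: (tr2 (fun s => G (r, s))).
rewrite tr1; last 2 first.
- apply: (@measurable_fun_fubini_tonelli_F _ _ _ _ R mu
    (fun p : R * R => (G (p.1, (x.2 + c * p.2)%R) * `|c|%:E)%E)).
  + apply: emeasurable_funM => //.
    apply: (measurableT_comp mG).
    apply: (measurable_fun_pair (f := fst) (g := fun y : R * R => x.2 + c * y.2)).
      exact: measurable_fst.
    exact: (measurableT_comp (measurable_affine c x.2) measurable_snd).
  + by move=> y; rewrite mule_ge0.
- by move=> r; apply: integral_ge0 => s _; rewrite mule_ge0.
rewrite [RHS]fubini_tonelli1; last 2 first.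
- by apply: emeasurable_funM; [exact: mGphi|exact/measurable_EFinP/measurable_cst].
- by move=> y; rewrite mule_ge0// lee_fin mulr_ge0.
apply: eq_integral => r _; rewrite /fubini_F /= -ge0_integralZr//; last 2 first.
- by apply: emeasurable_funM; [exact: mGphi1|exact/measurable_EFinP/measurable_cst].
- by move=> s _; rewrite mule_ge0.
by apply: eq_integral => s _; rewrite EFinM muleA.
Qed.

(** Signed polar coordinates: the angular variable is the slope [t] of the
    line through the origin, and [r] is the signed radius on that line, so
    that the single chart [(t, r)] covers the plane up to the vertical axis. *)
Definition slope_dir (t : R) : R * R :=
  (Num.sqrt (1 + t ^+ 2))^-1 *: (1, t).

Definition polar (p : R * R) : R * R := p.2 *: slope_dir p.1.

Definition polar_weight (p : R * R) : R := `|p.2| / (1 + p.1 ^+ 2).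

Lemma continuous_slope_norm : continuous (fun t : R => (Num.sqrt (1 + t ^+ 2))^-1).
Proof.
move=> t; apply: cvgV; first by rewrite gt_eqF// sqrtr_gt0 ltr_wpDr ?sqr_ge0.
apply: (@continuous_comp _ _ _ (fun t : R => 1 + t ^+ 2) Num.sqrt).
  by apply: cvgD; [exact: cvg_cst|exact: exprn_continuous].
exact: sqrt_continuous.
Qed.

Let mfst : measurable_fun setT (fun p : R * R => p.1).
Proof. exact: measurable_fst. Qed.

Let msnd : measurable_fun setT (fun p : R * R => p.2).
Proof. exact: measurable_snd. Qed.

Let mnorm : measurable_fun setT
  (fun p : R * R => (Num.sqrt (1 + p.1 ^+ 2))^-1).
Proof.
exact: (measurableT_comp (continuous_measurable_fun continuous_slope_norm) mfst).
Qed.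

Lemma measurable_polar : measurable_fun setT polar.
Proof.
apply: (measurable_fun_pair
  (f := fun p : R * R => p.2 * ((Num.sqrt (1 + p.1 ^+ 2))^-1 * 1))
  (g := fun p : R * R => p.2 * ((Num.sqrt (1 + p.1 ^+ 2))^-1 * p.1))).
- by apply: measurable_funM => //; exact: measurable_funM.
- by apply: measurable_funM => //; exact: measurable_funM.
Qed.

Lemma measurable_polar_weight : measurable_fun setT polar_weight.
Proof.
apply: measurable_funM; first exact: (measurableT_comp (@normr_measurable R setT)).
apply: measurable_funV_ge0 => [p|]; first by rewrite addr_ge0 ?sqr_ge0.
by apply: measurable_funD => //; exact: measurable_funX.
Qed.

Lemma polar_weight_ge0 p : 0 <= polar_weight p.
Proof. by rewrite divr_ge0// addr_ge0 ?sqr_ge0. Qed.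

(** On the vertical line of abscissa [x != 0] the slope [t = y / x] is a linear
    coordinate with Jacobian [|x|]; at fixed slope [x = r / sqrt (1 + t ^ 2)]
    is linear in [r]. *)
Lemma polar_transports : transports mu2 mu2 polar polar_weight.
Proof.
split; [exact: measurable_polar|exact: measurable_polar_weight|
        exact: polar_weight_ge0|].
move=> G mG G0.
pose K (x t : R) := (G (x, x * t)%R * `|x|%:E)%E.
have mK : measurable_fun setT (fun p : R * R => K p.1 p.2).
  apply: emeasurable_funM; last first.
    by apply/measurable_EFinP; exact: (measurableT_comp (@normr_measurable R setT)).
  apply: (measurableT_comp mG).
  by apply: (measurable_fun_pair (f := fst) (g := fun y : R * R => y.1 * y.2)) => //;
     exact: measurable_funM.
have K0 x t : (0 <= K x t)%E by rewrite mule_ge0// lee_fin.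
rewrite /leb2 [LHS]fubini_tonelli1// /fubini_F.
transitivity (\int[mu]_x \int[mu]_t K x t)%E.
  apply: ge0_ae_eq_integral => //=.
  - exact: (@measurable_fun_fubini_tonelli_F _ _ _ _ R mu G).
  - by apply: (@measurable_fun_fubini_tonelli_F _ _ _ _ R mu (fun p => K p.1 p.2)).
  - by move=> x _; exact: integral_ge0.
  - by move=> x _; exact: integral_ge0.
  exists [set 0]; split => //; first exact: lebesgue_measure_set1.
  move=> x /= xP; apply: contrapT => /eqP x0; apply: xP => _.
  have [_ _ _ ->//] := affine_transports 0 x0.
    by apply: eq_integral => t _; rewrite add0r.
  exact: (measurableT_comp mG (pair1_measurable x)).
transitivity (\int[mu]_t \int[mu]_x K x t)%E.
  exact: (@fubini_tonelli _ _ _ _ R mu mu (fun p => K p.1 p.2)).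
rewrite [RHS]fubini_tonelli1; last 2 first.
- apply: emeasurable_funM; first exact: (measurableT_comp mG measurable_polar).
  by apply/measurable_EFinP; exact: measurable_polar_weight.
- by move=> p; rewrite mule_ge0// lee_fin polar_weight_ge0.
apply: eq_integral => t _; rewrite /fubini_F /=.
have s0 : 0 < Num.sqrt (1 + t ^+ 2) by rewrite sqrtr_gt0 ltr_wpDr ?sqr_ge0.
have sV0 : (Num.sqrt (1 + t ^+ 2))^-1 != 0 by rewrite gt_eqF// invr_gt0.
have [_ _ _ ->//] := affine_transports 0 sV0; last first.
  exact: (measurableT_comp mK (pair2_measurable t)).
apply: eq_integral => r _; rewrite /K -muleA -EFinM; congr (G _ * _%:E)%E.
  rewrite (_ : polar (t, r) = (r * ((Num.sqrt (1 + t ^+ 2))^-1 * 1),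
                               r * ((Num.sqrt (1 + t ^+ 2))^-1 * t)))//.
  by congr (_, _); ring.
rewrite /polar_weight /= add0r normrM.
rewrite ger0_norm ?invr_ge0 1?ltW// mulrAC -expr2 exprVn sqr_sqrtr 1?mulrC//.
by rewrite addr_ge0 ?sqr_ge0.
Qed.

End plane_transport.

(** * Real-valued integrals *)

Section real_integrals.
Context d (T : measurableType d) (R : realType).
Variables (mu : {measure set T -> \bar R}) (D : set T).
Hypothesis mD : measurable D.
Implicit Types f g : T -> R.

Lemma le_Rintegrable f g : measurable_fun D f ->
  (forall x, D x -> `|f x| <= g x) ->
  mu.-integrable D (EFin \o g) -> mu.-integrable D (EFin \o f).
Proof.
move=> mf fg; apply: le_integrable => //; first exact/measurable_EFinP.
by move=> x Dx; rewrite /= lee_fin (le_trans (fg x Dx))// ler_norm.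
Qed.

Lemma integrableR_measurable f :
  mu.-integrable D (EFin \o f) -> measurable_fun D f.
Proof. by move=> /measurable_int /measurable_EFinP. Qed.

Lemma RintegrableZl (k : R) f : mu.-integrable D (EFin \o f) ->
  mu.-integrable D (EFin \o (fun x => k * f x)).
Proof. exact: integrableZl. Qed.

Lemma RintegrableD f g : mu.-integrable D (EFin \o f) ->
  mu.-integrable D (EFin \o g) -> mu.-integrable D (EFin \o (fun x => f x + g x)).
Proof. exact: integrableD. Qed.

Lemma RintegrableM f g : measurable_fun D f -> (forall x, D x -> `|f x| <= 1) ->
  mu.-integrable D (EFin \o g) -> mu.-integrable D (EFin \o (fun x => f x * g x)).
Proof.
move=> mf f1 ig; apply: (le_Rintegrable (g := fun x => `|g x|)).
- by apply: measurable_funM => //; exact: integrableR_measurable.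
- by move=> x Dx; rewrite normrM ler_piMl// f1.
- exact: integrable_norm.
Qed.

Lemma Rintegral_dominated_cvg (f_ : (T -> R)^nat) f g :
  (forall n, measurable_fun D (f_ n)) ->
  (forall x, D x -> f_ n x @[n --> \oo] --> f x) ->
  mu.-integrable D (EFin \o g) ->
  (forall n x, D x -> `|f_ n x| <= g x) ->
  mu.-integrable D (EFin \o f) /\
  (\int[mu]_(x in D) f_ n x)%R @[n --> \oo] --> (\int[mu]_(x in D) f x)%R.
Proof.
move=> mf_ cvf ig fg.
have mf : measurable_fun D f.
  by apply: (measurable_fun_cvg (h := f_)) => // x Dx; exact: cvf.
have [] := @dominated_convergence _ _ _ mu D mD (fun n => EFin \o f_ n) (EFin \o f)
    (EFin \o g).
- by move=> n; exact/measurable_EFinP.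
- exact/measurable_EFinP.
- by apply: aeW => x Dx; apply: cvg_EFin; [exact: nearW|exact: cvf].
- exact: ig.
- by apply: aeW => x n Dx; rewrite /= lee_fin fg.
move=> if_ _ cvI; split => //.
apply: fine_cvg; rewrite fineK//.
exact: (integral_fune_fin_num mD if_).
Qed.

End real_integrals.

Section real_fubini.
Context d1 d2 (T1 : measurableType d1) (T2 : measurableType d2) (R : realType).
Variables (m1 : {sigma_finite_measure set T1 -> \bar R}).
Variables (m2 : {sigma_finite_measure set T2 -> \bar R}).
Implicit Types F : T1 * T2 -> R.

(** Integrability of every section, rather than of almost every one, makes the
    inner integrals finite, hence equal to their real-valued versions. *)
Lemma Rintegral_prod12 F : (m1 \x m2)%E.-integrable setT (EFin \o F) ->
  (forall x, m2.-integrable setT (fun y => (F (x, y))%:E)) ->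
  \int[(m1 \x m2)%E]_p F p = \int[m1]_x \int[m2]_y F (x, y).
Proof.
move=> iF iFx; rewrite /Rintegral -integral12_prod_meas1//; congr fine.
apply: eq_integral => x _; rewrite /fubini_F fineK//.
exact: (integral_fune_fin_num measurableT (iFx x)).
Qed.

Lemma Rintegral_prod21 F : (m1 \x m2)%E.-integrable setT (EFin \o F) ->
  (forall y, m1.-integrable setT (fun x => (F (x, y))%:E)) ->
  \int[(m1 \x m2)%E]_p F p = \int[m2]_y \int[m1]_x F (x, y).
Proof.
move=> iF iFy; rewrite /Rintegral -integral21_prod_meas1//; congr fine.
apply: eq_integral => y _; rewrite /fubini_G fineK//.
exact: (integral_fune_fin_num measurableT (iFy y)).
Qed.

Lemma Rintegrable_fubini_F F : (m1 \x m2)%E.-integrable setT (EFin \o F) ->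
  (forall x, m2.-integrable setT (fun y => (F (x, y))%:E)) ->
  m1.-integrable setT (fun x => (\int[m2]_y F (x, y))%:E).
Proof.
move=> iF iFx; have := integrable_fubini_F iF.
apply: eq_integrable => // x _; rewrite /fubini_F /Rintegral fineK//.
exact: (integral_fune_fin_num measurableT (iFx x)).
Qed.

Lemma Rintegrable_tensor (u : T1 -> R) (v : T2 -> R) :
  m1.-integrable setT (EFin \o u) -> m2.-integrable setT (EFin \o v) ->
  (m1 \x m2)%E.-integrable setT (fun p => (u p.1 * v p.2)%:E).
Proof.
move=> iu iv.
have mu_ := integrableR_measurable iu; have mv := integrableR_measurable iv.
apply/integrable12ltyP.
  apply/measurable_EFinP; apply: measurable_funM.
    exact: (measurableT_comp mu_ measurable_fst).
  exact: (measurableT_comp mv measurable_snd).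
rewrite (_ : (fun x => _) = (fun x => `|(u x)%:E| * \int[m2]_y `|(v y)%:E|)%E).
  rewrite ge0_integralZr//; last 2 first.
  - by do 2 apply: measurableT_comp => //.
  - exact: integral_ge0.
  by rewrite lte_mul_pinfty ?integral_ge0//; [
     apply: integrable_fin_num => //; exact: integrable_abse|
     case/integrableP: iv].
apply/funext => x; rewrite -ge0_integralZl//.
- by apply: eq_integral => y _; rewrite /= normrM EFinM.
- by do 2 apply: measurableT_comp => //.
Qed.

Lemma Rintegrable_tensorM (k : T1 * T2 -> R) (u : T1 -> R) (v : T2 -> R) :
  measurable_fun setT k -> (forall p, `|k p| <= 1) ->
  m1.-integrable setT (EFin \o u) -> m2.-integrable setT (EFin \o v) ->
  (m1 \x m2)%E.-integrable setT (fun p => (k p * (u p.1 * v p.2))%:E).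
Proof.
by move=> mk k1 iu iv; apply: RintegrableM => //; exact: Rintegrable_tensor.
Qed.

Lemma Rintegral_tensor (u : T1 -> R) (v : T2 -> R) :
  m1.-integrable setT (EFin \o u) -> m2.-integrable setT (EFin \o v) ->
  \int[(m1 \x m2)%E]_p (u p.1 * v p.2) = (\int[m1]_x u x) * (\int[m2]_y v y).
Proof.
move=> iu iv; rewrite Rintegral_prod12.
- rewrite -RintegralZr//; apply: eq_Rintegral => x _ /=.
  by rewrite RintegralZl.
- exact: Rintegrable_tensor.
- by move=> x; exact: (RintegrableZl measurableT (u x) iv).
Qed.

End real_fubini.

Section cauchy_density.
Variable R : realType.
Local Notation mu := (@lebesgue_measure R).

Lemma continuous_oneDsqV : continuous (fun t : R => (1 + t ^+ 2)^-1).
Proof. exact: continuous_oneDsqrV. Qed.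

Lemma integral_oneDsqV : (\int[mu]_t ((1 + t ^+ 2)^-1)%:E = pi%:E)%E.
Proof.
rewrite ge0_symfun_integralT.
- rewrite (_ : [set x | _] = `[0, +oo[%classic); last first.
    by apply/seteqP; split => x /=; rewrite in_itv/= andbT.
  rewrite (integral0y_oneDsqr R) -EFinM; congr EFin; by field.
- by move=> t; rewrite invr_ge0 addr_ge0// sqr_ge0.
- exact: continuous_oneDsqV.
- by move=> t /=; rewrite sqrrN.
Qed.

Lemma integrable_oneDsqV :
  mu.-integrable setT (EFin \o (fun t : R => (1 + t ^+ 2)^-1)).
Proof.
apply/integrableP; split.
  by apply/measurable_EFinP; exact: (continuous_measurable_fun continuous_oneDsqV).
rewrite (_ : (fun _ => _) = (fun t : R => ((1 + t ^+ 2)^-1)%:E)).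
  by rewrite integral_oneDsqV ltry.
by apply/funext => t /=; rewrite ger0_norm// invr_ge0 addr_ge0// sqr_ge0.
Qed.

Lemma Rintegral_oneDsqV : \int[mu]_t (1 + t ^+ 2)^-1 = pi.
Proof. by rewrite /Rintegral integral_oneDsqV. Qed.

End cauchy_density.

(** * The Poisson kernel as a Fourier integral *)

Section laplace_kernel.
Variable R : realType.
Local Notation mu := (@lebesgue_measure R).
Implicit Types e t s : R.

Definition laplace e s : R := expR (- (e * `|s|)).

(** [2e / (e^2 + t^2)] is the Fourier transform of [exp (- e |s|)]. *)
Definition poisson e t : R := 2 * e / (e ^+ 2 + t ^+ 2).

Lemma laplace_ge0 e s : 0 <= laplace e s.
Proof. exact: expR_ge0. Qed.

Lemma laplace_le1 e s : 0 <= e -> laplace e s <= 1.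
Proof. by move=> e0; rewrite -expR0 ler_expR oppr_le0 mulr_ge0. Qed.

Lemma continuous_laplace e : continuous (laplace e).
Proof.
move=> s; apply: continuous_comp; last exact: continuous_expR.
by apply: cvgN; apply: cvgM; [exact: cvg_cst|exact: norm_continuous].
Qed.

Lemma is_derive_scale c s : is_derive s 1 (fun s : R => c * s) c.
Proof. by apply: is_derive_eq; rewrite /GRing.scale/= mulr1. Qed.

Lemma is_derive_expRN e s :
  is_derive s 1 (fun s => expR (- (e * s))) (- e * expR (- (e * s))).
Proof.
have -> : (fun s => expR (- (e * s))) = expR \o (fun s => - e * s).
  by apply/funext => u; rewrite /= mulNr.
have := @is_derive1_comp R expR (fun s => - e * s) s _ _
  (is_derive_expR _) (is_derive_scale _ _).
by rewrite mulrC -[in X in _ -> X]mulNr.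
Qed.

Lemma is_derive_sinM t s :
  is_derive s 1 (fun s => sin (t * s)) (t * cos (t * s)).
Proof.
have := @is_derive1_comp R sin (fun s => t * s) s _ _
  (is_derive_sin _) (is_derive_scale _ _).
by rewrite mulrC.
Qed.

Lemma is_derive_cosM t s :
  is_derive s 1 (fun s => cos (t * s)) (- (t * sin (t * s))).
Proof.
have := @is_derive1_comp R cos (fun s => t * s) s _ _
  (is_derive_cos _) (is_derive_scale _ _).
by rewrite mulrC mulrN.
Qed.

Lemma continuous_laplace_cos e t :
  continuous (fun s => laplace e s * (1 + cos (t * s))).
Proof.
move=> s; apply: cvgM; first exact: continuous_laplace.
apply: cvgD; first exact: cvg_cst.
apply: (@continuous_comp _ _ _ (fun s => t * s) cos); last exact: continuous_cos.
by apply: cvgM; [exact: cvg_cst|exact: cvg_id].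
Qed.

(** The summand [1] makes the integrand nonnegative, so that the improper
    integral is given by an antiderivative and its limit. *)
Lemma integral_laplace_1Dcos e t : 0 < e ->
  (\int[mu]_s (laplace e s * (1 + cos (t * s)))%:E =
   (2 / e + poisson e t)%:E)%E.
Proof.
move=> e0.
have et0 : 0 < e ^+ 2 + t ^+ 2 by rewrite ltr_pwDl ?sqr_ge0// exprn_gt0.
have f0 s : 0 <= laplace e s * (1 + cos (t * s)).
  by rewrite mulr_ge0 ?laplace_ge0// -lerBlDl sub0r cos_geN1.
rewrite ge0_symfun_integralT//; first last.
- by move=> s /=; rewrite /laplace normrN mulrN cosN.
- exact: continuous_laplace_cos.
rewrite (_ : [set x | _] = `[0, +oo[%classic); last first.
  by apply/seteqP; split => x /=; rewrite in_itv/= andbT.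
pose F s : R := expR (- (e * s)) *
  ((t * sin (t * s) - e * cos (t * s)) / (e ^+ 2 + t ^+ 2) - e^-1).
have dF s : is_derive s 1 F (expR (- (e * s)) * (1 + cos (t * s))).
  have h1 := is_derive_expRN e s.
  have h2 := is_derive_sinM t s.
  have h3 := is_derive_cosM t s.
  rewrite /F; apply: is_derive_eq; rewrite /GRing.scale/=.
  by field; rewrite !gt_eqF.
rewrite (@ge0_continuous_FTC2y _ _ F 0 0)//.
- rewrite /F !mulr0 oppr0 expR0 mul1r sin0 cos0 mulr0 mulr1 sub0r add0r /poisson.
  by rewrite -EFinN -EFinM; congr EFin; field; rewrite !gt_eqF.
- by apply: continuous_subspaceT; exact: continuous_laplace_cos.
- pose C := (`|t| + e) / (e ^+ 2 + t ^+ 2) + e^-1.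
  have Ce : C * expR (- (e * x)) @[x --> +oo] --> 0.
    rewrite -(mulr0 C); apply: cvgM; first exact: cvg_cst.
    apply: (@cvg_comp _ _ _ (fun x => e * x) (fun x => expR (- x)) _ (pinfty_nbhs R)).
      exact: gt0_cvgMry.
    exact: cvgr_expR.
  apply: norm_cvg0; apply: (squeeze_cvgr _ (cvg_cst 0) Ce).
  apply: nearW => s; rewrite normr_ge0/= /F normrM mulrC (ger0_norm (expR_ge0 _)).
  rewrite ler_wpM2r ?expR_ge0// (le_trans (ler_normB _ _))// lerD//; last first.
    by rewrite ger0_norm// invr_ge0 ltW.
  rewrite normrM normfV (ger0_norm (ltW et0)) ler_wpM2r ?invr_ge0 ?(ltW et0)//.
  rewrite (le_trans (ler_normB _ _))// lerD// normrM.
    by rewrite ler_piMr// ler_norml sin_geN1 sin_le1.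
  by rewrite (ger0_norm (ltW e0)) ler_piMr ?(ltW e0)// ler_norml cos_geN1 cos_le1.
- by apply: cvg_at_right_filter; apply: differentiable_continuous;
     apply/derivable1_diffP; exact: ex_derive.
- move=> s; rewrite in_itv/= andbT => s0.
  by rewrite derive1E derive_val /laplace gtr0_norm.
Qed.

Lemma integrable_laplace e : 0 < e -> mu.-integrable setT (EFin \o laplace e).
Proof.
move=> e0; apply/integrableP; split.
  by apply/measurable_EFinP; exact: (continuous_measurable_fun (@continuous_laplace e)).
have := integral_laplace_1Dcos 0 e0.
under eq_integral do rewrite mul0r cos0.
move=> h; rewrite (@le_lt_trans _ _ (2 / e + poisson e 0)%:E) ?ltry// -h.
apply: ge0_le_integral => //=.
- by apply/measurable_EFinP; apply: measurableT_comp => //;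
     exact: (continuous_measurable_fun (@continuous_laplace e)).
- by apply/measurable_EFinP; apply: measurable_funM => //;
     exact: (continuous_measurable_fun (@continuous_laplace e)).
- move=> s _; rewrite lee_fin ger0_norm ?laplace_ge0// ler_peMr ?laplace_ge0//.
  by rewrite lerDl.
Qed.

Lemma measurable_cosM t : measurable_fun setT (fun s : R => cos (t * s)).
Proof.
apply: continuous_measurable_fun => s.
apply: (@continuous_comp _ _ _ (fun s => t * s) cos); last exact: continuous_cos.
by apply: cvgM; [exact: cvg_cst|exact: cvg_id].
Qed.

Lemma measurable_sinM t : measurable_fun setT (fun s : R => sin (t * s)).
Proof.
apply: continuous_measurable_fun => s.
apply: (@continuous_comp _ _ _ (fun s => t * s) sin); last exact: continuous_sin.
by apply: cvgM; [exact: cvg_cst|exact: cvg_id].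
Qed.

Lemma normr_cos_le1 (s : R) : `|cos s| <= 1.
Proof. by rewrite ler_norml cos_geN1 cos_le1. Qed.

Lemma normr_sin_le1 (s : R) : `|sin s| <= 1.
Proof. by rewrite ler_norml sin_geN1 sin_le1. Qed.

Lemma integrable_cos_laplace e t : 0 < e ->
  mu.-integrable setT (EFin \o (fun s => cos (t * s) * laplace e s)).
Proof.
move=> e0; apply: RintegrableM => //; first exact: measurable_cosM.
  by move=> s _; exact: normr_cos_le1.
exact: integrable_laplace.
Qed.

Lemma integrable_sin_laplace e t : 0 < e ->
  mu.-integrable setT (EFin \o (fun s => sin (t * s) * laplace e s)).
Proof.
move=> e0; apply: RintegrableM => //; first exact: measurable_sinM.
  by move=> s _; exact: normr_sin_le1.
exact: integrable_laplace.
Qed.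

(** The summand [1] is removed by subtracting the integral of [laplace], which
    the case [t = 0] gives. *)
Lemma Rintegral_cos_laplace e t : 0 < e ->
  \int[mu]_s (cos (t * s) * laplace e s) = poisson e t.
Proof.
move=> e0.
have sum u : \int[mu]_s laplace e s + \int[mu]_s (cos (u * s) * laplace e s) =
    2 / e + poisson e u.
  rewrite -RintegralD//; [|exact: integrable_laplace|exact: integrable_cos_laplace].
  rewrite /Rintegral -[RHS]/(fine (2 / e + poisson e u)%:E) -integral_laplace_1Dcos//.
  by congr fine; apply: eq_integral => s _; rewrite mulrDr mulr1 mulrC.
have := sum 0.
have -> : \int[mu]_s (cos (0 * s) * laplace e s) = \int[mu]_s laplace e s.
  by apply: eq_Rintegral => s _; rewrite mul0r cos0 mul1r.
rewrite /poisson expr0n/= addr0 => h0; have := sum t.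
have -> : \int[mu]_s laplace e s = 2 / e.
  move: h0; set I := Rintegral _ _ _ => h0.
  suff : 2 * I = 2 * (2 / e) by move/(mulfI _) => ->//; rewrite pnatr_eq0.
  by rewrite mulr_natl mulr2n h0; field; rewrite gt_eqF.
by move/addrI.
Qed.

Lemma Rintegral_sin_laplace e t : 0 < e ->
  \int[mu]_s (sin (t * s) * laplace e s) = 0.
Proof.
move=> e0; set I := LHS.
have N1 : -1 != 0 :> R by rewrite oppr_eq0 oner_eq0.
suff : I = - I by move=> h; lra.
rewrite {1}/I (transports_Rintegral (affine_transports 0 N1)); last first.
  by apply: integrableR_measurable; exact: integrable_sin_laplace.
rewrite -[RHS]mulN1r -RintegralZl//; last exact: integrable_sin_laplace.
apply: eq_Rintegral => s _ /=.
by rewrite normrN1 mulr1 add0r mulN1r mulrN sinN /laplace normrN mulN1r mulNr.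
Qed.

End laplace_kernel.

Section planar_kernels.
Variable R : realType.
Local Notation mu := (@lebesgue_measure R).
Local Notation mu2 := (@leb2 R).
Implicit Types (e : R) (z xi : R * R).

Definition laplace2 e xi : R := laplace e xi.1 * laplace e xi.2.

Definition poisson2 e z : R := poisson e z.1 * poisson e z.2.

Lemma laplace2_ge0 e xi : 0 <= laplace2 e xi.
Proof. by rewrite mulr_ge0 ?laplace_ge0. Qed.

Lemma laplace2_gt0 e xi : 0 < laplace2 e xi.
Proof. by rewrite mulr_gt0// expR_gt0. Qed.

Lemma laplace2_le1 e xi : 0 <= e -> laplace2 e xi <= 1.
Proof. by move=> e0; rewrite mulr_ile1 ?laplace_ge0 ?laplace_le1. Qed.

Lemma measurable_laplace2 e : measurable_fun setT (laplace2 e).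
Proof.
have m := continuous_measurable_fun (@continuous_laplace R e).
by apply: measurable_funM; [exact: (measurableT_comp m measurable_fst)|
                            exact: (measurableT_comp m measurable_snd)].
Qed.

Lemma integrable_laplace2 e : 0 < e -> mu2.-integrable setT (EFin \o laplace2 e).
Proof.
move=> e0; exact: (Rintegrable_tensor (integrable_laplace e0) (integrable_laplace e0)).
Qed.

Lemma measurable_dot2 : measurable_fun setT (fun p : (R * R) * (R * R) => dot p.1 p.2).
Proof.
apply: measurable_funD; apply: measurable_funM.
- exact: (measurableT_comp measurable_fst measurable_fst).
- exact: (measurableT_comp measurable_fst measurable_snd).
- exact: (measurableT_comp measurable_snd measurable_fst).
- exact: (measurableT_comp measurable_snd measurable_snd).
Qed.

Lemma measurable_dot z : measurable_fun setT (dot z).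
Proof. exact: (measurableT_comp measurable_dot2 (pair1_measurable z)). Qed.

Lemma measurable_cos_dot z : measurable_fun setT (fun xi => cos (dot z xi)).
Proof.
exact: (measurableT_comp (continuous_measurable_fun (@continuous_cos R)) (measurable_dot z)).
Qed.

Lemma measurable_sin_dot z : measurable_fun setT (fun xi => sin (dot z xi)).
Proof.
exact: (measurableT_comp (continuous_measurable_fun (@continuous_sin R)) (measurable_dot z)).
Qed.

Lemma dotC (a b : R * R) : dot a b = dot b a.
Proof. by rewrite /dot (mulrC a.1) (mulrC a.2). Qed.

Lemma dotBl (a b c : R * R) : dot (a - b) c = dot a c - dot b c.
Proof. by rewrite /dot /=; ring. Qed.

(** [cos (z.xi)] is a difference of tensor products, and the product of sines
    integrates to [0] by oddness. *)
Lemma Rintegral_cos_laplace2 e z : 0 < e ->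
  \int[mu2]_xi (cos (dot z xi) * laplace2 e xi) = poisson2 e z.
Proof.
move=> e0.
have ic t := integrable_cos_laplace t e0.
have is_ t := integrable_sin_laplace t e0.
transitivity (\int[mu2]_xi (
    (cos (z.1 * xi.1) * laplace e xi.1) * (cos (z.2 * xi.2) * laplace e xi.2) -
    (sin (z.1 * xi.1) * laplace e xi.1) * (sin (z.2 * xi.2) * laplace e xi.2))).
  by apply: eq_Rintegral => xi _; rewrite /dot cosD /laplace2; ring.
rewrite RintegralB//; last 2 first.
- exact: (Rintegrable_tensor (ic z.1) (ic z.2)).
- exact: (Rintegrable_tensor (is_ z.1) (is_ z.2)).
rewrite /leb2 (Rintegral_tensor (ic z.1) (ic z.2)) (Rintegral_tensor (is_ z.1) (is_ z.2)).
by rewrite !Rintegral_cos_laplace// !Rintegral_sin_laplace// mulr0 subr0.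
Qed.

Lemma poisson_ge0 e (t : R) : 0 <= e -> 0 <= poisson e t.
Proof. by move=> e0; rewrite divr_ge0 ?mulr_ge0// addr_ge0 ?sqr_ge0. Qed.

Lemma poisson2_ge0 e z : 0 <= e -> 0 <= poisson2 e z.
Proof. by move=> e0; rewrite mulr_ge0 ?poisson_ge0. Qed.

Lemma measurable_poisson e : measurable_fun setT (poisson e).
Proof.
apply: measurable_funM => //; apply: measurable_funV_ge0 => [t|].
  by rewrite addr_ge0 ?sqr_ge0.
by apply: measurable_funD => //; exact: measurable_funX.
Qed.

Lemma poisson_scale e (t : R) : 0 < e -> poisson e (0 + e * t) * e = 2 * (1 + t ^+ 2)^-1.
Proof.
move=> e0; rewrite /poisson add0r.
have t0 : 0 < 1 + t ^+ 2 by rewrite ltr_wpDr ?sqr_ge0.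
have et0 : 0 < e ^+ 2 + (e * t) ^+ 2 by rewrite ltr_wpDr ?sqr_ge0 ?exprn_gt0.
by field; rewrite !gt_eqF.
Qed.

Let poisson_tr e : 0 < e -> (fun t => poisson e (0 + e * t) * cst `|e| t) =
  (fun t => 2 * (1 + t ^+ 2)^-1).
Proof. by move=> e0; apply/funext => t; rewrite /= gtr0_norm// poisson_scale. Qed.

Lemma integrable_poisson e : 0 < e -> mu.-integrable setT (EFin \o poisson e).
Proof.
move=> e0; have e0' : e != 0 by rewrite gt_eqF.
apply/(transports_Rintegrable (affine_transports 0 e0')).
  exact: measurable_poisson.
rewrite poisson_tr//; apply: RintegrableZl => //; exact: integrable_oneDsqV.
Qed.

Lemma Rintegral_poisson e : 0 < e -> \int[mu]_t poisson e t = 2 * pi.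
Proof.
move=> e0; have e0' : e != 0 by rewrite gt_eqF.
rewrite (transports_Rintegral (affine_transports 0 e0')); last exact: measurable_poisson.
rewrite poisson_tr// RintegralZl//; last exact: integrable_oneDsqV.
by rewrite Rintegral_oneDsqV.
Qed.

Lemma measurable_poisson2 e : measurable_fun setT (poisson2 e).
Proof.
by apply: measurable_funM;
  [exact: (measurableT_comp (measurable_poisson e) measurable_fst)|
   exact: (measurableT_comp (measurable_poisson e) measurable_snd)].
Qed.

Lemma integrable_poisson2 e : 0 < e -> mu2.-integrable setT (EFin \o poisson2 e).
Proof.
move=> e0; exact: (Rintegrable_tensor (integrable_poisson e0) (integrable_poisson e0)).
Qed.

Lemma Rintegral_poisson2 e : 0 < e -> \int[mu2]_z poisson2 e z = (2 * pi) ^+ 2.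
Proof.
move=> e0; rewrite /leb2.
by rewrite (Rintegral_tensor (integrable_poisson e0) (integrable_poisson e0))
           Rintegral_poisson.
Qed.

Lemma poisson_le e (t : R) : 0 < e -> poisson e t <= 2 / e.
Proof.
move=> e0; rewrite /poisson ler_pdivrMr ?ltr_wpDr ?sqr_ge0 ?exprn_gt0//.
rewrite mulrDr (_ : 2 / e * e ^+ 2 = 2 * e); last by field; rewrite gt_eqF.
by rewrite lerDl mulr_ge0 ?sqr_ge0// divr_ge0// ltW.
Qed.

(** A majorant, of integral independent of [e], of the square of the planar
    Poisson kernel away from the square of side [2], up to the factor [e]. *)
Definition poisson_tail e z : R :=
  32 * ((1 + z.1 ^+ 2)^-1 * poisson e z.2 + poisson e z.1 * (1 + z.2 ^+ 2)^-1).

Lemma poisson_tail_ge0 e z : 0 <= e -> 0 <= poisson_tail e z.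
Proof.
by move=> e0; rewrite mulr_ge0// addr_ge0// mulr_ge0 ?poisson_ge0// invr_ge0
  addr_ge0// sqr_ge0.
Qed.

Lemma integrable_poisson_tail e : 0 < e ->
  mu2.-integrable setT (EFin \o poisson_tail e).
Proof.
move=> e0; apply: RintegrableZl => //; apply: RintegrableD => //.
- exact: (Rintegrable_tensor (integrable_oneDsqV R) (integrable_poisson e0)).
- exact: (Rintegrable_tensor (integrable_poisson e0) (integrable_oneDsqV R)).
Qed.

Lemma Rintegral_poisson_tail e : 0 < e ->
  \int[mu2]_z poisson_tail e z = 128 * pi ^+ 2.
Proof.
move=> e0.
have i1 := Rintegrable_tensor (integrable_oneDsqV R) (integrable_poisson e0).
have i2 := Rintegrable_tensor (integrable_poisson e0) (integrable_oneDsqV R).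
rewrite RintegralZl//; last exact: RintegrableD.
rewrite RintegralD// /leb2.
rewrite (Rintegral_tensor (integrable_oneDsqV R) (integrable_poisson e0)).
rewrite (Rintegral_tensor (integrable_poisson e0) (integrable_oneDsqV R)).
by rewrite Rintegral_oneDsqV Rintegral_poisson//; ring.
Qed.

(** In a far coordinate the kernel is [O(e / (1 + t ^ 2))], in the other one it
    is at most [2 / e]: in the square of the product, one factor [e] is left. *)
Lemma poisson2_sqr_tail e z : 0 < e -> 1 <= `|z.1| \/ 1 <= `|z.2| ->
  poisson2 e z ^+ 2 <= e * poisson_tail e z.
Proof.
move=> e0.
have far (s t : R) : 1 <= `|s| ->
    (poisson e s * poisson e t) ^+ 2 <= e * (32 * ((1 + s ^+ 2)^-1 * poisson e t)).
  move=> s1.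
  have s2 : 1 <= s ^+ 2 by rewrite -real_normK ?num_real// expr_ge1.
  have ps : poisson e s <= 4 * e * (1 + s ^+ 2)^-1.
    rewrite /poisson -mulrA -[leRHS]mulrA.
    rewrite (_ : 4 * (e * (1 + s ^+ 2)^-1) = 2 * (e * (2 * (1 + s ^+ 2)^-1))); last by ring.
    rewrite ler_wpM2l// ler_wpM2l ?(ltW e0)//.
    rewrite -[2 * _]invrK invrM ?unitfE ?invr_eq0 ?gt_eqF ?ltr_pwDl ?sqr_ge0//.
    rewrite invrK lef_pV2 ?posrE ?mulr_gt0 ?ltr_pwDl ?sqr_ge0//; last first.
      by rewrite exprn_gt0.
    have := exprn_gt0 2 e0; lra.
  have r1 : (1 + s ^+ 2)^-1 <= 1 by rewrite invf_le1 ?lerDl ?ltr_pwDl ?sqr_ge0.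
  have r0 : 0 <= (1 + s ^+ 2)^-1 by rewrite invr_ge0 addr_ge0// sqr_ge0.
  have pt := poisson_le t e0.
  have [ps0 pt0] := (poisson_ge0 s (ltW e0), poisson_ge0 t (ltW e0)).
  rewrite exprMn (_ : _ * (32 * _) =
      (16 * e ^+ 2 * (1 + s ^+ 2)^-1) * (2 / e * poisson e t)); last first.
    by field; rewrite gt_eqF// gt_eqF// ltr_pwDl ?sqr_ge0.
  apply: ler_pM; rewrite ?sqr_ge0//; last by rewrite expr2 ler_wpM2r.
  apply: (@le_trans _ _ ((4 * e * (1 + s ^+ 2)^-1) ^+ 2)).
    by rewrite lerXn2r ?nnegrE// !mulr_ge0// ltW.
  rewrite exprMn exprMn (_ : 4 ^+ 2 = 16); last by ring.
  apply: ler_wpM2l; first by rewrite mulr_ge0// sqr_ge0.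
  by rewrite expr2 ler_piMl.
have nn (s t : R) : 0 <= (1 + s ^+ 2)^-1 * poisson e t.
  by rewrite mulr_ge0 ?poisson_ge0 ?(ltW e0)// invr_ge0 addr_ge0// sqr_ge0.
rewrite /poisson2 /poisson_tail; case=> /far h.
- apply: le_trans (h z.2) _.
  by rewrite ler_wpM2l ?(ltW e0)// ler_wpM2l// lerDl mulrC nn.
- rewrite [poisson e z.1 * _]mulrC; apply: le_trans (h z.1) _.
  by rewrite ler_wpM2l ?(ltW e0)// ler_wpM2l// [poisson e z.1 * _]mulrC lerDr nn.
Qed.

End planar_kernels.

(** * Fourier inversion for continuous square-integrable functions *)

Section square_integrable.
Context d (T : measurableType d) (R : realType).
Variable mu : {measure set T -> \bar R}.
Implicit Types u v : T -> R.

Lemma Lfun2_measurable u : u \in Lfun mu 2%:E -> measurable_fun setT u.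
Proof. by rewrite inE => /andP[]; rewrite inE. Qed.

Lemma Lfun2_Lnorm_lty u : u \in Lfun mu 2%:E -> ('N[mu]_2%:E[EFin \o u] < +oo)%E.
Proof. by rewrite inE => /andP[_]; rewrite inE. Qed.

Lemma integrable_sqr_Lfun2 u : measurable_fun setT u ->
  mu.-integrable setT (EFin \o (fun x => u x ^+ 2)) -> u \in Lfun mu 2%:E.
Proof.
move=> mu_ /integrableP[_ iu]; rewrite inE; apply/andP; split; rewrite inE//=.
rewrite /finite_norm unlock /=.
apply: poweR_lty; apply: le_lt_trans iu.
rewrite le_eqVlt; apply/orP; left; apply/eqP; apply: eq_integral => x _ /=.
by rewrite powR_mulrn// normrX.
Qed.

Lemma bounded_integrable_Lfun2 u (M : R) : (forall x, 0 <= u x <= M) ->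
  mu.-integrable setT (EFin \o u) -> u \in Lfun mu 2%:E.
Proof.
move=> uM iu; have mu_ := integrableR_measurable iu.
apply: integrable_sqr_Lfun2 => //.
apply: (le_Rintegrable measurableT (g := fun x => M * u x)) => //.
- exact: measurable_funX.
- move=> x _; have /andP[u0 uM'] := uM x.
  by rewrite normrX ger0_norm// expr2 ler_wpM2r.
- exact: RintegrableZl.
Qed.

Lemma Lfun2_integrableM u v : u \in Lfun mu 2%:E -> v \in Lfun mu 2%:E ->
  mu.-integrable setT (EFin \o (fun x => u x * v x)).
Proof. by move=> hu hv; apply/Lfun1_integrable; exact: Lfun2_mul_Lfun1. Qed.

Lemma Lfun2_cvg_integral (u_ : (T -> R)^nat) u v :
  (forall n, measurable_fun setT (u_ n)) ->
  (forall n, mu.-integrable setT (EFin \o (fun x => u_ n x * v x))) ->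
  u \in Lfun mu 2%:E -> v \in Lfun mu 2%:E ->
  ('N[mu]_2%:E[EFin \o (u_ n \- u)%R] @[n --> \oo] --> 0)%E ->
  (\int[mu]_x (u_ n x * v x))%R @[n --> \oo] --> \int[mu]_x (u x * v x).
Proof.
move=> mu_ iu_ hu hv cu.
have iuv := Lfun2_integrableM hu hv.
have [mu0 mv] := (Lfun2_measurable hu, Lfun2_measurable hv).
have idiff n : mu.-integrable setT (EFin \o (fun x => (u_ n x - u x) * v x)).
  apply: eq_integrable (integrableB _ (iu_ n) iuv) => //.
  by move=> x _ /=; rewrite -EFinD mulrBl.
have Nv : ('N[mu]_2%:E[EFin \o v])%E \is a fin_num.
  by rewrite ge0_fin_numE ?Lnorm_ge0// Lfun2_Lnorm_lty.
have key n : (`|\int[mu]_x (u_ n x * v x) - \int[mu]_x (u x * v x)|%:E <=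
    'N[mu]_2%:E[EFin \o (u_ n \- u)%R] * 'N[mu]_2%:E[EFin \o v])%E.
  rewrite -RintegralB//.
  have -> : \int[mu]_x (u_ n x * v x - u x * v x) = \int[mu]_x ((u_ n x - u x) * v x).
    by apply: eq_Rintegral => x _; rewrite mulrBl.
  rewrite EFin_normr_Rintegral//.
  apply: le_trans (le_abse_integral _ _ _) _ => //.
    by case/integrableP: (idiff n).
  have := @hoelder _ _ _ mu (u_ n \- u)%R v 2 2.
  rewrite Lnorm1; apply => //; first exact: measurable_funB.
  by rewrite [RHS]splitr !div1r.
have c0 : ('N[mu]_2%:E[EFin \o (u_ n \- u)%R] * 'N[mu]_2%:E[EFin \o v])%E
    @[n --> \oo] --> 0%E.
  rewrite -(mul0e ('N[mu]_2%:E[EFin \o v])%E); apply: cvgeM => //; last exact: cvg_cst.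
  by rewrite mule_def_fin.
apply/cvgrPdist_le => e e0.
have /fine_cvgP[fin] := c0; move/cvgr0Pnorm_le => /(_ e e0) h.
near=> n; rewrite -lee_fin distrC; apply: le_trans (key n) _.
have fn : ('N[mu]_2%:E[EFin \o (u_ n \- u)%R] * 'N[mu]_2%:E[EFin \o v])%E \is a fin_num.
  by near: n.
rewrite -(fineK fn) lee_fin; apply: le_trans (ler_norm _) _.
by near: n.
Unshelve. all: by end_near. Qed.

End square_integrable.

Section fourier_inversion.
Variable R : realType.
Local Notation mu := (@lebesgue_measure R).
Local Notation mu2 := (@leb2 R).
Implicit Types (e : R) (x y z xi : R * R) (f h : R * R -> R).

Lemma continuous_enorm : continuous (@enorm R).
Proof.
move=> x; apply: continuous_comp; last exact: sqrt_continuous.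
by apply: cvgD; apply: cvgM; first [exact: cvg_fst|exact: cvg_snd].
Qed.

Lemma measurable_enorm : measurable_fun setT (@enorm R).
Proof. exact: continuous_measurable2 continuous_enorm. Qed.

Lemma normr_fst_enorm x : `|x.1| <= enorm x.
Proof.
by rewrite -sqrtr_sqr ler_wsqrtr// /dot expr2 lerDl -expr2 sqr_ge0.
Qed.

Lemma normr_snd_enorm x : `|x.2| <= enorm x.
Proof.
by rewrite -sqrtr_sqr ler_wsqrtr// /dot expr2 lerDr -expr2 sqr_ge0.
Qed.

Definition box x (r : R) : set (R * R) :=
  [set y | `|y.1 - x.1| <= r /\ `|y.2 - x.2| <= r].

Lemma boxE x r : box x r = `[x.1 - r, x.1 + r] `*` `[x.2 - r, x.2 + r].
Proof.
by rewrite /box; apply/seteqP; split => -[u v] /=; rewrite !in_itv/= !ler_distl => -[-> ->].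
Qed.

Lemma measurable_box x r : measurable (box x r).
Proof. by rewrite boxE; exact: measurableX. Qed.

Lemma continuous_bounded_box f x r : continuous f ->
  exists2 M, 0 <= M & forall y, box x r y -> `|f y| <= M.
Proof.
move=> cf.
have : compact (f @` box x r).
  apply: continuous_compact; first exact: continuous_subspaceT.
  by rewrite boxE; apply: compact_setX; exact: segment_compact.
move=> /compact_bounded [M [_ hM]]; exists (`|M| + 1) => // y by_.
by apply: (hM (`|M| + 1)); [rewrite ltr_pwDr// ler_norm|exists y].
Qed.

Lemma integrable_indic_box x r : mu2.-integrable setT (EFin \o \1_(box x r)).
Proof.
apply: eq_integrable (Rintegrable_tensor
  (integrable_indic_itv (x.1 - r) (x.1 + r) true false)
  (integrable_indic_itv (x.2 - r) (x.2 + r) true false)) => //.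
by case=> u v _; rewrite /= boxE !indicE in_setX -natrM mulnb.
Qed.

Lemma bounded_box_integrable f x r (M : R) : measurable_fun setT f ->
  (forall y, `|f y| <= M * \1_(box x r) y) -> mu2.-integrable setT (EFin \o f).
Proof.
move=> mf fM.
apply: (@le_Rintegrable _ _ R mu2 setT measurableT f (fun y => M * \1_(box x r) y)) => //.
by apply: RintegrableZl => //; exact: integrable_indic_box.
Qed.

Lemma continuous_restrict_integrable f (B : set (R * R)) x r : continuous f ->
  measurable B -> B `<=` box x r ->
  exists2 M, mu2.-integrable setT (EFin \o (f \_ B)) & forall y, `|(f \_ B) y| <= M.
Proof.
move=> cf mB Bbox; have [M M0 fM] := continuous_bounded_box x r cf.
have le y : `|(f \_ B) y| <= M * \1_(box x r) y.
  rewrite patchE; case: ifPn => [/set_mem By|_].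
    by rewrite indicE mem_set ?mulr1; [exact/fM/Bbox|exact: Bbox].
  by rewrite normr0 mulr_ge0.
exists M => [|y]; last first.
  by apply: le_trans (le y) _; rewrite ler_piMr// indicE; case: (_ \in _).
apply: bounded_box_integrable le.
apply/(measurable_restrictT _ _).1 => //.
by apply: measurable_funTS; exact: continuous_measurable2.
Qed.

Lemma integrable_trig_dot (trig : R -> R) (k : R * R -> R) x :
  continuous trig -> (forall t, `|trig t| <= 1) ->
  mu2.-integrable setT (EFin \o k) ->
  mu2.-integrable setT (EFin \o (fun y => trig (dot x y) * k y)).
Proof.
move=> ct t1 ik; apply: RintegrableM => //.
exact: (measurableT_comp (continuous_measurable_fun ct) (measurable_dot x)).
Qed.

Lemma integrable_trig_dotC (trig : R -> R) (k : R * R -> R) x :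
  continuous trig -> (forall t, `|trig t| <= 1) ->
  mu2.-integrable setT (EFin \o k) ->
  mu2.-integrable setT (EFin \o (fun y => k y * trig (dot y x))).
Proof.
move=> ct t1 /(integrable_trig_dot x ct t1); apply: eq_integrable => // y _ /=.
by rewrite dotC mulrC.
Qed.

Section integrable_transform.
Variable h : R * R -> R.
Hypothesis ih : mu2.-integrable setT (EFin \o h).

(** The transform of [h] alone is not integrable in [xi]; with the weight the
    double integral converges absolutely. *)
Lemma weighted_double_integrable e (k : (R * R) * (R * R) -> R) : 0 < e ->
  measurable_fun setT k -> (forall p, `|k p| <= 1) ->
  (mu2 \x mu2)%E.-integrable setT (EFin \o (fun p => k p * (laplace2 e p.1 * h p.2))).
Proof.
by move=> e0 mk k1; apply: (Rintegrable_tensorM _ _ (integrable_laplace2 e0) ih).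
Qed.

Lemma trig_transform_integrable (trig : R -> R) e : continuous trig ->
  (forall t, `|trig t| <= 1) -> 0 < e ->
  mu2.-integrable setT
    (EFin \o (fun xi => \int[mu2]_y (h y * trig (dot y xi)) * laplace2 e xi)).
Proof.
move=> ct t1 e0.
have mk : measurable_fun setT (fun p : (R * R) * (R * R) => trig (dot p.1 p.2)).
  exact: (measurableT_comp (continuous_measurable_fun ct) (@measurable_dot2 R)).
have isec xi : mu2.-integrable setT
    (fun y => (trig (dot xi y) * (laplace2 e xi * h y))%:E).
  exact: (integrable_trig_dot xi ct t1 (RintegrableZl measurableT (laplace2 e xi) ih)).
have := Rintegrable_fubini_F (weighted_double_integrable e0 mk (fun p => t1 _)) isec.
apply: eq_integrable => // xi _ /=; congr EFin.
rewrite mulrC -RintegralZl//; last exact: integrable_trig_dotC.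
by apply: eq_Rintegral => y _; rewrite dotC; ring.
Qed.

Lemma measurable_trig_transform (trig : R -> R) : continuous trig ->
  (forall t, `|trig t| <= 1) ->
  measurable_fun setT (fun xi => \int[mu2]_y (h y * trig (dot y xi))).
Proof.
move=> ct t1.
(* the weight is positive: it may be divided out after the Fubini theorem *)
rewrite (_ : (fun xi => _) = (fun xi => (\int[mu2]_y (h y * trig (dot y xi)) *
    laplace2 1 xi) * (laplace2 1 xi)^-1)); last first.
  by apply/funext => xi; rewrite mulfK// gt_eqF// laplace2_gt0.
apply: measurable_funM.
  exact: (integrableR_measurable (trig_transform_integrable ct t1 ltr01)).
by apply: measurable_funV_ge0; [exact: laplace2_ge0|exact: measurable_laplace2].
Qed.

Lemma measurable_cos_difference x :
  measurable_fun setT (fun p : (R * R) * (R * R) => cos (dot (x - p.2) p.1)).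
Proof.
have mxy : measurable_fun setT (fun p : (R * R) * (R * R) => x - p.2).
  apply: (measurable_fun_pair (f := fun p : (R * R) * (R * R) => x.1 - p.2.1)
                              (g := fun p : (R * R) * (R * R) => x.2 - p.2.2)).
  - apply: measurable_funB => //; exact: (measurableT_comp measurable_fst measurable_snd).
  - apply: measurable_funB => //; exact: (measurableT_comp measurable_snd measurable_snd).
exact: (measurableT_comp (continuous_measurable_fun (@continuous_cos R))
  (measurableT_comp (@measurable_dot2 R) (measurable_fun_pair mxy measurable_fst))).
Qed.

Lemma cos_difference_fubini e x : 0 < e ->
  \int[mu2]_xi \int[mu2]_y (cos (dot (x - y) xi) * (laplace2 e xi * h y)) =
  \int[mu2]_y (h y * poisson2 e (x - y)).
Proof.
move=> e0.
have ik := weighted_double_integrable e0 (measurable_cos_difference x)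
  (fun p => normr_cos_le1 _).
have ik1 xi : mu2.-integrable setT
    (fun y => (cos (dot (x - y) xi) * (laplace2 e xi * h y))%:E).
  apply: RintegrableM => //; last exact: RintegrableZl.
    exact: (measurableT_comp (measurable_cos_difference x) (pair1_measurable xi)).
  by move=> y _; exact: normr_cos_le1.
have ik2 y : mu2.-integrable setT
    (fun xi => (cos (dot (x - y) xi) * (laplace2 e xi * h y))%:E).
  under eq_fun do rewrite (mulrC (laplace2 _ _)).
  apply: (integrable_trig_dot _ (@continuous_cos R) (@normr_cos_le1 R)).
  by apply: RintegrableZl => //; exact: integrable_laplace2.
rewrite -(Rintegral_prod12 ik ik1) (Rintegral_prod21 ik ik2).
apply: eq_Rintegral => y _; rewrite -Rintegral_cos_laplace2// -RintegralZl//.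
  by apply: eq_Rintegral => xi _ /=; ring.
exact: (integrable_trig_dot _ (@continuous_cos R) (@normr_cos_le1 R)
  (integrable_laplace2 e0)).
Qed.

Lemma cos_differenceE e x xi :
  \int[mu2]_y (h y * cos (dot y xi)) * (cos (dot x xi) * laplace2 e xi) +
  \int[mu2]_y (h y * sin (dot y xi)) * (sin (dot x xi) * laplace2 e xi) =
  \int[mu2]_y (cos (dot (x - y) xi) * (laplace2 e xi * h y)).
Proof.
have ic := integrable_trig_dotC xi (@continuous_cos R) (@normr_cos_le1 R) ih.
have is_ := integrable_trig_dotC xi (@continuous_sin R) (@normr_sin_le1 R) ih.
have icZ := RintegrableZl measurableT (cos (dot x xi) * laplace2 e xi) ic.
have isZ := RintegrableZl measurableT (sin (dot x xi) * laplace2 e xi) is_.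
rewrite [X in X + _]mulrC [X in _ + X]mulrC.
rewrite -(RintegralZl _ measurableT ic) -(RintegralZl _ measurableT is_).
rewrite -(RintegralD measurableT icZ isZ).
by apply: eq_Rintegral => y _; rewrite dotBl cosB; ring.
Qed.

(** The weighted inverse transform of the transform of [h] is the convolution
    of [h] with the Poisson kernel: this is the exchange of the integrals in
    [y] and [xi], where [cos (x.xi) cos (y.xi) + sin (x.xi) sin (y.xi)] is
    [cos ((x - y).xi)]. *)
Lemma laplace_inverse_transform e x : 0 < e ->
  \int[mu2]_xi (\int[mu2]_y (h y * cos (dot y xi)) * (cos (dot x xi) * laplace2 e xi)) +
  \int[mu2]_xi (\int[mu2]_y (h y * sin (dot y xi)) * (sin (dot x xi) * laplace2 e xi)) =
  \int[mu2]_y (h y * poisson2 e (x - y)).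
Proof.
move=> e0.
have weighted (trig : R -> R) : continuous trig -> (forall t, `|trig t| <= 1) ->
    mu2.-integrable setT (EFin \o (fun xi =>
      \int[mu2]_y (h y * trig (dot y xi)) * (trig (dot x xi) * laplace2 e xi))).
  move=> ct t1.
  have := integrable_trig_dot x ct t1 (trig_transform_integrable ct t1 e0).
  by apply: eq_integrable => // xi _ /=; rewrite mulrCA.
rewrite -(RintegralD measurableT (weighted _ (@continuous_cos R) (@normr_cos_le1 R))
  (weighted _ (@continuous_sin R) (@normr_sin_le1 R))) -cos_difference_fubini//.
by apply: eq_Rintegral => xi _; exact: cos_differenceE.
Qed.

End integrable_transform.
End fourier_inversion.

Section inversion_limits.
Variable R : realType.
Local Notation mu := (@lebesgue_measure R).
Local Notation mu2 := (@leb2 R).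
Implicit Types (e : R) (x y z xi : R * R).

Let N10 : -1 != 0 :> R.
Proof. by rewrite oppr_eq0 oner_eq0. Qed.

Lemma reflect2_integrable x (k : R * R -> R) : mu2.-integrable setT (EFin \o k) ->
  mu2.-integrable setT (EFin \o (fun y => k (x - y))).
Proof.
move=> ik; have mk := integrableR_measurable ik.
have := (transports_Rintegrable (affine2_transports x N10) mk).1 ik.
apply: eq_integrable => // y _ /=.
by rewrite normrN1 !mulr1 scaleN1r.
Qed.

Lemma reflect2_Rintegral x (k : R * R -> R) : mu2.-integrable setT (EFin \o k) ->
  \int[mu2]_y k (x - y) = \int[mu2]_y k y.
Proof.
move=> ik; have mk := integrableR_measurable ik.
rewrite [RHS](transports_Rintegral (affine2_transports x N10) mk).
by apply: eq_Rintegral => y _ /=; rewrite normrN1 !mulr1 scaleN1r.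
Qed.

Lemma laplace2_trig_Lfun2 e x (trig : R -> R) : 0 < e -> continuous trig ->
  (forall t, `|trig t| <= 1) ->
  (fun xi => trig (dot x xi) * laplace2 e xi) \in Lfun mu2 2%:E.
Proof.
move=> e0 ct t1.
have mt : measurable_fun setT (fun xi => trig (dot x xi)).
  exact: (measurableT_comp (continuous_measurable_fun ct) (measurable_dot x)).
apply: integrable_sqr_Lfun2.
  by apply: measurable_funM; [exact: mt|exact: measurable_laplace2].
apply: (@le_Rintegrable _ _ R mu2 setT measurableT _ (laplace2 e)).
- by apply: measurable_funX; apply: measurable_funM;
    [exact: mt|exact: measurable_laplace2].
- move=> xi _; rewrite normrX normrM (ger0_norm (laplace2_ge0 _ _)) exprMn.
  have h1 : `|trig (dot x xi)| ^+ 2 <= 1 by rewrite expr_le1.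
  apply: (@le_trans _ _ (laplace2 e xi ^+ 2)).
    by rewrite ler_piMl ?sqr_ge0.
  by rewrite expr2 ler_piMr ?laplace2_ge0// laplace2_le1// ltW.
- exact: integrable_laplace2.
Qed.

Lemma poisson2_Lfun2 e x : 0 < e -> (fun y => poisson2 e (x - y)) \in Lfun mu2 2%:E.
Proof.
move=> e0; apply: (bounded_integrable_Lfun2 (M := (2 / e) ^+ 2)); last first.
  by apply: (@reflect2_integrable x (poisson2 e)); exact: integrable_poisson2.
move=> y; rewrite poisson2_ge0 ?(ltW e0)//= expr2.
by apply: ler_pM; rewrite ?poisson_ge0 ?poisson_le// ltW.
Qed.

Lemma measurable_ball_enorm (n : nat) : measurable [set x : R * R | enorm x <= n%:R].
Proof.
have := @measurable_enorm R measurableT _ (measurable_itv `]-oo, (n%:R : R)]).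
by rewrite setTI; congr measurable.
Qed.

Lemma ball_enorm_box (n : nat) : [set x : R * R | enorm x <= n%:R] `<=` box 0 n%:R.
Proof.
move=> x /= xn; split; rewrite subr0.
- exact: le_trans (normr_fst_enorm x) xn.
- exact: le_trans (normr_snd_enorm x) xn.
Qed.

Section truncation.
Variables (f : R * R -> R) (n : nat).
Hypothesis cf : continuous f.

Definition truncate : R * R -> R := f \_ [set x | enorm x <= n%:R].

Lemma truncateE y : truncate y = if enorm y <= n%:R then f y else 0.
Proof.
rewrite /truncate patchE; case: ifPn => [/set_mem /= -> //|/negP yn].
by rewrite ifF//; apply/negP => yn'; apply: yn; exact: mem_set.
Qed.

Lemma truncate_integrable : mu2.-integrable setT (EFin \o truncate).
Proof.
by have [] := continuous_restrict_integrable cf (measurable_ball_enorm n)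
  (@ball_enorm_box n).
Qed.

Lemma fourier_cosE xi :
  fourier_cos n f xi = \int[mu2]_y (truncate y * cos (dot y xi)).
Proof.
rewrite /fourier_cos Rintegral_mkcond; apply: eq_Rintegral => y _.
by rewrite /truncate !patchE; case: ifP => // _; rewrite mul0r.
Qed.

Lemma fourier_sinE xi :
  fourier_sin n f xi = \int[mu2]_y (truncate y * sin (dot y xi)).
Proof.
rewrite /fourier_sin Rintegral_mkcond; apply: eq_Rintegral => y _.
by rewrite /truncate !patchE; case: ifP => // _; rewrite mul0r.
Qed.

End truncation.

Section trig_limit.
Variables (f : R * R -> R) (trig : R -> R).
Hypotheses (cf : continuous f) (ct : continuous trig).
Hypothesis t1 : forall t, `|trig t| <= 1.

Lemma trig_transform_cvg (a : R * R -> R) e x : 0 < e -> L2 a ->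
  ('N[mu2]_2%:E[EFin \o
    ((fun xi => \int[mu2]_y (truncate f n y * trig (dot y xi))) \- a)%R]
    @[n --> \oo] --> 0)%E ->
  (\int[mu2]_xi (\int[mu2]_y (truncate f n y * trig (dot y xi)) *
    (trig (dot x xi) * laplace2 e xi)))%R @[n --> \oo] -->
  \int[mu2]_xi (a xi * (trig (dot x xi) * laplace2 e xi)).
Proof.
move=> e0 L2a ca; apply: Lfun2_cvg_integral.
- by move=> n; exact: (measurable_trig_transform (truncate_integrable n cf) ct t1).
- move=> n; under eq_fun do rewrite mulrCA.
  apply: (integrable_trig_dot x ct t1).
  exact: (trig_transform_integrable (truncate_integrable n cf) ct t1).
- exact: L2a.
- exact: laplace2_trig_Lfun2.
- exact: ca.
Qed.

End trig_limit.

Lemma truncate_poisson_cvg (f : R * R -> R) e x : 0 < e -> continuous f -> L2 f ->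
  (\int[mu2]_y (truncate f n y * poisson2 e (x - y)))%R @[n --> \oo] -->
    \int[mu2]_y (f y * poisson2 e (x - y)).
Proof.
move=> e0 cf L2f.
have ifp := Lfun2_integrableM L2f (poisson2_Lfun2 x e0).
apply: (@Rintegral_dominated_cvg _ _ R mu2 setT measurableT _ _
    (fun y => `|f y * poisson2 e (x - y)|) _ _ _ _).2.
- move=> n; apply: measurable_funM.
    exact: integrableR_measurable (truncate_integrable n cf).
  exact: Lfun2_measurable (poisson2_Lfun2 x e0).
- move=> y _; apply: cvgM; last exact: cvg_cst.
  apply: cvg_near_cst; near=> n; rewrite truncateE ifT//.
  by near: n; exact: nbhs_infty_ger.
- exact: integrable_norm.
- move=> n y _; rewrite truncateE; case: ifP => _//.
  by rewrite mul0r normr0.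
Unshelve. all: by end_near. Qed.

(** The truncated transforms converge in [L^2], which is enough to integrate
    them against the square-integrable weights, while the truncations of [f]
    converge dominatedly against the Poisson kernel. *)
Lemma laplace_inverse_fourier (f a b : R * R -> R) e x : 0 < e ->
  continuous f -> L2 f -> fourier_transform f a b -> L2 a -> L2 b ->
  \int[mu2]_xi (a xi * (cos (dot x xi) * laplace2 e xi)) +
  \int[mu2]_xi (b xi * (sin (dot x xi) * laplace2 e xi)) =
  \int[mu2]_y (f y * poisson2 e (x - y)).
Proof.
move=> e0 cf L2f [ca cb] L2a L2b.
have ca' : ('N[mu2]_2%:E[EFin \o
    ((fun xi => \int[mu2]_y (truncate f n y * cos (dot y xi))) \- a)%R]
    @[n --> \oo] --> 0)%E.
  apply: cvg_trans ca; apply: near_eq_cvg; apply: nearW => n.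
  by rewrite (funext (fourier_cosE f n)).
have cb' : ('N[mu2]_2%:E[EFin \o
    ((fun xi => \int[mu2]_y (truncate f n y * sin (dot y xi))) \- b)%R]
    @[n --> \oo] --> 0)%E.
  apply: cvg_trans cb; apply: near_eq_cvg; apply: nearW => n.
  by rewrite (funext (fourier_sinE f n)).
have cvc := trig_transform_cvg (x := x) cf (@continuous_cos R) (@normr_cos_le1 R) e0 L2a ca'.
have cvs := trig_transform_cvg (x := x) cf (@continuous_sin R) (@normr_sin_le1 R) e0 L2b cb'.
have cvf := truncate_poisson_cvg (x := x) e0 cf L2f.
rewrite -(cvg_lim (@Rhausdorff R) cvf); apply/esym/(cvg_lim (@Rhausdorff R)).
apply: cvg_trans (cvgD cvc cvs); apply: near_eq_cvg; apply: nearW => n.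
by rewrite -(laplace_inverse_transform (truncate_integrable n cf)).
Qed.

End inversion_limits.

Section approximate_identity.
Variable R : realType.
Local Notation mu := (@lebesgue_measure R).
Local Notation mu2 := (@leb2 R).
Implicit Types (e : R) (x y z xi : R * R).

(** The Poisson kernel has width [eta k ^+ 2], whose square root appears in the
    estimate of the far part. *)
Let eta (k : nat) : R := (k.+1%:R)^-1.

Let eta_gt0 k : 0 < eta k.
Proof. by rewrite invr_gt0. Qed.

Let cvg_eta : eta k @[k --> \oo] --> 0.
Proof. exact: cvg_harmonic. Qed.

Let cvg_eta2 : eta k ^+ 2 @[k --> \oo] --> 0.
Proof.
rewrite -(mulr0 (0 : R)); under eq_fun do rewrite expr2.
exact: (cvgM cvg_eta cvg_eta).
Qed.

Lemma poisson2_scale e z : 0 < e -> poisson2 e (e *: z) * e ^+ 2 = poisson2 1 z.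
Proof.
move=> e0.
have s t : poisson e (e * t) * e = poisson 1 t.
  by rewrite -[e * t]add0r poisson_scale// /poisson mulr1 expr1n.
by rewrite /poisson2 /= -!s; rewrite /GRing.scale /=; ring.
Qed.

Section near_part.
Variables (h : R * R -> R) (M : R) (x : R * R).
Hypotheses (ih : mu2.-integrable setT (EFin \o h)) (hM : forall y, `|h y| <= M).
Hypothesis hx : {for x, continuous h}.

Let scaled e z := h (x - e *: z) * poisson2 1 z.

Lemma poisson_convolution_scale e : 0 < e ->
  \int[mu2]_y (h y * poisson2 e (x - y)) = \int[mu2]_z scaled e z.
Proof.
move=> e0; have Ne0 : - e != 0 by rewrite oppr_eq0 gt_eqF.
rewrite (transports_Rintegral (affine2_transports x Ne0)); last first.
  apply: measurable_funM; first exact: (integrableR_measurable ih).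
  exact: integrableR_measurable (reflect2_integrable x (integrable_poisson2 e0)).
apply: eq_Rintegral => z _ /=.
rewrite normrN gtr0_norm// -expr2 /scaled -(poisson2_scale z e0) scaleNr.
by rewrite opprB addrCA subrr addr0 mulrA.
Qed.

Lemma measurable_scaled e : e != 0 -> measurable_fun setT (scaled e).
Proof.
move=> e0; apply: measurable_funM; last exact: measurable_poisson2.
have := measurableT_comp (integrableR_measurable ih) (measurable_affine2 x (- e)).
by congr measurable_fun; apply/funext => z /=; rewrite scaleNr.
Qed.

(** After rescaling the convolution is an average of [h (x - e z)] for a fixed
    weight, and the boundedness of [h] gives the domination. *)
Lemma bounded_poisson_cvg :
  (\int[mu2]_y (h y * poisson2 (eta k ^+ 2) (x - y)))%R @[k --> \oo] -->
  (2 * pi) ^+ 2 * h x.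
Proof.
have e0 k : 0 < eta k ^+ 2 by rewrite exprn_gt0.
have -> : (2 * pi) ^+ 2 * h x = \int[mu2]_z (h x * poisson2 1 z).
  by rewrite RintegralZl ?Rintegral_poisson2// 1?mulrC//; exact: integrable_poisson2.
have cv : (\int[mu2]_z scaled (eta k ^+ 2) z)%R @[k --> \oo] -->
    \int[mu2]_z (h x * poisson2 1 z).
  apply: (@Rintegral_dominated_cvg _ _ R mu2 setT measurableT _ _
    (fun z => M * poisson2 1 z) _ _ _ _).2.
  - by move=> k; apply: measurable_scaled; rewrite gt_eqF.
  - move=> z _; apply: cvgM; last exact: cvg_cst.
    apply: (cvg_comp (fun k => x - eta k ^+ 2 *: z) h); last exact: hx.
    have : x - eta k ^+ 2 *: z @[k --> \oo] --> x - 0 *: z.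
      by apply: cvgB; [exact: cvg_cst|apply: cvgZr_tmp; exact: cvg_eta2].
    by rewrite scale0r subr0.
  - by apply: RintegrableZl => //; exact: integrable_poisson2.
  - move=> k z _; rewrite normrM (ger0_norm (poisson2_ge0 _ ler01)).
    by rewrite ler_wpM2r ?poisson2_ge0.
apply: cvg_trans cv; apply: near_eq_cvg; apply: nearW => k.
by rewrite poisson_convolution_scale.
Qed.

End near_part.

Section far_part.
Variables (h : R * R -> R) (x : R * R).
Hypotheses (L2h : L2 h) (h0 : forall y, box x 1 y -> h y = 0).

Let ih2 : mu2.-integrable setT (EFin \o (fun y => h y ^+ 2)).
Proof. exact: Lfun2_integrable_sqr. Qed.

(** With [e = s ^ 2], the inequality [2 p q <= s p ^ 2 + q ^ 2 / s] trades the
    square-integrability of [h] against that of the kernel away from [x]. *)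
Lemma far_poisson_le (s : R) y : 0 < s ->
  `|h y * poisson2 (s ^+ 2) (x - y)| <=
  s * (h y ^+ 2 + poisson_tail (s ^+ 2) (x - y)).
Proof.
move=> s0; have e0 : 0 < s ^+ 2 by rewrite exprn_gt0.
have t0 := poisson_tail_ge0 (x - y) (ltW e0).
have [/h0 ->|nbox] := pselect (box x 1 y).
  rewrite mul0r normr0 mulr_ge0// ?(ltW s0)// addr_ge0// sqr_ge0.
have far : 1 <= `|(x - y).1| \/ 1 <= `|(x - y).2|.
  have [h1|/ltW h1] := lerP 1 `|(x - y).1|; first by left.
  have [h2|/ltW h2] := lerP 1 `|(x - y).2|; first by right.
  by exfalso; apply: nbox; split; rewrite distrC.
have p2 := poisson2_sqr_tail e0 far.
have p0 := poisson2_ge0 (x - y) (ltW e0).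
rewrite normrM (ger0_norm p0) -[h y ^+ 2]real_normK ?num_real//.
move: (normr_ge0 (h y)) p2 p0 t0; set p := poisson2 _ _; set q := `|h y|.
set t := poisson_tail _ _ => q0 p2 p0 t0.
have am : 0 <= (s * q - p) ^+ 2 by rewrite sqr_ge0.
have sq : 2 * (s * (q * p)) <= s * (s * (q ^+ 2 + t)).
  rewrite sqrrB in am; rewrite mulrDr mulrDr; nra.
rewrite -(ler_pM2l s0); apply: le_trans sq.
by rewrite ler_peMl ?ler1n//; apply: mulr_ge0; [exact: ltW|exact: mulr_ge0].
Qed.

Lemma far_poisson_cvg0 :
  (\int[mu2]_y (h y * poisson2 (eta k ^+ 2) (x - y)))%R @[k --> \oo] --> 0.
Proof.
have e0 k : 0 < eta k ^+ 2 by rewrite exprn_gt0.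
pose C := \int[mu2]_y (h y ^+ 2) + 128 * pi ^+ 2.
have Ce : eta k * C @[k --> \oo] --> 0.
  by rewrite -(mul0r C); apply: cvgM; [exact: cvg_eta|exact: cvg_cst].
apply: norm_cvg0; apply: (squeeze_cvgr _ (cvg_cst 0) Ce).
apply: nearW => k; rewrite normr_ge0/=.
have itail := reflect2_integrable x (integrable_poisson_tail (e0 k)).
have ihp := Lfun2_integrableM L2h (poisson2_Lfun2 x (e0 k)).
have isum : mu2.-integrable setT (EFin \o (fun y =>
    eta k * (h y ^+ 2 + poisson_tail (eta k ^+ 2) (x - y)))).
  by apply: RintegrableZl => //; apply: RintegrableD.
apply: le_trans (le_normr_Rintegral measurableT ihp) _.
have -> : eta k * C = \int[mu2]_y (eta k * (h y ^+ 2 + poisson_tail (eta k ^+ 2) (x - y))).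
  rewrite RintegralZl//; last exact: RintegrableD.
  rewrite RintegralD// (reflect2_Rintegral x (integrable_poisson_tail (e0 k))).
  by rewrite Rintegral_poisson_tail.
apply: le_Rintegral => //; first exact: integrable_norm.
by move=> y _; exact: far_poisson_le.
Qed.

End far_part.

Lemma Lfun2_restrict (f : R * R -> R) (B : set (R * R)) : measurable B ->
  L2 f -> L2 (f \_ B).
Proof.
move=> mB L2f; apply: integrable_sqr_Lfun2.
  apply/(measurable_restrictT _ _).1 => //.
  by apply: measurable_funTS; exact: Lfun2_measurable L2f.
have := Lfun2_integrable_sqr L2f.
apply: le_Rintegrable => //.
  apply: measurable_funX; apply/(measurable_restrictT _ _).1 => //.
  by apply: measurable_funTS; exact: Lfun2_measurable L2f.
move=> y _; rewrite patchE normrX real_normK ?num_real//.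
by case: (y \in B) => //; rewrite expr0n/= sqr_ge0.
Qed.

(** [f] is continuous and square-integrable but not known to be bounded: it is
    bounded near [x], and away from [x] square integrability suffices. *)
Lemma poisson_convolution_cvg (f : R * R -> R) x : continuous f -> L2 f ->
  (\int[mu2]_y (f y * poisson2 (eta k ^+ 2) (x - y)))%R @[k --> \oo] -->
  (2 * pi) ^+ 2 * f x.
Proof.
move=> cf L2f.
have mB := measurable_box x 1.
have [M if1 f1M] := continuous_restrict_integrable cf mB (@subset_refl _ _).
have xB : box x 1 x by split; rewrite subrr normr0.
have f1x : (f \_ (box x 1)) x = f x by rewrite patchE mem_set.
have cf1 : {for x, continuous (f \_ (box x 1))}.
  rewrite /prop_for /continuous_at f1x; apply: cvg_trans (cf x).
  apply: near_eq_cvg; have : nbhs x (ball x (1 : R)) by exact: nbhsx_ballx.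
  apply: filterS => y [/ltW b1 /ltW b2]; rewrite patchE mem_set//.
  by split; rewrite distrC.
have L2f1 := Lfun2_restrict mB L2f.
have L2f2 := Lfun2_restrict (measurableC mB) L2f.
have f20 y : box x 1 y -> (f \_ (~` box x 1)) y = 0.
  by move=> by_; rewrite patchE ifF//; apply/negP => /set_mem.
have c1 := bounded_poisson_cvg if1 f1M cf1.
have c2 := far_poisson_cvg0 L2f2 f20.
have split_int k : \int[mu2]_y (f y * poisson2 (eta k ^+ 2) (x - y)) =
    \int[mu2]_y ((f \_ (box x 1)) y * poisson2 (eta k ^+ 2) (x - y)) +
    \int[mu2]_y ((f \_ (~` box x 1)) y * poisson2 (eta k ^+ 2) (x - y)).
  have e0 : 0 < eta k ^+ 2 by rewrite exprn_gt0.
  rewrite -RintegralD//; last 2 first.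
  - exact: Lfun2_integrableM L2f1 (poisson2_Lfun2 x e0).
  - exact: Lfun2_integrableM L2f2 (poisson2_Lfun2 x e0).
  apply: eq_Rintegral => y _; rewrite -mulrDl; congr (_ * _).
  have [yB|yB] := pselect (box x 1 y).
    by rewrite f20// addr0 patchE mem_set.
  have -> : (f \_ (~` box x 1)) y = f y by rewrite patchE mem_set.
  have -> : (f \_ (box x 1)) y = 0 by rewrite patchE memNset.
  by rewrite add0r.
rewrite f1x in c1; rewrite -[X in _ --> X]addr0.
apply: cvg_trans (cvgD c1 c2); apply: near_eq_cvg; apply: nearW => k.
by rewrite split_int.
Qed.

Lemma laplace_weight_cvg (a : R * R -> R) (trig : R -> R) x : continuous trig ->
  (forall t, `|trig t| <= 1) -> mu2.-integrable setT (EFin \o a) ->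
  (\int[mu2]_xi (a xi * (trig (dot x xi) * laplace2 (eta k ^+ 2) xi)))%R @[k --> \oo] -->
  \int[mu2]_xi (a xi * trig (dot x xi)).
Proof.
move=> ct t1 ia.
have mt : measurable_fun setT (fun xi => trig (dot x xi)).
  exact: (measurableT_comp (continuous_measurable_fun ct) (measurable_dot x)).
apply: (@Rintegral_dominated_cvg _ _ R mu2 setT measurableT _ _
    (fun xi => `|a xi|) _ _ _ _).2.
- move=> k; apply: measurable_funM; first exact: (integrableR_measurable ia).
  by apply: measurable_funM; [exact: mt|exact: measurable_laplace2].
- move=> xi _; apply: cvgM; first exact: cvg_cst.
  rewrite -[X in _ --> X]mulr1; apply: cvgM; first exact: cvg_cst.
  have lap (t : R) : laplace (eta k ^+ 2) t @[k --> \oo] --> (1 : R).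
    have c0 : - (eta k ^+ 2 * `|t|) @[k --> \oo] --> - (0 * `|t|).
      by apply: cvgN; apply: cvgM; [exact: cvg_eta2|exact: cvg_cst].
    rewrite mul0r oppr0 in c0; rewrite -expR0.
    exact: (cvg_comp _ _ c0 (@continuous_expR R 0)).
  have := cvgM (lap xi.1) (lap xi.2); rewrite mulr1; exact.
- exact: integrable_norm.
- move=> k xi _; rewrite normrM ler_piMr// normrM mulr_ile1//.
  by rewrite ger0_norm ?laplace2_ge0// laplace2_le1// sqr_ge0.
Qed.

(** Removing the weight [laplace2], in the limit where the Poisson kernel
    becomes a Dirac mass, inverts the transform at every point. *)
Theorem fourier_inversion (f a b : R * R -> R) x :
  continuous f -> L2 f -> fourier_transform f a b -> L2 a -> L2 b ->
  mu2.-integrable setT (EFin \o a) -> mu2.-integrable setT (EFin \o b) ->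
  \int[mu2]_xi (a xi * cos (dot x xi)) + \int[mu2]_xi (b xi * sin (dot x xi)) =
  (2 * pi) ^+ 2 * f x.
Proof.
move=> cf L2f ft L2a L2b ia ib.
have ca := laplace_weight_cvg (x := x) (@continuous_cos R) (@normr_cos_le1 R) ia.
have cb := laplace_weight_cvg (x := x) (@continuous_sin R) (@normr_sin_le1 R) ib.
rewrite -(cvg_lim (@Rhausdorff R) (poisson_convolution_cvg (x := x) cf L2f)).
apply/esym/(cvg_lim (@Rhausdorff R)).
apply: cvg_trans (cvgD ca cb); apply: near_eq_cvg; apply: nearW => k.
have e0 : 0 < eta k ^+ 2 by rewrite exprn_gt0.
exact: (laplace_inverse_fourier x e0 cf L2f ft L2a L2b).
Qed.

End approximate_identity.

(** * Regularity of the functions of [H^infty] *)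

Section taylor.
Variable R : realType.

(** A quadratic remainder gives the derivative at once, in one variable as well
    as along a direction of the plane. *)
Lemma is_derive_quadratic (V : normedModType R) (u : V -> R) (x v : V) (l K : R) :
  (forall h : R, `|u (h *: v + x) - u x - h * l| <= K * h ^+ 2) ->
  is_derive x v u l.
Proof.
move=> uK.
have K0 : 0 <= K by have := uK 1; rewrite expr1n mulr1; exact: le_trans.
have K10 : 0 < K + 1 by rewrite ltr_wpDl.
have cv : h^-1 *: (u (h *: v + x) - u x) @[h --> 0^'] --> l.
  apply/cvgrPdist_le => e e0; near=> h.
  have h0 : h != 0 by near: h; exact: nbhs_dnbhs_neq.
  rewrite (_ : l - _ = - (h^-1 * (u (h *: v + x) - u x - h * l))); last first.
    by rewrite /GRing.scale/=; field.
  rewrite normrN normrM normfV ler_pdivrMl ?normr_gt0//.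
  apply: le_trans (uK h) _.
  rewrite -real_normK ?num_real// expr2 mulrCA ler_wpM2l//.
  have hK : `|h| <= e / (K + 1).
    by near: h; apply: dnbhs0_le; rewrite divr_gt0.
  rewrite ler_pdivlMr// in hK; apply: le_trans hK.
  by rewrite mulrC ler_wpM2l// lerDl.
apply: DeriveDef; first by apply/cvg_ex; exists l.
exact: cvg_lim cv.
Unshelve. all: by end_near. Qed.

Lemma mean_value_le (u du : R -> R) (a b M : R) :
  (forall s : R, is_derive s 1 u (du s)) ->
  (forall s : R, `|s - a| <= `|b - a| -> `|du s| <= M) ->
  `|u b - u a| <= M * `|b - a|.
Proof.
move=> d M1.
have cu (A : set R) : {within A, continuous u}.
  apply: continuous_subspaceT => s.
  by apply: differentiable_continuous; apply/derivable1_diffP; apply: ex_derive.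
have [ab|/ltW ba] := leP a b.
- have [c + ->] := MVT_segment ab (fun s _ => d s) (cu _).
  rewrite in_itv/= => /andP[ac cb]; rewrite normrM ler_wpM2r// M1//.
  by rewrite !ger0_norm ?subr_ge0// lerD2r.
- have [c + E] := MVT_segment ba (fun s _ => d s) (cu _).
  rewrite in_itv/= => /andP[bc ca]; rewrite distrC E normrM distrC ler_wpM2r// M1//.
  by rewrite !ler0_norm ?subr_le0// lerN2 lerD2r.
Qed.

Lemma sin_lipschitz (s t : R) : `|sin s - sin t| <= `|s - t|.
Proof.
rewrite -[leRHS]mul1r; apply: (mean_value_le (du := cos)) => // c _.
exact: normr_cos_le1.
Qed.

Lemma cos_lipschitz (s t : R) : `|cos s - cos t| <= `|s - t|.
Proof.
rewrite -[leRHS]mul1r; apply: (mean_value_le (du := fun s => - sin s)) => // c _.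
by rewrite normrN normr_sin_le1.
Qed.

Lemma is_derive_subl (F : R -> R) (dF s u : R) : is_derive (u - s) 1 F dF ->
  is_derive s 1 (fun s => F (u - s)) (- dF).
Proof.
move=> h.
have d : is_derive s 1 (fun s : R => u - s) (-1).
  by apply: is_derive_eq; rewrite add0r mul1r.
have := @is_derive1_comp R F (fun s => u - s) s _ _ h d.
by rewrite mulrN1.
Qed.

Lemma cos_taylor (u v : R) : `|cos (u - v) - cos u - v * sin u| <= v ^+ 2.
Proof.
pose F (s : R) := cos (u - s) - s * sin u.
have dF (s : R) : is_derive s 1 F (sin (u - s) - sin u).
  have h := is_derive_subl (is_derive_cos (u - s)).
  apply: is_derive_eq.
  by rewrite opprK /GRing.scale/= mulr0 add0r mulr1.
have -> : cos (u - v) - cos u - v * sin u = F v - F 0.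
  by rewrite /F subr0 mul0r subr0; ring.
apply: le_trans (mean_value_le (M := `|v|) dF _) _.
- move=> s; rewrite !subr0; apply: le_trans; apply: le_trans (sin_lipschitz _ _) _.
  by rewrite addrAC subrr add0r normrN.
- by rewrite subr0 -expr2 real_normK ?num_real.
Qed.

Lemma sin_taylor (u v : R) : `|sin (u - v) - sin u + v * cos u| <= v ^+ 2.
Proof.
pose F (s : R) := sin (u - s) + s * cos u.
have dF (s : R) : is_derive s 1 F (cos u - cos (u - s)).
  have h := is_derive_subl (is_derive_sin (u - s)).
  apply: is_derive_eq.
  by rewrite /GRing.scale/= mulr0 add0r mulr1 addrC.
have -> : sin (u - v) - sin u + v * cos u = F v - F 0.
  by rewrite /F subr0 mul0r addr0; ring.
apply: le_trans (mean_value_le (M := `|v|) dF _) _.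
- move=> s; rewrite !subr0; apply: le_trans; apply: le_trans (cos_lipschitz _ _) _.
  by rewrite opprB addrC subrK.
- by rewrite subr0 -expr2 real_normK ?num_real.
Qed.

End taylor.

Section euclidean_norm.
Variable R : realType.
Implicit Types (x y : R * R).

Lemma enorm_ge0 x : 0 <= enorm x.
Proof. exact: sqrtr_ge0. Qed.

Lemma dot_ge0 x : 0 <= dot x x.
Proof. by rewrite /dot addr_ge0// -expr2 sqr_ge0. Qed.

Lemma enorm_sqr x : enorm x ^+ 2 = dot x x.
Proof. by rewrite sqr_sqrtr ?dot_ge0. Qed.

Lemma normr_dot_le x y : `|dot x y| <= enorm x * enorm y.
Proof.
rewrite -ler_sqr ?nnegrE ?mulr_ge0 ?enorm_ge0// exprMn !enorm_sqr.
rewrite real_normK ?num_real// -subr_ge0.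
have -> : dot x x * dot y y - dot x y ^+ 2 = (x.1 * y.2 - x.2 * y.1) ^+ 2.
  by rewrite /dot; ring.
exact: sqr_ge0.
Qed.

Lemma enorm_le_sum x : enorm x <= `|x.1| + `|x.2|.
Proof.
rewrite -ler_sqr ?nnegrE ?enorm_ge0 ?addr_ge0// enorm_sqr /dot sqrrD.
rewrite !real_normK ?num_real// -!expr2 addrAC lerDl mulrn_wge0// mulr_ge0//.
Qed.

Lemma enormB_le x y : enorm (x - y) <= enorm x + enorm y.
Proof.
rewrite -ler_sqr ?nnegrE ?enorm_ge0 ?addr_ge0 ?enorm_ge0//.
have -> : enorm (x - y) ^+ 2 = enorm x ^+ 2 - 2 * dot x y + enorm y ^+ 2.
  by rewrite !enorm_sqr /dot /=; ring.
have := normr_dot_le x y; rewrite ler_norml => /andP[b _].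
rewrite sqrrD mulr2n; lra.
Qed.

Lemma enormN x : enorm (- x) = enorm x.
Proof. by rewrite /enorm /dot /= !mulrNN. Qed.

Lemma enormZ (c : R) x : enorm (c *: x) = `|c| * enorm x.
Proof.
rewrite /enorm (_ : dot (c *: x) (c *: x) = c ^+ 2 * dot x x).
  by rewrite sqrtrM ?sqr_ge0// sqrtr_sqr.
by rewrite /dot /= /GRing.scale /=; ring.
Qed.

Lemma enorm_eq0 x : (enorm x == 0) = (x == 0).
Proof.
apply/eqP/eqP => [x0|->]; last by rewrite /enorm /dot /= !mulr0 addr0 sqrtr0.
have := normr_fst_enorm x; have := normr_snd_enorm x; rewrite x0 !normr_le0.
by case: x {x0} => a b /= /eqP -> /eqP ->.
Qed.

Lemma enorm_gt0 x : (0 < enorm x) = (x != 0).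
Proof. by rewrite lt_neqAle enorm_ge0 andbT eq_sym enorm_eq0. Qed.

End euclidean_norm.

Section sobolev_regularity.
Variable R : realType.
Local Notation mu := (@lebesgue_measure R).
Local Notation mu2 := (@leb2 R).
Implicit Types (x y xi al : R * R) (f : R * R -> R) (F : R * R -> R * R).

(** [F] is the gradient of [f], with the bounds that two bounded derivatives
    would give, all with the same constant. *)
Definition regular (C : R) f F : Prop :=
  [/\ forall x, `|f x| <= C,
      forall x, enorm (F x) <= C,
      forall x y, enorm (F x - F y) <= C * enorm (x - y) &
      forall x al, `|f (x - al) - f x + dot al (F x)| <= C * enorm al ^+ 2].

Definition bessel xi : R := 1 + enorm xi ^+ 2.

Lemma bessel_ge1 xi : 1 <= bessel xi.
Proof. by rewrite lerDl sqr_ge0. Qed.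

Lemma measurable_bessel : measurable_fun setT bessel.
Proof.
have m := @measurable_enorm R.
by apply: measurable_funD => //; apply: measurable_funX; exact: m.
Qed.

Lemma integrable_besselV2 : mu2.-integrable setT (EFin \o (fun xi => (bessel xi ^+ 2)^-1)).
Proof.
apply: (@le_Rintegrable _ _ R mu2 setT measurableT _
  (fun xi => (1 + xi.1 ^+ 2)^-1 * (1 + xi.2 ^+ 2)^-1)).
- apply: measurable_funV_ge0 => [xi|]; first exact: sqr_ge0.
  by apply: measurable_funX; exact: measurable_bessel.
- move=> xi _; rewrite ger0_norm ?invr_ge0 ?sqr_ge0// -invfM.
  have p (t : R) : 0 < 1 + t ^+ 2 by rewrite ltr_pwDl ?sqr_ge0.
  rewrite lef_pV2 ?posrE ?mulr_gt0 ?exprn_gt0 ?(lt_le_trans ltr01 (bessel_ge1 _))//.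
  rewrite /bessel enorm_sqr /dot -!expr2 [leRHS]expr2.
  by apply: ler_pM; rewrite ?(ltW (p _))// lerD2l ?lerDl ?lerDr sqr_ge0.
- exact: (Rintegrable_tensor (integrable_oneDsqV R) (integrable_oneDsqV R)).
Qed.

(** With [b = bessel], the inequality [b |a| <= (b ^ 2 |a|) ^ 2 + b ^ - 2] leaves
    a weight that is integrable because the dimension is [2]. *)
Lemma integrable_bessel_of_Lfun2 (a : R * R -> R) :
  L2 (fun xi => bessel xi `^ (4 / 2) * a xi) -> L2 a ->
  mu2.-integrable setT (EFin \o (fun xi => bessel xi * `|a xi|)).
Proof.
move=> L2w L2a.
have iw := Lfun2_integrable_sqr L2w.
have ma := Lfun2_measurable L2a.
apply: (@le_Rintegrable _ _ R mu2 setT measurableT _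
  (fun xi => (bessel xi `^ (4 / 2) * a xi) ^+ 2 + (bessel xi ^+ 2)^-1)).
- apply: measurable_funM; first exact: measurable_bessel.
  exact: measurableT_comp.
- move=> xi _.
  have b1 := bessel_ge1 xi.
  rewrite (_ : 4 / 2 = 2%:R); last by field.
  rewrite powR_mulrn ?(le_trans ler01)// normrM normr_id (ger0_norm (le_trans ler01 b1)).
  rewrite -[leRHS]addr0 exprMn -[a xi ^+ 2]real_normK ?num_real// addr0.
  set q := `|a xi|; set b := bessel xi in b1 *.
  have b0 : b != 0 by rewrite gt_eqF// (lt_le_trans ltr01).
  have : 0 <= (b ^+ 2 * q - b^-1) ^+ 2 by rewrite sqr_ge0.
  rewrite sqrrB (_ : b ^+ 2 * q * b^-1 = b * q); last by field.
  have bq0 : 0 <= b * q by apply: mulr_ge0; [exact: le_trans b1|exact: normr_ge0].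
  by rewrite exprMn exprVn mulr2n; lra.
- by apply: RintegrableD => //; exact: integrable_besselV2.
Qed.

Section inverse_transform.
Variables (a b : R * R -> R).
Hypotheses (ia : mu2.-integrable setT (EFin \o (fun xi => bessel xi * `|a xi|))).
Hypotheses (ib : mu2.-integrable setT (EFin \o (fun xi => bessel xi * `|b xi|))).
Hypotheses (ma : measurable_fun setT a) (mb : measurable_fun setT b).

Let m xi := bessel xi * `|a xi| + bessel xi * `|b xi|.

Let im : mu2.-integrable setT (EFin \o m).
Proof. exact: RintegrableD. Qed.

Lemma bessel_bound_integrable (c d : R * R -> R) (K : R) :
  measurable_fun setT c -> measurable_fun setT d ->
  (forall xi, `|c xi| <= K * bessel xi) -> (forall xi, `|d xi| <= K * bessel xi) ->
  mu2.-integrable setT (EFin \o (fun xi => a xi * c xi + b xi * d xi)) /\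
  `|\int[mu2]_xi (a xi * c xi + b xi * d xi)| <= K * \int[mu2]_xi m xi.
Proof.
move=> mc md cK dK.
have le xi : `|a xi * c xi + b xi * d xi| <= K * m xi.
  apply: le_trans (ler_normD _ _) _; rewrite !normrM /m mulrDr !mulrA.
  by apply: lerD; rewrite mulrC ler_wpM2r.
have iK : mu2.-integrable setT (EFin \o (fun xi => K * m xi)) by exact: RintegrableZl.
have i : mu2.-integrable setT (EFin \o (fun xi => a xi * c xi + b xi * d xi)).
  apply: (@le_Rintegrable _ _ R mu2 setT measurableT _ (fun xi => K * m xi)) => //.
  by apply: measurable_funD; apply: measurable_funM.
split => //; apply: le_trans (le_normr_Rintegral measurableT i) _.
rewrite -RintegralZl//; apply: le_Rintegral => //; exact: integrable_norm.
Qed.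

Lemma normr_fst_bessel xi : `|xi.1| <= bessel xi.
Proof.
have := normr_fst_enorm xi; rewrite /bessel; have := sqr_ge0 (enorm xi - 1).
by rewrite sqrrB1; have := enorm_ge0 xi; lra.
Qed.

Lemma normr_snd_bessel xi : `|xi.2| <= bessel xi.
Proof.
have := normr_snd_enorm xi; rewrite /bessel; have := sqr_ge0 (enorm xi - 1).
by rewrite sqrrB1; have := enorm_ge0 xi; lra.
Qed.

Let mcos x : measurable_fun setT (fun xi => cos (dot x xi)).
Proof. exact: measurable_cos_dot. Qed.

Let msin x : measurable_fun setT (fun xi => sin (dot x xi)).
Proof. exact: measurable_sin_dot. Qed.

Let mx1 : measurable_fun setT (fun xi : R * R => xi.1).
Proof. exact: measurable_fst. Qed.

Let mx2 : measurable_fun setT (fun xi : R * R => xi.2).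
Proof. exact: measurable_snd. Qed.

Definition inverse_transform x : R :=
  \int[mu2]_xi (a xi * cos (dot x xi) + b xi * sin (dot x xi)).

Definition inverse_transform_grad x : R * R :=
  (\int[mu2]_xi (a xi * (- (xi.1 * sin (dot x xi))) + b xi * (xi.1 * cos (dot x xi))),
   \int[mu2]_xi (a xi * (- (xi.2 * sin (dot x xi))) + b xi * (xi.2 * cos (dot x xi)))).

Let C := \int[mu2]_xi m xi.

Lemma inverse_transform_int x :
  mu2.-integrable setT (EFin \o (fun xi => a xi * cos (dot x xi) + b xi * sin (dot x xi))) /\
  `|inverse_transform x| <= C.
Proof.
have [||i le] := bessel_bound_integrable (K := 1) (mcos x) (msin x).
- by move=> xi; rewrite mul1r (le_trans (normr_cos_le1 _))// bessel_ge1.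
- by move=> xi; rewrite mul1r (le_trans (normr_sin_le1 _))// bessel_ge1.
by split => //; rewrite -[leRHS]mul1r.
Qed.

(** [p] stands for a coordinate of the frequency. *)
Section coordinate.
Variable p : R * R -> R.
Hypotheses (mp : measurable_fun setT p) (pb : forall xi, `|p xi| <= bessel xi).
Hypothesis pe : forall xi, `|p xi| <= enorm xi.

Definition coordinate_grad x : R :=
  \int[mu2]_xi (a xi * (- (p xi * sin (dot x xi))) + b xi * (p xi * cos (dot x xi))).

Let mps x : measurable_fun setT (fun xi => - (p xi * sin (dot x xi))).
Proof. by apply: measurable_funN; exact: measurable_funM. Qed.

Let mpc x : measurable_fun setT (fun xi => p xi * cos (dot x xi)).
Proof. exact: measurable_funM. Qed.

Lemma coordinate_grad_int x :
  mu2.-integrable setT (EFin \o (fun xi =>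
    a xi * (- (p xi * sin (dot x xi))) + b xi * (p xi * cos (dot x xi)))) /\
  `|coordinate_grad x| <= C.
Proof.
have [||i le] := bessel_bound_integrable (K := 1) (mps x) (mpc x).
- by move=> xi; rewrite mul1r normrN normrM (le_trans _ (pb xi))// ler_piMr// normr_sin_le1.
- by move=> xi; rewrite mul1r normrM (le_trans _ (pb xi))// ler_piMr// normr_cos_le1.
by split => //; rewrite -[leRHS]mul1r.
Qed.

Lemma coordinate_grad_lipschitz x y :
  `|coordinate_grad x - coordinate_grad y| <= enorm (x - y) * C.
Proof.
have [ix _] := coordinate_grad_int x; have [iy _] := coordinate_grad_int y.
rewrite /coordinate_grad -RintegralB//.
have [||||_ le] := bessel_bound_integrable (K := enorm (x - y))
  (c := fun xi => - (p xi * sin (dot x xi)) - - (p xi * sin (dot y xi)))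
  (d := fun xi => p xi * cos (dot x xi) - p xi * cos (dot y xi)).
- by apply: measurable_funB.
- by apply: measurable_funB.
- move=> xi; rewrite -opprD normrN -mulrBr normrM.
  have := sin_lipschitz (dot x xi) (dot y xi); rewrite -dotBl => h.
  apply: le_trans (ler_pM _ _ (pe xi) (le_trans h (normr_dot_le _ _))) _ => //.
  by rewrite mulrCA ler_wpM2l ?enorm_ge0// -expr2 lerDr.
- move=> xi; rewrite -mulrBr normrM.
  have := cos_lipschitz (dot x xi) (dot y xi); rewrite -dotBl => h.
  apply: le_trans (ler_pM _ _ (pe xi) (le_trans h (normr_dot_le _ _))) _ => //.
  by rewrite mulrCA ler_wpM2l ?enorm_ge0// -expr2 lerDr.
by apply: le_trans le; rewrite le_eqVlt; apply/orP; left; apply/eqP;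
  congr (`|_|); apply: eq_Rintegral => xi _; ring.
Qed.

End coordinate.

(** Expanding [cos] and [sin] under the integral sign costs the second moment of
    the transform; differentiability follows from the expansion. *)
Lemma inverse_transform_taylor x al :
  `|inverse_transform (x - al) - inverse_transform x + dot al (inverse_transform_grad x)|
    <= enorm al ^+ 2 * C.
Proof.
have [i1 _] := inverse_transform_int x.
have [i2 _] := inverse_transform_int (x - al).
have [i3 _] := coordinate_grad_int mx1 normr_fst_bessel x.
have [i4 _] := coordinate_grad_int mx2 normr_snd_bessel x.
have E : inverse_transform (x - al) - inverse_transform x +
    dot al (inverse_transform_grad x) = \int[mu2]_xi (
    a xi * (cos (dot x xi - dot al xi) - cos (dot x xi) - dot al xi * sin (dot x xi)) +
    b xi * (sin (dot x xi - dot al xi) - sin (dot x xi) + dot al xi * cos (dot x xi))).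
  have i5 := RintegrableZl measurableT al.1 i3.
  have i6 := RintegrableZl measurableT al.2 i4.
  have i7 := RintegrableD measurableT i5 i6.
  have i8 := integrableB measurableT i2 i1.
  rewrite [X in _ + X]/dot /= -RintegralB// -[X in _ + (X + _)]RintegralZl//.
  rewrite -[X in _ + (_ + X)]RintegralZl// -[X in _ + X]RintegralD// -RintegralD//.
  by apply: eq_Rintegral => xi _; rewrite dotBl /(dot al xi); ring.
rewrite E.
have q xi (r : R) : `|r| <= dot al xi ^+ 2 -> `|r| <= enorm al ^+ 2 * bessel xi.
  move=> h; apply: le_trans h _; rewrite -real_normK ?num_real//.
  apply: (@le_trans _ _ ((enorm al * enorm xi) ^+ 2)).
    by rewrite lerXn2r ?nnegrE ?mulr_ge0 ?enorm_ge0// normr_dot_le.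
  by rewrite exprMn ler_wpM2l ?sqr_ge0// lerDr.
have md := measurable_dot al.
apply: (bessel_bound_integrable (K := enorm al ^+ 2)
 (c := fun xi => cos (dot x xi - dot al xi) - cos (dot x xi) - dot al xi * sin (dot x xi))
 (d := fun xi => sin (dot x xi - dot al xi) - sin (dot x xi) + dot al xi * cos (dot x xi)) _ _ _ _).2.
- under eq_fun do rewrite -dotBl.
  by apply: measurable_funB; [exact: measurable_funB|exact: measurable_funM].
- under eq_fun do rewrite -dotBl.
  by apply: measurable_funD; [exact: measurable_funB|exact: measurable_funM].
- by move=> xi; apply: q; exact: cos_taylor.
- by move=> xi; apply: q; exact: sin_taylor.
Qed.

End inverse_transform.
End sobolev_regularity.

Section regular_theory.
Variable R : realType.
Local Notation mu2 := (@leb2 R).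
Implicit Types (x y v w al : R * R) (f : R * R -> R) (F : R * R -> R * R) (C : R).

Lemma dotZl (k : R) (a b : R * R) : dot (k *: a) b = k * dot a b.
Proof. by rewrite /dot /= /GRing.scale/=; ring. Qed.

Lemma dotNl (a b : R * R) : dot (- a) b = - dot a b.
Proof. by rewrite /dot /=; ring. Qed.

Lemma dotZr (k : R) (a b : R * R) : dot a (k *: b) = k * dot a b.
Proof. by rewrite dotC dotZl dotC. Qed.

Lemma dotBr (a b c : R * R) : dot a (b - c) = dot a b - dot a c.
Proof. by rewrite dotC dotBl !(dotC a). Qed.

Section with_bounds.
Variables (C : R) (f : R * R -> R) (F : R * R -> R * R).
Hypothesis fF : regular C f F.

Lemma regular_ge0 : 0 <= C.
Proof. by case: fF => f0 _ _ _; exact: le_trans (f0 0). Qed.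

Lemma regular_increment x v (h : R) :
  `|f (h *: v + x) - f x - h * dot v (F x)| <= C * enorm v ^+ 2 * h ^+ 2.
Proof.
case: fF => _ _ _ /(_ x (- h *: v)).
rewrite dotZl enormZ normrN exprMn real_normK ?num_real//.
by rewrite scaleNr opprK addrC [x + _]addrC mulNr addrC -mulrA [_ ^+ 2 * h ^+ 2]mulrC.
Qed.

Lemma regular_is_derive x v : is_derive x v f (dot v (F x)).
Proof. by apply: is_derive_quadratic => h; exact: regular_increment. Qed.

Lemma regular_grad : grad f = F.
Proof.
apply/funext => x; rewrite /grad.
rewrite (@derive_val _ _ _ _ _ _ _ (regular_is_derive x (1, 0))).
rewrite (@derive_val _ _ _ _ _ _ _ (regular_is_derive x (0, 1))).
by rewrite /dot /= !mul1r !mul0r add0r addr0 -surjective_pairing.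
Qed.

Lemma regular_delta_is_derive x v al :
  is_derive x v (delta al f) (dot v (F x - F (x - al))).
Proof.
apply: (is_derive_quadratic (K := C * enorm v ^+ 2 + C * enorm v ^+ 2)) => h.
rewrite (_ : _ - _ = (f (h *: v + x) - f x - h * dot v (F x)) -
   (f (h *: v + (x - al)) - f (x - al) - h * dot v (F (x - al)))); last first.
  by rewrite /delta dotBr [h *: v + (x - al)]addrA; ring.
apply: le_trans (ler_normB _ _) _; rewrite mulrDl lerD//;
  exact: regular_increment.
Qed.

Lemma regular_grad_delta x al : grad (delta al f) x = F x - F (x - al).
Proof.
rewrite /grad.
rewrite (@derive_val _ _ _ _ _ _ _ (regular_delta_is_derive x (1, 0) al)).
rewrite (@derive_val _ _ _ _ _ _ _ (regular_delta_is_derive x (0, 1) al)).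
by rewrite /dot !mul1r !mul0r add0r addr0 -surjective_pairing.
Qed.

Lemma regular_grad_Delta x al :
  grad (Delta al f) x = (enorm al)^-1 *: (F x - F (x - al)).
Proof.
have d v : is_derive x v (Delta al f) ((enorm al)^-1 * dot v (F x - F (x - al))).
  have -> : Delta al f = (enorm al)^-1 *: delta al f.
    by apply/funext => y; rewrite /Delta /delta mulrC.
  by have h := regular_delta_is_derive x v al; exact: is_deriveZ.
rewrite /grad (@derive_val _ _ _ _ _ _ _ (d (1, 0))) (@derive_val _ _ _ _ _ _ _ (d (0, 1))).
by rewrite /dot !mul1r !mul0r add0r addr0.
Qed.

Lemma regular_ray_is_derive x w (r : R) :
  is_derive r 1 (fun r : R => f (x - r *: w)) (- dot w (F (x - r *: w))).
Proof.
apply: (is_derive_quadratic (K := C * enorm w ^+ 2)) => h.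
have := regular_increment (x - r *: w) (- w) h.
rewrite enormN dotNl.
have -> // : x - (h *: 1 + r) *: w = h *: - w + (x - r *: w).
by rewrite [h *: 1]mulr1 scalerDl opprD scalerN addrCA.
Qed.

(** For large [al] the boundedness of [f] takes over from the expansion. *)
Lemma regular_lipschitz x al : `|f x - f (x - al)| <= (C + C) * enorm al.
Proof.
have C0 := regular_ge0; have [f0 F0 _ ft] := fF.
have [al1|al1] := lerP (enorm al) 1.
  have -> : f x - f (x - al) = dot al (F x) - (f (x - al) - f x + dot al (F x)) by ring.
  apply: le_trans (ler_normB _ _) _; rewrite mulrDl lerD//.
    by rewrite (le_trans (normr_dot_le _ _))// mulrC ler_wpM2r ?enorm_ge0.
  by rewrite (le_trans (ft x al))// ler_wpM2l// expr2 ler_piMr ?enorm_ge0.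
apply: le_trans (ler_normB _ _) _; apply: (@le_trans _ _ (C + C)); first exact: lerD.
by rewrite ler_peMr ?addr_ge0// ltW.
Qed.

Lemma regular_second_difference x al :
  `|f x - f (x - al) + (f x - f (x + al))| <= (C + C) * enorm al ^+ 2.
Proof.
have [_ _ _ ft] := fF.
have := ft x (- al); rewrite opprK dotNl enormN => h.
have -> : f x - f (x - al) + (f x - f (x + al)) =
  - ((f (x - al) - f x + dot al (F x)) + (f (x + al) - f x - dot al (F x))) by ring.
by rewrite normrN mulrDl (le_trans (ler_normD _ _))// lerD.
Qed.

End with_bounds.

(** The Sobolev exponent [4] gives an integrable second moment of the
    transform, and the inversion formula transfers the bounds to [f]. *)
Lemma Hinfty_regular f : Hinfty f -> exists C, regular C f (grad f).
Proof.
case=> cf /(_ 4)[//|L2f [a [b [ft L2a L2b L2wa L2wb]]]].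
have ia := integrable_bessel_of_Lfun2 L2wa L2a.
have ib := integrable_bessel_of_Lfun2 L2wb L2b.
have [ma mb] := (Lfun2_measurable L2a, Lfun2_measurable L2b).
have weaken (c : R * R -> R) : measurable_fun setT c ->
    mu2.-integrable setT (EFin \o (fun xi => bessel xi * `|c xi|)) ->
    mu2.-integrable setT (EFin \o c).
  move=> mc; apply: le_Rintegrable => // xi _.
  by rewrite ler_peMl ?bessel_ge1.
have [ia1 ib1] := (weaken _ ma ia, weaken _ mb ib).
pose k : R := (2 * pi) ^- 2; have k0 : 0 <= k by rewrite invr_ge0 sqr_ge0.
pose I := \int[mu2]_xi (bessel xi * `|a xi| + bessel xi * `|b xi|).
have fE x : f x = k * inverse_transform a b x.
  have inv := fourier_inversion x cf L2f ft L2a L2b ia1 ib1.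
  have -> : inverse_transform a b x = (2 * pi) ^+ 2 * f x.
    rewrite -inv /inverse_transform RintegralD//.
    - under eq_fun do rewrite mulrC.
      exact: (integrable_trig_dot x (@continuous_cos R) (@normr_cos_le1 R) ia1).
    - under eq_fun do rewrite mulrC.
      exact: (integrable_trig_dot x (@continuous_sin R) (@normr_sin_le1 R) ib1).
  by rewrite /k mulKf// sqrf_eq0 mulf_neq0// ?pnatr_eq0// gt_eqF// pi_gt0.
pose F x := k *: inverse_transform_grad a b x.
have m1 : measurable_fun setT (fun xi : R * R => xi.1) by exact: measurable_fst.
have m2 : measurable_fun setT (fun xi : R * R => xi.2) by exact: measurable_snd.
have I0 : 0 <= I.
  apply: Rintegral_ge0 => xi _.
  by rewrite addr_ge0// mulr_ge0// (le_trans ler01 (bessel_ge1 _)).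
have kI0 : 0 <= k * I by exact: mulr_ge0.
suff h : regular (2 * (k * I)) f F.
  by exists (2 * (k * I)); rewrite (regular_grad h).
split.
- move=> x; rewrite fE normrM (ger0_norm k0) mulrCA ler_wpM2l//.
  apply: le_trans (inverse_transform_int ia ib ma mb x).2 _.
  by rewrite -/I ler_peMl// ler1n.
- move=> x; rewrite /F enormZ (ger0_norm k0) mulrCA ler_wpM2l//.
  apply: le_trans (enorm_le_sum _) _; rewrite mulr_natl mulr2n lerD//.
  + exact: (coordinate_grad_int ia ib ma mb m1 (@normr_fst_bessel R) x).2.
  + exact: (coordinate_grad_int ia ib ma mb m2 (@normr_snd_bessel R) x).2.
- move=> x y; rewrite /F -scalerBr enormZ (ger0_norm k0).
  rewrite (_ : 2 * _ * _ = k * (enorm (x - y) * I + enorm (x - y) * I)); last by ring.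
  rewrite ler_wpM2l//; apply: le_trans (enorm_le_sum _) _; apply: lerD.
  + exact: (coordinate_grad_lipschitz ia ib ma mb m1 (@normr_fst_bessel R) (@normr_fst_enorm R)).
  + exact: (coordinate_grad_lipschitz ia ib ma mb m2 (@normr_snd_bessel R) (@normr_snd_enorm R)).
- move=> x al; rewrite !fE /F dotZr -mulrBr -mulrDr normrM (ger0_norm k0).
  rewrite (_ : 2 * _ * _ = k * (2 * (enorm al ^+ 2 * I))); last by ring.
  rewrite ler_wpM2l//; apply: le_trans (inverse_transform_taylor ia ib ma mb x al) _.
  by rewrite ler_peMl ?ler1n// mulr_ge0// sqr_ge0.
Qed.

End regular_theory.

(** * Principal values *)

Section principal_values.
Variable R : realType.
Local Notation mu := (@lebesgue_measure R).
Local Notation mu2 := (@leb2 R).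
Implicit Types (al : R * R) (F : R * R -> R) (eta : R).

Lemma measurable_annulus eta : measurable (annulus eta : set (R * R)).
Proof.
have := @measurable_enorm R measurableT _ (measurable_itv `]eta, eta^-1[).
rewrite setTI; congr measurable; apply/seteqP; split => al /=.
  by rewrite in_itv/= => /andP.
by rewrite in_itv/= => -[-> ->].
Qed.

Lemma annulus_box eta : (annulus eta : set (R * R)) `<=` box 0 eta^-1.
Proof.
move=> al [_ /ltW le]; split; rewrite subr0.
- exact: le_trans (normr_fst_enorm al) le.
- exact: le_trans (normr_snd_enorm al) le.
Qed.

Lemma annulusN eta al : annulus eta (- al) <-> annulus eta al.
Proof. by rewrite /annulus /= enormN. Qed.

Lemma annulus_integrableP F eta :
  mu2.-integrable (annulus eta) (EFin \o F) <->
  mu2.-integrable setT (EFin \o (F \_ (annulus eta))).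
Proof.
have -> : EFin \o (F \_ (annulus eta)) = (EFin \o F) \_ (annulus eta).
  by apply/funext => al; rewrite /= !patchE; case: ifP.
exact: (@integrable_mkcond _ _ R mu2 (annulus eta) (EFin \o F) (measurable_annulus eta)).
Qed.

Lemma bounded_annulus_integrable F eta (M : R) : measurable_fun setT F ->
  (forall al, annulus eta al -> `|F al| <= M) ->
  mu2.-integrable (annulus eta) (EFin \o F).
Proof.
move=> mF FM; have mA := measurable_annulus eta; apply/annulus_integrableP.
apply: (bounded_box_integrable (x := 0) (r := eta^-1) (M := `|M|)).
  by apply/(measurable_restrictT _ _).1 => //; exact: measurable_funTS.
move=> al; rewrite patchE; case: ifPn => [/set_mem Aal|_].
  rewrite indicE mem_set ?mulr1; last exact: annulus_box.
  exact: le_trans (FM _ Aal) (ler_norm _).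
by rewrite normr0 mulr_ge0.
Qed.

Lemma annulus_Rintegral_reflect F eta :
  mu2.-integrable (annulus eta) (EFin \o F) ->
  mu2.-integrable (annulus eta) (EFin \o (fun al => F (- al))) /\
  \int[mu2]_(al in annulus eta) F (- al) = \int[mu2]_(al in annulus eta) F al.
Proof.
move=> /annulus_integrableP iF.
have E al : (F \_ (annulus eta)) (0 - al) = ((fun al => F (- al)) \_ (annulus eta)) al.
  rewrite sub0r !patchE; have [Aal|nA] := pselect (annulus eta al).
    by rewrite !mem_set//; exact/annulusN.
  by rewrite !memNset//; apply: contra_not nA => /annulusN.
split.
  apply/annulus_integrableP; have := reflect2_integrable 0 iF.
  by apply: eq_integrable => // al _; rewrite /= E.
rewrite [LHS]Rintegral_mkcond [RHS]Rintegral_mkcond -(reflect2_Rintegral 0 iF).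
by apply: eq_Rintegral => al _; rewrite E.
Qed.

Definition punctured : set (R * R) := [set al | al != 0].

Lemma measurable_punctured : measurable punctured.
Proof.
have := @measurable_enorm R measurableT _ (measurable_itv `]0, +oo[).
rewrite setTI; congr measurable; apply/seteqP; split => al /=.
  by rewrite in_itv/= andbT enorm_gt0.
by rewrite in_itv/= andbT enorm_gt0.
Qed.

Lemma near_annulus (u : nat -> R) al : al != 0 -> (forall n, 0 < u n) ->
  u n @[n --> \oo] --> 0 -> \forall n \near \oo, annulus (u n) al.
Proof.
rewrite -enorm_gt0 => al0 u0 cu; near=> n.
have u1 : u n < enorm al by near: n; exact: (cvgr_lt _ cu).
have u2 : u n < (enorm al)^-1 by near: n; apply: (cvgr_lt _ cu); rewrite invr_gt0.
by split => //=; rewrite -[enorm al]invrK ltf_pV2 ?posrE ?invr_gt0 ?u0.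
Unshelve. all: by end_near. Qed.

Lemma annulus_punctured eta al : 0 < eta -> annulus eta al -> al != 0.
Proof. by move=> eta0 [h _]; rewrite -enorm_gt0 (lt_trans eta0). Qed.

(** Exhaustion of the punctured plane by annuli. *)
Lemma dominated_annulus_cvg F (g : R * R -> R) : measurable_fun setT F ->
  (forall al, al != 0 -> `|F al| <= g al) -> (forall al, 0 <= g al) ->
  mu2.-integrable setT (EFin \o g) ->
  (\int[mu2]_(al in annulus eta) F al)%R @[eta --> 0^'+] -->
  \int[mu2]_al (F \_ punctured) al.
Proof.
move=> mF Fg g0 ig; apply/cvg_at_rightP => u [u0 cu].
have h n : \int[mu2]_(al in annulus (u n)) F al = \int[mu2]_al (F \_ (annulus (u n))) al.
  exact: Rintegral_mkcond.
rewrite (funext h).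
apply: (@Rintegral_dominated_cvg _ _ R mu2 setT measurableT _ _ g _ _ _ _).2 => //.
- move=> n; apply/(measurable_restrictT _ _).1; first exact: measurable_annulus.
  exact: measurable_funTS.
- move=> al _; have [->|al0] := eqVneq al 0.
    apply: cvg_near_cst; apply: nearW => n; rewrite !patchE !memNset//.
      by rewrite /punctured /= eqxx.
    by move=> /(annulus_punctured (u0 n)); rewrite eqxx.
  apply: cvg_near_cst; have := near_annulus al0 u0 cu; apply: filterS => n Aal.
  by rewrite !patchE !mem_set.
- move=> n al _; rewrite patchE; case: ifPn => [/set_mem/(annulus_punctured (u0 n))/Fg//|_].
  by rewrite normr0.
Qed.

Lemma leb2_set1 : mu2 [set 0] = 0%E.
Proof.
rewrite (_ : [set 0] = [set (0 : R)] `*` [set (0 : R)]); last first.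
  by apply/seteqP; split => [_ -> //|[a b] /= [-> ->]].
transitivity (mu [set (0 : R)%R] * mu [set (0 : R)%R])%E.
  by apply: (product_measure1E mu mu); exact: measurable_set1.
by rewrite lebesgue_measure_set1 mul0e.
Qed.

(** The annuli exhaust the plane up to the origin, a null set: for an absolutely
    integrable function, the principal value is the integral. *)
Lemma pv_intE F (l : R) :
  (\int[mu2]_(al in annulus eta) F al)%R @[eta --> 0^'+] --> l -> pv_int F = l.
Proof.
move=> cl; rewrite /pv_int; case: asboolP => [iF|_]; last exact: cvg_lim cl.
have mF := integrableR_measurable iF.
have := dominated_annulus_cvg mF (fun al _ => lexx `|F al|) (fun al => normr_ge0 _)
  (integrable_norm iF).
move=> /(cvg_lim (@Rhausdorff R)); rewrite (cvg_lim (@Rhausdorff R) cl) => ->.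
rewrite /Rintegral; congr fine; apply: ae_eq_integral => //.
- exact/measurable_EFinP.
- apply/measurable_EFinP/(measurable_restrictT _ _).1.
    exact: measurable_punctured.
  exact: measurable_funTS.
exists [set 0]; split; [|exact: leb2_set1|].
  by rewrite (_ : [set 0] = ~` punctured); [apply: measurableC; exact: measurable_punctured|
    apply/seteqP; split => al /=; [move=> ->; rewrite /punctured/= eqxx|
      move=> /negP; rewrite negbK => /eqP]].
move=> al /= nE; apply: contrapT => /eqP al0; apply: nE => _.
by rewrite patchE mem_set.
Qed.

Lemma slope_dir_unit (t : R) : enorm (slope_dir t) = 1.
Proof.
have t0 : 0 < 1 + t ^+ 2 by rewrite ltr_wpDr ?sqr_ge0.
rewrite /slope_dir enormZ (_ : enorm (1, t) = Num.sqrt (1 + t ^+ 2)); last first.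
  by rewrite /enorm /dot /= mulr1 expr2.
by rewrite ger0_norm ?invr_ge0// mulVf// gt_eqF// sqrtr_gt0.
Qed.

Lemma enorm_polar (p : R * R) : enorm (polar p) = `|p.2|.
Proof. by rewrite /polar enormZ slope_dir_unit mulr1. Qed.

(** The critical singularity [1 / |al|] at the origin and the decay
    [1 / |al| ^ 3] at infinity, the typical behaviour of a symmetrised
    principal value integrand in the plane. *)
Definition pv_majorant al : R := (enorm al * (1 + enorm al ^+ 2))^-1.

Lemma pv_majorant_ge0 al : 0 <= pv_majorant al.
Proof. by rewrite invr_ge0 mulr_ge0 ?enorm_ge0// addr_ge0 ?sqr_ge0. Qed.

(** In polar coordinates the majorant, with the Jacobian, is a product of two
    Cauchy densities. *)
Lemma integrable_pv_majorant : mu2.-integrable setT (EFin \o pv_majorant).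
Proof.
have men := @measurable_enorm R.
have mh : measurable_fun setT pv_majorant.
  apply: measurable_funV_ge0 => [al|].
    by rewrite mulr_ge0 ?enorm_ge0// addr_ge0 ?sqr_ge0.
  apply: measurable_funM; first exact: men.
  by apply: measurable_funD => //; apply: measurable_funX; exact: men.
apply/(transports_Rintegrable (@polar_transports R) mh).
apply: (@le_Rintegrable _ _ R mu2 setT measurableT _
  (fun p => (1 + p.1 ^+ 2)^-1 * (1 + p.2 ^+ 2)^-1)).
- apply: measurable_funM; last exact: measurable_polar_weight.
  exact: (measurableT_comp mh (@measurable_polar R)).
- move=> [t r] _; rewrite ger0_norm; last first.
    by rewrite mulr_ge0 ?pv_majorant_ge0 ?polar_weight_ge0.
  rewrite /pv_majorant enorm_polar /polar_weight /= real_normK ?num_real//.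
  have pos (s : R) : 0 < 1 + s ^+ 2 by rewrite ltr_wpDr ?sqr_ge0.
  have [->|r0] := eqVneq r 0.
    by rewrite normr0 !mul0r mulr0; apply: mulr_ge0; rewrite invr_ge0 ltW.
  rewrite (_ : _ * _ = (1 + t ^+ 2)^-1 * (1 + r ^+ 2)^-1)//.
  by field; rewrite !gt_eqF ?normr_gt0.
- exact: (Rintegrable_tensor (integrable_oneDsqV R) (integrable_oneDsqV R)).
Qed.

Lemma pv_majorant_le (N K : R) al : al != 0 ->
  `|N| <= K * enorm al ^+ 2 -> `|N| <= K ->
  `|N / enorm al ^+ 3| <= 2 * K * pv_majorant al.
Proof.
rewrite -enorm_gt0 => al0 N2 N0.
have s0 : 0 < 1 + enorm al ^+ 2 by rewrite ltr_wpDr ?sqr_ge0.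
rewrite normrM [X in _ * X]ger0_norm ?invr_ge0 ?exprn_ge0 ?enorm_ge0//.
rewrite ler_pdivrMr ?exprn_gt0// /pv_majorant.
rewrite (_ : 2 * K * _ * _ = (2 * K * enorm al ^+ 2) / (1 + enorm al ^+ 2)); last first.
  by field; rewrite !gt_eqF.
rewrite ler_pdivlMr// mulrDr mulr1.
have : `|N| * enorm al ^+ 2 <= K * enorm al ^+ 2 by rewrite ler_wpM2r ?sqr_ge0.
by lra.
Qed.

(** Only the even part of the integrand contributes to the integrals over the
    annuli, so that it alone has to be absolutely integrable. *)
Lemma pv_symmetric_cvg F (K : R) : measurable_fun setT F ->
  (forall eta, 0 < eta -> mu2.-integrable (annulus eta) (EFin \o F)) ->
  (forall al, al != 0 -> `|F al + F (- al)| <= K * pv_majorant al) ->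
  cvg ((\int[mu2]_(al in annulus eta) F al)%R @[eta --> 0^'+]).
Proof.
move=> mF iF FK.
pose S al := F al + F (- al).
have K0 : 0 <= K.
  have al1 : (1, 0) != 0 :> R * R.
    by apply/eqP => -[] /eqP; rewrite oner_eq0.
  have := le_trans (normr_ge0 _) (FK _ al1); rewrite pmulr_lge0// invr_gt0.
  by rewrite mulr_gt0 ?enorm_gt0// ltr_wpDr ?sqr_ge0.
have mN : measurable_fun setT (fun al : R * R => - al).
  have := measurable_affine2 (0 : R * R) (-1 : R).
  by congr measurable_fun; apply/funext => al; rewrite add0r scaleN1r.
have mS : measurable_fun setT S.
  by apply: measurable_funD => //; exact: (measurableT_comp mF mN).
have := dominated_annulus_cvg mS FK
  (fun al => mulr_ge0 K0 (pv_majorant_ge0 al))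
  (RintegrableZl measurableT K integrable_pv_majorant).
move=> cS; apply/cvg_ex; exists (2^-1 * \int[mu2]_al (S \_ punctured) al).
have cS2 : 2^-1 * (\int[mu2]_(al in annulus eta) S al)%R @[eta --> 0^'+] -->
    2^-1 * \int[mu2]_al (S \_ punctured) al.
  by apply: cvgM => //; exact: cvg_cst.
apply: cvg_trans cS2; apply: near_eq_cvg; near=> eta.
have eta0 : 0 < eta by near: eta; exact: nbhs_right_gt.
have [iN EN] := annulus_Rintegral_reflect (iF _ eta0).
rewrite /S RintegralD//; last 2 first.
- exact: measurable_annulus.
- exact: iF.
by rewrite EN; field.
Unshelve. all: by end_near. Qed.

End principal_values.

Section polar_annulus.
Variable R : realType.
Local Notation mu := (@lebesgue_measure R).
Local Notation mu2 := (@leb2 R).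
Variables (D : R * R -> R) (eta M : R).
Hypotheses (mD : measurable_fun setT D) (eta0 : 0 < eta).
Hypothesis DM : forall al, annulus eta al -> `|D al| <= M.

Let I : set R := `]eta, eta^-1[%classic.

Definition radial (w : R * R) (r : R) : R := D (r *: w) * r.

Lemma measurable_radial w : measurable_fun setT (radial w).
Proof.
apply: measurable_funM => //.
have m : measurable_fun setT (fun r : R => (r *: w : R * R)).
  apply: (measurable_fun_pair (f := fun r : R => r * w.1) (g := fun r : R => r * w.2)).
  - exact: measurable_funM.
  - exact: measurable_funM.
exact: (measurableT_comp mD m).
Qed.

Lemma unit_annulus w r : enorm w = 1 -> I r -> annulus eta (r *: w).
Proof.
move=> w1; rewrite /I /= in_itv/= => /andP[r1 r2].
by rewrite /annulus /= enormZ w1 mulr1 gtr0_norm// (lt_trans eta0).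
Qed.

Lemma radial_integrable w : enorm w = 1 ->
  mu.-integrable setT (EFin \o (radial w \_ I)).
Proof.
move=> w1; apply: (@le_Rintegrable _ _ R mu setT measurableT _
  (fun r => `|M| / eta * \1_I r)).
- apply/(measurable_restrictT _ _).1; first exact: measurable_itv.
  by apply: measurable_funTS; exact: measurable_radial.
- move=> r _; rewrite patchE; case: ifPn => [/set_mem Ir|_]; last first.
    by rewrite normr0 mulr_ge0// divr_ge0// ltW.
  rewrite indicE mem_set// mulr1 /radial normrM; apply: ler_pM => //.
    exact: le_trans (DM (unit_annulus w1 Ir)) (ler_norm _).
  move: Ir; rewrite /I /= in_itv/= => /andP[r1 r2].
  by rewrite gtr0_norm ?(lt_trans eta0)// ltW.
- by apply: RintegrableZl => //; exact: integrable_indic_itv.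
Qed.

Let N10 : -1 != 0 :> R.
Proof. by rewrite oppr_eq0 oner_eq0. Qed.

Lemma radial_reflect_integrable w : enorm w = 1 ->
  mu.-integrable setT (EFin \o (fun r => (radial w \_ I) (- r))) /\
  \int[mu]_r (radial w \_ I) (- r) = \int[mu]_r (radial w \_ I) r.
Proof.
move=> w1; have i := radial_integrable w1; have m := integrableR_measurable i.
split.
  have := (transports_Rintegrable (affine_transports 0 N10) m).1 i.
  apply: eq_integrable => // r _.
  by rewrite /= normrN1 mulr1 add0r mulN1r.
rewrite [RHS](transports_Rintegral (affine_transports 0 N10) m).
by apply: eq_Rintegral => r _; rewrite /= normrN1 mulr1 add0r mulN1r.
Qed.

(** On a line through the origin the annulus is the union of two opposite
    segments. *)
Lemma signed_radialE w r : enorm w = 1 ->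
  (D \_ (annulus eta)) (r *: w) * `|r| =
  (radial w \_ I) r + (radial (- w) \_ I) (- r).
Proof.
move=> w1; rewrite !patchE /radial.
have Aw : annulus eta (r *: w) <-> eta < `|r| /\ `|r| < eta^-1.
  by rewrite /annulus /= enormZ w1 mulr1.
have II s : I s <-> eta < s /\ s < eta^-1.
  by rewrite /I /= in_itv/=; split => [/andP//|[-> ->]].
have nI s : s <= 0 -> ~ I s.
  by move=> s0 /II[h _]; move: (lt_le_trans h s0); rewrite ltNge (ltW eta0).
have [r0|r0] := lerP 0 r.
- rewrite (memNset (nI (- r) _)) ?oppr_le0// addr0.
  have [Ir|nIr] := pselect (I r).
    rewrite !mem_set//; first by rewrite ger0_norm.
    by apply/Aw; rewrite ger0_norm//; exact/II.
  rewrite !memNset ?mul0r// => /Aw; rewrite ger0_norm// => /II; exact: nIr.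
- rewrite (memNset (nI r (ltW r0))) add0r scalerN scaleNr opprK.
  have [Ir|nIr] := pselect (I (- r)).
    rewrite !mem_set//; first by rewrite ltr0_norm.
    by apply/Aw; rewrite ltr0_norm//; exact/II.
  rewrite !memNset ?mul0r// => /Aw; rewrite ltr0_norm// => /II; exact: nIr.
Qed.

Lemma signed_radial_integral w : enorm w = 1 ->
  mu.-integrable setT (EFin \o (fun r => (D \_ (annulus eta)) (r *: w) * `|r|)) /\
  \int[mu]_r ((D \_ (annulus eta)) (r *: w) * `|r|) =
  \int[mu]_(r in I) ((D (r *: w) + D (- (r *: w))) * r).
Proof.
move=> w1; have Nw1 : enorm (- w) = 1 by rewrite enormN.
have E : (fun r => (D \_ (annulus eta)) (r *: w) * `|r|) =
   (fun r => (radial w \_ I) r + (radial (- w) \_ I) (- r)).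
  by apply/funext => r; exact: signed_radialE.
have i1 := radial_integrable w1; have i2 := radial_integrable Nw1.
have [i3 E3] := radial_reflect_integrable Nw1.
rewrite E; split; first exact: RintegrableD.
rewrite RintegralD// E3 -RintegralD// [RHS]Rintegral_mkcond.
apply: eq_Rintegral => r _; rewrite !patchE; case: ifP => _; last by rewrite addr0.
by rewrite /radial scalerN mulrDl.
Qed.

(** [pi] is the mass of the angular measure [dt / (1 + t ^ 2)]; opposite radii
    are grouped, so that their boundary terms can compensate. *)
Lemma polar_annulus_le K :
  (forall w, enorm w = 1 ->
     `|\int[mu]_(r in `]eta, eta^-1[) ((D (r *: w) + D (- (r *: w))) * r)| <= K) ->
  `|\int[mu2]_(al in annulus eta) D al| <= K * pi.
Proof.
move=> DK.
have iA := bounded_annulus_integrable mD DM.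
have iD : mu2.-integrable setT (EFin \o (D \_ (annulus eta))) by exact/annulus_integrableP.
have mDA := integrableR_measurable iD.
have ipol := (transports_Rintegrable (@polar_transports R) mDA).1 iD.
pose k t r := (D \_ (annulus eta)) (r *: slope_dir t) * `|r|.
have kE t r : (D \_ (annulus eta)) (polar (t, r)) * polar_weight (t, r) =
    (1 + t ^+ 2)^-1 * k t r.
  by rewrite /polar_weight /k /polar /= mulrA mulrC.
have isec t : mu.-integrable setT (fun r =>
    ((D \_ (annulus eta)) (polar (t, r)) * polar_weight (t, r))%:E).
  under eq_fun do rewrite kE.
  exact: (RintegrableZl measurableT _ (signed_radial_integral (slope_dir_unit t)).1).
rewrite Rintegral_mkcond (transports_Rintegral (@polar_transports R) mDA).
rewrite /leb2 (Rintegral_prod12 ipol isec).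
have ifub := Rintegrable_fubini_F ipol isec.
apply: le_trans (le_normr_Rintegral measurableT ifub) _.
rewrite -Rintegral_oneDsqV -RintegralZl//; last exact: integrable_oneDsqV.
apply: le_Rintegral => //.
- exact: integrable_norm.
- by apply: RintegrableZl => //; exact: integrable_oneDsqV.
move=> t _.
have -> : \int[mu]_r ((D \_ (annulus eta)) (polar (t, r)) * polar_weight (t, r)) =
    (1 + t ^+ 2)^-1 * \int[mu]_r k t r.
  rewrite -RintegralZl//; last exact: (signed_radial_integral (slope_dir_unit t)).1.
  by apply: eq_Rintegral => r _; rewrite kE.
rewrite (signed_radial_integral (slope_dir_unit t)).2 normrM mulrC.
rewrite [X in _ * X]ger0_norm; last by rewrite invr_ge0 addr_ge0 ?sqr_ge0.
by rewrite ler_wpM2r ?DK ?slope_dir_unit// invr_ge0 addr_ge0 ?sqr_ge0.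
Qed.

End polar_annulus.

(** * The kernel along a ray *)

Section japanese_bracket.
Variable R : realType.
Implicit Types a b : R.

Definition jap3V a : R := (jap a ^+ 3)^-1.
Definition jap5V a : R := (jap a ^+ 5)^-1.

Lemma jap_sqr a : jap a ^+ 2 = 1 + a ^+ 2.
Proof. by rewrite sqr_sqrtr// addr_ge0 ?sqr_ge0. Qed.

Lemma jap_gt0 a : 0 < jap a.
Proof. by rewrite sqrtr_gt0 ltr_wpDr ?sqr_ge0. Qed.

Lemma jap_ge1 a : 1 <= jap a.
Proof.
rewrite -(ler_pXn2r (n := 2))// ?nnegrE ?(ltW (jap_gt0 a))//.
by rewrite expr1n jap_sqr lerDl sqr_ge0.
Qed.

Lemma normr_le_jap a : `|a| <= jap a.
Proof.
rewrite -(ler_pXn2r (n := 2))// ?nnegrE ?(ltW (jap_gt0 a))//.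
by rewrite jap_sqr real_normK ?num_real// lerDr.
Qed.

Lemma japN a : jap (- a) = jap a.
Proof. by rewrite /jap sqrrN. Qed.

Lemma jap3VN a : jap3V (- a) = jap3V a.
Proof. by rewrite /jap3V japN. Qed.

Lemma jap3V_ge0 a : 0 <= jap3V a.
Proof. by rewrite invr_ge0 exprn_ge0// ltW// jap_gt0. Qed.

Lemma jap3V_le1 a : jap3V a <= 1.
Proof. by rewrite invf_le1 ?exprn_gt0 ?jap_gt0// exprn_ege1// jap_ge1. Qed.

Lemma normr_jap3V_le1 a : `|jap3V a| <= 1.
Proof. by rewrite ger0_norm ?jap3V_ge0// jap3V_le1. Qed.

Lemma normr_mul_jap5V_le1 a : `|a * jap5V a| <= 1.
Proof.
rewrite normrM /jap5V (ger0_norm (x := (_ ^+ 5)^-1)); last first.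
  by rewrite invr_ge0 exprn_ge0// ltW// jap_gt0.
rewrite ler_pdivrMr ?exprn_gt0 ?jap_gt0// mul1r.
apply: le_trans (normr_le_jap a) _.
by rewrite -[leLHS]expr1 ler_weXn2l// jap_ge1.
Qed.

Lemma is_derive_jap a : is_derive a 1 (@jap R) (a / jap a).
Proof.
have d : is_derive a 1 (fun a : R => 1 + a ^+ 2) (2 * a).
  by apply: is_derive_eq; rewrite add0r /GRing.scale/= mulr1; ring.
have p : 0 < 1 + a ^+ 2 by rewrite ltr_wpDr ?sqr_ge0.
have := @is_derive1_comp R Num.sqrt (fun a => 1 + a ^+ 2) a _ _ (is_derive1_sqrt p) d.
rewrite (_ : _ * (2 * a) = a / jap a)// -/(jap a).
by field; rewrite gt_eqF// jap_gt0.
Qed.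

Lemma is_derive_jap3V a : is_derive a 1 jap3V (- 3 * (a * jap5V a)).
Proof.
have j0 : jap a != 0 by rewrite gt_eqF// jap_gt0.
have d := is_derive_jap a.
have d3 : is_derive a 1 (fun a => jap a ^+ 3) (3 * jap a * a).
  by apply: is_derive_eq; rewrite /GRing.scale/=; field.
have := is_deriveV (f := fun a => jap a ^+ 3) (expf_neq0 3 j0) d3.
rewrite (_ : _ *: _ = - 3 * (a * jap5V a))//.
by rewrite /jap5V /GRing.scale/=; field.
Qed.

Lemma jap3V_lipschitz a b : `|jap3V a - jap3V b| <= 3 * `|a - b|.
Proof.
apply: (mean_value_le (du := fun a => - 3 * (a * jap5V a))).
  exact: is_derive_jap3V.
by move=> s _ /=; rewrite normrM normrN (ger0_norm (ler0n _ 3)) ler_piMr ?normr_mul_jap5V_le1.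
Qed.

Lemma continuous_jap : continuous (@jap R).
Proof.
move=> a; apply: differentiable_continuous; apply/derivable1_diffP.
exact: (@ex_derive _ _ _ _ _ _ _ (is_derive_jap a)).
Qed.

Lemma continuous_jap3V : continuous jap3V.
Proof.
move=> a; apply: differentiable_continuous; apply/derivable1_diffP.
exact: (@ex_derive _ _ _ _ _ _ _ (is_derive_jap3V a)).
Qed.

Lemma continuous_jap5V : continuous jap5V.
Proof.
move=> a; apply: cvgV; first by rewrite expf_neq0// gt_eqF// jap_gt0.
apply: (cvg_comp (@jap R) (fun y => y ^+ 5)); first exact: continuous_jap.
exact: exprn_continuous.
Qed.

End japanese_bracket.

Section positive_ftc.
Variable R : realType.
Local Notation mu := (@lebesgue_measure R).

Lemma Rintegral_derive_pos (E e : R -> R) (a b : R) : 0 < a -> a < b ->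
  (forall r : R, 0 < r -> is_derive r 1 E (e r)) ->
  (forall r : R, 0 < r -> {for r, continuous e}) ->
  \int[mu]_(r in `]a, b[) e r = E b - E a.
Proof.
move=> a0 ab dE ce.
have cE (r : R) : 0 < r -> {for r, continuous E}.
  move=> r0; apply: differentiable_continuous; apply/derivable1_diffP.
  exact: (@ex_derive _ _ _ _ _ _ _ (dE r r0)).
have we : {within `[a, b], continuous e}.
  apply: continuous_in_subspaceT => r /set_mem /=; rewrite in_itv/= => /andP[ar _].
  by apply: ce; exact: lt_le_trans ar.
have icc : mu.-integrable `[a, b] (EFin \o e).
  by apply: continuous_compact_integrable => //; exact: segment_compact.
have ico : mu.-integrable `]a, b] (EFin \o e).
  by apply: integrableS icc => //; apply: subset_itv; rewrite bnd_simp.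
have ioo : mu.-integrable `]a, b[ (EFin \o e).
  by apply: integrableS icc => //; apply: subset_itv; rewrite bnd_simp.
rewrite Rintegral_itv_bndo_bndc// Rintegral_itv_obnd_cbnd//.
rewrite /Rintegral (continuous_FTC2 ab we (F := E))//.
- split.
  + move=> r; rewrite in_itv/= => /andP[ar _].
    exact: (@ex_derive _ _ _ _ _ _ _ (dE r (lt_trans a0 ar))).
  + by apply: cvg_at_right_filter; exact: cE.
  + by apply: cvg_at_left_filter; apply: cE; exact: lt_trans ab.
- move=> r; rewrite in_itv/= => /andP[ar _]; rewrite derive1E.
  exact: (@derive_val _ _ _ _ _ _ _ (dE r (lt_trans a0 ar))).
Qed.

End positive_ftc.

Section symbol.
Variable R : realType.
Implicit Types (f g : R * R -> R) (x al w : R * R).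

Lemma lipschitz_continuous2 (C : R) (k : R * R -> R) :
  (forall x y, `|k x - k y| <= C * enorm (x - y)) -> continuous k.
Proof.
move=> kC x.
have c : C * enorm (x - y) @[y --> x] --> 0.
  rewrite -(mulr0 C); apply: cvgM; first exact: cvg_cst.
  have : x - y @[y --> x] --> x - x by apply: cvgB; [exact: cvg_cst|exact: cvg_id].
  move=> /(cvg_comp _ (@enorm R)) h.
  have := h _ (@continuous_enorm R (x - x)).
  have e0 : enorm (x - x) = 0 by apply/eqP; rewrite enorm_eq0 subrr.
  by rewrite e0.
apply/cvgrPdist_le => e e0.
move/cvgrPdist_le : c => /(_ e e0); apply: filterS => y.
rewrite sub0r normrN => h; apply: le_trans (kC x y) _.
exact: le_trans (ler_norm _) h.
Qed.

Section regular_continuity.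
Variables (C : R) (f : R * R -> R).
Hypothesis rf : regular C f (grad f).

Lemma regular_continuous : continuous f.
Proof.
apply: (lipschitz_continuous2 (C := C + C)) => x y.
by have := regular_lipschitz rf x (x - y); rewrite subKr.
Qed.

Lemma regular_continuous_fst : continuous (fun x => (grad f x).1).
Proof.
case: rf => _ _ lip _; apply: (lipschitz_continuous2 (C := C)) => x y.
by apply: le_trans (lip x y); exact: (normr_fst_enorm (grad f x - grad f y)).
Qed.

Lemma regular_continuous_snd : continuous (fun x => (grad f x).2).
Proof.
case: rf => _ _ lip _; apply: (lipschitz_continuous2 (C := C)) => x y.
by apply: le_trans (lip x y); exact: (normr_snd_enorm (grad f x - grad f y)).
Qed.

Lemma continuous_ray x w : continuous (fun r : R => x - r *: w).
Proof.
move=> r; apply: cvgB; first exact: cvg_cst.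
by apply: cvgZr_tmp; exact: cvg_id.
Qed.

Lemma continuous_dot_ray x w : continuous (fun r : R => dot w (grad f (x - r *: w))).
Proof.
move=> r; apply: cvgD; apply: cvgM; try exact: cvg_cst.
- apply: (cvg_comp (fun r : R => x - r *: w) (fun y => (grad f y).1)).
    exact: continuous_ray.
  exact: regular_continuous_fst.
- apply: (cvg_comp (fun r : R => x - r *: w) (fun y => (grad f y).2)).
    exact: continuous_ray.
  exact: regular_continuous_snd.
Qed.

Lemma difference_ray_is_derive x w (r : R) :
  is_derive r 1 (fun r : R => f x - f (x - r *: w)) (dot w (grad f (x - r *: w))).
Proof.
have h := regular_ray_is_derive rf x w r.
by apply: is_derive_eq; rewrite add0r mul1r opprK.
Qed.

Lemma slope_ray_is_derive x w (r : R) : 0 < r ->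
  is_derive r 1 (fun r : R => (f x - f (x - r *: w)) / r)
    ((dot w (grad f (x - r *: w)) - (f x - f (x - r *: w)) / r) / r).
Proof.
move=> r0; have h := difference_ray_is_derive x w r.
have rn0 : r != 0 by rewrite gt_eqF.
have hV : is_derive r 1 (fun r : R => r^-1) (- r ^- 2).
  have := is_deriveV (f := fun r : R => r) rn0 (is_derive_id r 1).
  by rewrite /GRing.scale/= mulr1.
apply: is_derive_eq; rewrite /GRing.scale/=.
by field.
Qed.

End regular_continuity.

(** The symbol produced by the radial integration by parts: its last term is
    [- al . grad_al] of [<Delta_al f> ^ - 3]. *)
Definition symbol f al x : R :=
  jap3V (Delta al f x) - jap3V (dot (direction al) (grad f x)) +
  3 * (Delta al f x * jap5V (Delta al f x)) *
    (dot (direction al) (grad f (x - al)) - Delta al f x).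

(** Difference between the term of [L_integrand] in [grad g (x - al)] and what
    the integration by parts turns it into. *)
Definition ibp_defect f g x al : R :=
  (dot al (grad g (x - al)) * jap3V (Delta al f x) -
   delta al g x * (jap3V (Delta al f x) +
     3 * (Delta al f x * jap5V (Delta al f x)) *
     (dot (direction al) (grad f (x - al)) - Delta al f x))) / enorm al ^+ 3.

(** The term of [L_integrand] in [grad g x]. *)
Definition transport_integrand f g x al : R :=
  dot al (grad g x) * jap3V (Delta al f x) / enorm al ^+ 3.

Section ray.
Variables (C K : R) (f g : R * R -> R) (x : R * R).
Hypotheses (rf : regular C f (grad f)) (rg : regular K g (grad g)).

Definition ray_slope w (r : R) : R := (f x - f (x - r *: w)) / r.

Definition ray_primitive w (r : R) : R :=
  (g x - g (x - r *: w)) * jap3V (ray_slope w r) / r.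

Definition ray_density w (r : R) : R :=
  (dot w (grad g (x - r *: w)) * jap3V (ray_slope w r)) / r -
  (g x - g (x - r *: w)) * (jap3V (ray_slope w r) +
    3 * (ray_slope w r * jap5V (ray_slope w r)) *
    (dot w (grad f (x - r *: w)) - ray_slope w r)) / r ^+ 2.

(** On the ray [al = r w], the radial derivative of [delta_al g] is
    [w . grad g (x - al)], and [r] times that of [Delta_al f] is
    [w . grad f (x - al) - Delta_al f]. *)
Lemma ray_primitive_is_derive w (r : R) : 0 < r ->
  is_derive r 1 (ray_primitive w) (ray_density w r).
Proof.
move=> r0; have rn0 : r != 0 by rewrite gt_eqF.
have hu := difference_ray_is_derive rg x w r.
have hs := slope_ray_is_derive rf x w r0.
have hc := @is_derive1_comp R (@jap3V R) (ray_slope w) r _ _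
  (is_derive_jap3V (ray_slope w r)) hs.
have hV : is_derive r 1 (fun r : R => r^-1) (- r ^- 2).
  have := is_deriveV (f := fun r : R => r) rn0 (is_derive_id r 1).
  by rewrite /GRing.scale/= mulr1.
have huc := is_deriveM hu hc.
apply: (is_derive_eq (is_deriveM huc hV)).
rewrite mulrfctE /= /ray_density /GRing.scale/= -/(ray_slope w r).
by field.
Qed.

Lemma continuous_ray_slope w (r : R) : 0 < r -> {for r, continuous (ray_slope w)}.
Proof.
move=> r0; apply: differentiable_continuous; apply/derivable1_diffP.
exact: (@ex_derive _ _ _ _ _ _ _ (slope_ray_is_derive rf x w r0)).
Qed.

Lemma continuous_ray_density w (r : R) : 0 < r -> {for r, continuous (ray_density w)}.
Proof.
move=> r0; have rn0 : r != 0 by rewrite gt_eqF.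
have cs := continuous_ray_slope (w := w) r0.
have c3 : {for r, continuous (fun r : R => jap3V (ray_slope w r))}.
  by apply: (cvg_comp _ (@jap3V R) cs); exact: continuous_jap3V.
have c5 : {for r, continuous (fun r : R => jap5V (ray_slope w r))}.
  by apply: (cvg_comp _ (@jap5V R) cs); exact: continuous_jap5V.
have cg : {for r, continuous (fun r : R => dot w (grad g (x - r *: w)))}.
  exact: (continuous_dot_ray rg).
have cf : {for r, continuous (fun r : R => dot w (grad f (x - r *: w)))}.
  exact: (continuous_dot_ray rf).
have cu : {for r, continuous (fun r : R => g x - g (x - r *: w))}.
  apply: cvgB; first exact: cvg_cst.
  apply: (cvg_comp (fun r : R => x - r *: w) g); first exact: continuous_ray.
  exact: regular_continuous rg _.
have cV : {for r, continuous (fun r : R => r^-1)} by apply: cvgV => //; exact: cvg_id.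
have cV2 : {for r, continuous (fun r : R => (r ^+ 2)^-1)}.
  by apply: cvgV; [rewrite expf_neq0|exact: exprn_continuous].
apply: cvgB; first by apply: cvgM => //; exact: cvgM.
apply: cvgM => //; apply: cvgM => //; apply: cvgD => //; apply: cvgM.
  by apply: cvgM; [exact: cvg_cst|exact: cvgM].
exact: cvgB.
Qed.

(** The Jacobian [r] of the polar coordinates makes the defect an exact radial
    derivative. *)
Lemma ibp_defect_ray w (r : R) : enorm w = 1 -> 0 < r ->
  ibp_defect f g x (r *: w) * r = ray_density w r.
Proof.
move=> w1 r0; have rn0 : r != 0 by rewrite gt_eqF.
have n : enorm (r *: w) = r by rewrite enormZ w1 mulr1 gtr0_norm.
have dE : direction (r *: w) = w.
  by rewrite /direction n scalerA mulVf// scale1r.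
rewrite /ibp_defect /ray_density dE n dotZl /delta /Delta n -/(ray_slope w r).
by field.
Qed.

Lemma ray_slopeN w (r : R) : 0 < r -> enorm w = 1 ->
  `|- ray_slope (- w) r - ray_slope w r| <= (C + C) * r.
Proof.
move=> r0 w1.
have -> : - ray_slope (- w) r - ray_slope w r =
    - ((f x - f (x - r *: w) + (f x - f (x + r *: w))) / r).
  by rewrite /ray_slope scalerN opprK; field; rewrite gt_eqF.
rewrite normrN normrM normfV (gtr0_norm r0) ler_pdivrMr//.
apply: le_trans (regular_second_difference rf x (r *: w)) _.
by rewrite enormZ w1 mulr1 gtr0_norm// expr2 mulrA.
Qed.

Lemma ray_primitive_le w (r : R) : 0 < r -> `|ray_primitive w r| <= (K + K) / r.
Proof.
move=> r0; have [g0 _ _ _] := rg.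
rewrite /ray_primitive !normrM [`|r^-1|]normfV (gtr0_norm r0) ler_wpM2r ?invr_ge0 ?(ltW r0)//.
rewrite (le_trans (ler_piMr _ (normr_jap3V_le1 _)))//.
by rewrite (le_trans (ler_normB _ _))// lerD.
Qed.

(** Near the origin the two opposite boundary terms compensate, as
    [delta_al g] is odd and [<Delta_al f>] even at first order. *)
Lemma ray_primitive_sym w (r : R) : 0 < r -> enorm w = 1 ->
  `|ray_primitive w r + ray_primitive (- w) r| <=
  ((K + K) + (K + K) * (3 * (C + C))) * r.
Proof.
move=> r0 w1; have rn0 : r != 0 by rewrite gt_eqF.
have -> : ray_primitive w r + ray_primitive (- w) r =
  (g x - g (x - r *: w) + (g x - g (x + r *: w))) / r * jap3V (ray_slope w r) +
  (g x - g (x + r *: w)) / r * (jap3V (- ray_slope (- w) r) - jap3V (ray_slope w r)).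
  by rewrite /ray_primitive jap3VN scalerN opprK; field.
have er : enorm (r *: w) = r by rewrite enormZ w1 mulr1 gtr0_norm.
apply: le_trans (ler_normD _ _) _; rewrite [leRHS]mulrDl; apply: lerD.
  rewrite normrM; apply: le_trans (ler_piMr _ (normr_jap3V_le1 _)) _ => //.
  rewrite normrM normfV (gtr0_norm r0) ler_pdivrMr// -mulrA -expr2.
  by have := regular_second_difference rg x (r *: w); rewrite er.
rewrite normrM -mulrA; apply: ler_pM => //.
  rewrite normrM normfV (gtr0_norm r0) ler_pdivrMr//.
  by have := regular_lipschitz rg x (- (r *: w)); rewrite opprK enormN er.
apply: le_trans (jap3V_lipschitz _ _) _; rewrite -mulrA ler_wpM2l//.
exact: ray_slopeN.
Qed.

(** At the outer end the primitive is [O(1 / r)], with [r = 1 / eta]. *)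
Lemma ibp_defect_radial_le w eta : enorm w = 1 -> 0 < eta -> eta < 1 ->
  `|\int[lebesgue_measure]_(r in `]eta, eta^-1[)
     ((ibp_defect f g x (r *: w) + ibp_defect f g x (- (r *: w))) * r)| <=
  ((K + K) * 3 + (K + K) * (3 * (C + C))) * eta.
Proof.
move=> w1 eta0 eta1.
have Nw1 : enorm (- w) = 1 by rewrite enormN.
have eV : eta < eta^-1 by rewrite (lt_trans eta1)// invf_gt1.
have eV0 : 0 < eta^-1 by rewrite invr_gt0.
have -> : \int[lebesgue_measure]_(r in `]eta, eta^-1[)
     ((ibp_defect f g x (r *: w) + ibp_defect f g x (- (r *: w))) * r) =
    \int[lebesgue_measure]_(r in `]eta, eta^-1[) (ray_density w r + ray_density (- w) r).
  apply: eq_Rintegral => r /set_mem /=; rewrite in_itv/= => /andP[er _].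
  have r0 := lt_trans eta0 er.
  by rewrite mulrDl -scalerN !ibp_defect_ray.
have dE (r : R) : 0 < r -> is_derive r 1
    (fun r => ray_primitive w r + ray_primitive (- w) r)
    (ray_density w r + ray_density (- w) r).
  move=> r0; exact: is_deriveD (ray_primitive_is_derive w r0)
    (ray_primitive_is_derive (- w) r0).
have ce (r : R) : 0 < r ->
    {for r, continuous (fun r : R => ray_density w r + ray_density (- w) r)}.
  by move=> r0; apply: cvgD; exact: continuous_ray_density.
have -> := @Rintegral_derive_pos R _ _ eta eta^-1 eta0 eV dE ce.
apply: le_trans (ler_normB _ _) _.
have b1 := ray_primitive_le w eV0.
have b2 := ray_primitive_le (- w) eV0.
rewrite invrK in b1 b2.
have b3 := ray_primitive_sym eta0 w1.
have b4 := ler_normD (ray_primitive w eta^-1) (ray_primitive (- w) eta^-1).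
rewrite [X in _ <= X]mulrDl in b3; rewrite [leRHS]mulrDl.
have : (K + K) * 3 * eta = (K + K) * eta + (K + K) * eta + (K + K) * eta by ring.
lra.
Qed.

End ray.
End symbol.

(** * The decomposition *)

Section decomposition.
Variable R : realType.
Local Notation mu2 := (@leb2 R).
Implicit Types (al w : R * R) (eta : R).
Variables (C K : R) (f g : R * R -> R).
Hypotheses (rf : regular C f (grad f)) (rg : regular K g (grad g)).

Let C0 : 0 <= C. Proof. exact: regular_ge0 rf. Qed.
Let K0 : 0 <= K. Proof. exact: regular_ge0 rg. Qed.

Lemma enorm_direction al : al != 0 -> enorm (direction al) = 1.
Proof.
rewrite -enorm_gt0 => al0; rewrite /direction enormZ ger0_norm ?invr_ge0 ?ltW//.
by rewrite mulVf// gt_eqF.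
Qed.

Lemma directionN al : direction (- al) = - direction al.
Proof. by rewrite /direction enormN scalerN. Qed.

Lemma normr_dir_grad_le al x y : al != 0 -> `|dot (direction al) (grad f x - grad f y)| <=
  enorm (grad f x - grad f y).
Proof. by move=> al0; rewrite -[leRHS]mul1r -(enorm_direction al0) normr_dot_le. Qed.

Lemma normr_delta_le al x : `|delta al g x| <= K + K.
Proof. by have [g0 _ _ _] := rg; rewrite (le_trans (ler_normB _ _))// lerD. Qed.

Lemma normr_Delta_le al x : al != 0 -> `|Delta al f x| <= C + C.
Proof.
rewrite -enorm_gt0 => al0.
rewrite /Delta normrM normfV (gtr0_norm al0) ler_pdivrMr//.
exact: regular_lipschitz rf x al.
Qed.

Lemma normr_dir_grad_le1 al x : al != 0 -> `|dot (direction al) (grad f x)| <= C.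
Proof.
move=> al0; have [_ F0 _ _] := rf.
by rewrite (le_trans (normr_dot_le _ _))// enorm_direction// mul1r.
Qed.

Lemma Delta_taylor al x : al != 0 ->
  `|Delta al f x - dot (direction al) (grad f x)| <= C * enorm al.
Proof.
move=> al0; have [_ _ _ ft] := rf.
move: (al0); rewrite -enorm_gt0 => n0; have nn0 : enorm al != 0 by rewrite gt_eqF.
have -> : Delta al f x - dot (direction al) (grad f x) =
    - ((f (x - al) - f x + dot al (grad f x)) / enorm al).
  by rewrite /Delta /direction dotZl; field.
rewrite normrN normrM normfV (gtr0_norm n0) ler_pdivrMr// -mulrA -expr2.
exact: ft.
Qed.

(** [jap3V] is [3]-Lipschitz and [a * jap5V a] is at most [1], while replacing
    [grad f x] by [grad f (x - al)] costs the gradient of [delta al f]: the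
    first difference is thus counted [3 + 3] times. *)
Lemma symbol_le al x : al != 0 ->
  `|symbol f al x| <= 6 * `|Delta al f x - dot (direction al) (grad f x)|
    + 3 * enorm (grad (delta al f) x).
Proof.
move=> al0; rewrite (regular_grad_delta rf).
set D := Delta al f x; set p := dot _ _.
have b1 := jap3V_lipschitz D p.
have b2 := normr_mul_jap5V_le1 D.
have b3 := normr_dir_grad_le x (x - al) al0.
have b4 : `|dot (direction al) (grad f (x - al)) - D| <=
    `|D - p| + enorm (grad f x - grad f (x - al)).
  have -> : dot (direction al) (grad f (x - al)) - D =
     - ((D - p) + dot (direction al) (grad f x - grad f (x - al))).
    by rewrite dotBr /p; ring.
  by rewrite normrN (le_trans (ler_normD _ _))// lerD2l.
rewrite /symbol -/D -/p; apply: le_trans (ler_normD _ _) _.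
have b5 : `|3 * (D * jap5V D) * (dot (direction al) (grad f (x - al)) - D)| <=
    3 * (`|D - p| + enorm (grad f x - grad f (x - al))).
  rewrite -mulrA normrM (ger0_norm (ler0n _ 3)) ler_wpM2l// normrM.
  by rewrite (le_trans _ b4)// ler_piMl.
lra.
Qed.

Lemma symbol_le_enorm al x : al != 0 -> `|symbol f al x| <= 9 * C * enorm al.
Proof.
move=> al0; apply: le_trans (symbol_le x al0) _.
have h1 := Delta_taylor x al0; have [_ _ lip _] := rf.
have := lip x (x - al); rewrite subKr (regular_grad_delta rf).
by lra.
Qed.

Lemma symbol_le_cst al x : al != 0 -> `|symbol f al x| <= 24 * C.
Proof.
move=> al0; apply: le_trans (symbol_le x al0) _.
have h1 := normr_Delta_le x al0; have h2 := normr_dir_grad_le1 x al0.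
have h3 := ler_normB (Delta al f x) (dot (direction al) (grad f x)).
have [_ F0 _ _] := rf; rewrite (regular_grad_delta rf).
have h4 : enorm (grad f x - grad f (x - al)) <= C + C.
  exact: le_trans (enormB_le _ _) (lerD (F0 _) (F0 _)).
by lra.
Qed.

Section measurability.
Variable x : R * R.

Lemma measurable_shift : measurable_fun setT (fun al : R * R => x - al).
Proof.
have := measurable_affine2 x (-1).
by congr measurable_fun; apply/funext => al; rewrite scaleN1r.
Qed.

Lemma measurable_enormV n : measurable_fun setT (fun al : R * R => (enorm al ^+ n)^-1).
Proof.
have m := @measurable_enorm R.
apply: measurable_funV_ge0 => [al|]; first by rewrite exprn_ge0 ?enorm_ge0.
by apply: measurable_funX; exact: m.
Qed.

Lemma measurable_delta (B : R) (u : R * R -> R) : regular B u (grad u) ->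
  measurable_fun setT (fun al => delta al u x).
Proof.
move=> ru; apply: measurable_funB => //.
exact: (measurableT_comp (continuous_measurable2 (regular_continuous ru)) measurable_shift).
Qed.

Lemma measurable_Delta : measurable_fun setT (fun al => Delta al f x).
Proof.
apply: measurable_funM; first exact: (measurable_delta rf).
by have := measurable_enormV 1; under eq_fun do rewrite expr1.
Qed.

Lemma measurable_DeltaN : measurable_fun setT (fun al => Delta (- al) f x).
Proof.
have m : measurable_fun setT (fun al : R * R => - al).
  have := measurable_affine2 (0 : R * R) (-1).
  by congr measurable_fun; apply/funext => al; rewrite scaleN1r add0r.
exact: (measurableT_comp measurable_Delta m).
Qed.

Lemma measurable_jap3V (u : R * R -> R) : measurable_fun setT u ->
  measurable_fun setT (fun al => jap3V (u al)).
Proof.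
exact: (measurableT_comp (continuous_measurable_fun (@continuous_jap3V R))).
Qed.

Lemma measurable_jap5V (u : R * R -> R) : measurable_fun setT u ->
  measurable_fun setT (fun al => jap5V (u al)).
Proof.
exact: (measurableT_comp (continuous_measurable_fun (@continuous_jap5V R))).
Qed.

Lemma measurable_dot_grad (B : R) (u : R * R -> R) (v : R * R -> R * R) :
  regular B u (grad u) ->
  measurable_fun setT (fun al => (v al).1) -> measurable_fun setT (fun al => (v al).2) ->
  measurable_fun setT (fun al => dot (v al) (grad u (x - al))).
Proof.
move=> ru m1 m2; apply: measurable_funD; apply: measurable_funM => //.
- exact: (measurableT_comp (continuous_measurable2 (regular_continuous_fst ru)) measurable_shift).
- exact: (measurableT_comp (continuous_measurable2 (regular_continuous_snd ru)) measurable_shift).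
Qed.

Lemma measurable_dir1 : measurable_fun setT (fun al : R * R => (direction al).1).
Proof.
apply: measurable_funM; last exact: measurable_fst.
by have := measurable_enormV 1; under eq_fun do rewrite expr1.
Qed.

Lemma measurable_dir2 : measurable_fun setT (fun al : R * R => (direction al).2).
Proof.
apply: measurable_funM; last exact: measurable_snd.
by have := measurable_enormV 1; under eq_fun do rewrite expr1.
Qed.

Lemma measurable_dir_cst (y : R * R) :
  measurable_fun setT (fun al => dot (direction al) y).
Proof.
by apply: measurable_funD; apply: measurable_funM => //;
  [exact: measurable_dir1|exact: measurable_dir2].
Qed.

Lemma measurable_kernel_term : measurable_fun setT (fun al =>
  3 * (Delta al f x * jap5V (Delta al f x)) *
    (dot (direction al) (grad f (x - al)) - Delta al f x)).
Proof.
have mD := measurable_Delta.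
apply: measurable_funM.
  by apply: measurable_funM => //; apply: measurable_funM => //; exact: measurable_jap5V.
apply: measurable_funB => //.
by apply: (measurable_dot_grad rf); [exact: measurable_dir1|exact: measurable_dir2].
Qed.

Lemma measurable_symbol : measurable_fun setT (fun al => symbol f al x).
Proof.
have mD := measurable_Delta.
apply: measurable_funD; last exact: measurable_kernel_term.
by apply: measurable_funB; apply: measurable_jap3V => //; exact: measurable_dir_cst.
Qed.

Lemma measurable_P_integrand : measurable_fun setT (P_integrand f g x).
Proof.
apply: measurable_funM; last exact: measurable_enormV.
apply: measurable_funM; first exact: (measurable_delta rg).
by apply: measurable_jap3V; exact: measurable_dir_cst.
Qed.

Lemma measurable_Rem_integrand : measurable_fun setT (Rem_integrand (symbol f) g x).
Proof.
apply: measurable_funM; last exact: measurable_enormV.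
by apply: measurable_funM; [exact: measurable_symbol|exact: (measurable_delta rg)].
Qed.

Let V_scalar al : R := 2^-1 * (jap3V (Delta (- al) f x) - jap3V (Delta al f x)) / enorm al ^+ 3.

Let measurable_V_scalar : measurable_fun setT V_scalar.
Proof.
apply: measurable_funM; last exact: measurable_enormV.
apply: measurable_funM => //.
by apply: measurable_funB; apply: measurable_jap3V;
  [exact: measurable_DeltaN|exact: measurable_Delta].
Qed.

Lemma measurable_V_integrand1 : measurable_fun setT (fun al => (V_integrand f x al).1).
Proof.
by apply: measurable_funM; [exact: measurable_V_scalar|exact: measurable_fst].
Qed.

Lemma measurable_V_integrand2 : measurable_fun setT (fun al => (V_integrand f x al).2).
Proof.
by apply: measurable_funM; [exact: measurable_V_scalar|exact: measurable_snd].
Qed.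

Lemma measurable_transport : measurable_fun setT (transport_integrand f g x).
Proof.
apply: measurable_funM; last exact: measurable_enormV.
apply: measurable_funM; last by apply: measurable_jap3V; exact: measurable_Delta.
by apply: measurable_funD; apply: measurable_funM.
Qed.

Lemma measurable_ibp_defect : measurable_fun setT (ibp_defect f g x).
Proof.
have mj : measurable_fun setT (fun al => jap3V (Delta al f x)).
  by apply: measurable_jap3V; exact: measurable_Delta.
apply: measurable_funM; last exact: measurable_enormV.
apply: measurable_funB; apply: measurable_funM => //.
- by apply: (measurable_dot_grad rg); [exact: measurable_fst|exact: measurable_snd].
- exact: (measurable_delta rg).
- by apply: measurable_funD => //; exact: measurable_kernel_term.
Qed.

End measurability.
End decomposition.

Section convergence.
Variable R : realType.
Local Notation mu2 := (@leb2 R).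
Implicit Types (al : R * R) (eta : R).

Lemma annulus_ratio_le (N B : R) eta al : 0 < eta -> annulus eta al ->
  `|N| <= B -> `|N / enorm al ^+ 3| <= B / eta ^+ 3.
Proof.
move=> eta0 [/ltW e1 _] NB; have al0 := lt_le_trans eta0 e1.
rewrite normrM normfV [X in _ / X]ger0_norm ?exprn_ge0 ?(ltW al0)//.
apply: ler_pM; rewrite ?invr_ge0 ?exprn_ge0 ?(ltW al0)//.
by rewrite lef_pV2 ?posrE ?exprn_gt0// lerXn2r ?nnegrE ?(ltW eta0) ?(ltW al0).
Qed.

(** The same fact, for the sigma-algebra that carries [leb2]. *)
Lemma measurable_annulus_leb2 eta :
  measurable (annulus eta : set (measurableTypeR R * measurableTypeR R)%type).
Proof. exact: measurable_annulus. Qed.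

Lemma annulus_enorm_le eta al : annulus eta al -> enorm al <= eta^-1.
Proof. by case=> _ /ltW. Qed.

Variables (C K : R) (f g : R * R -> R) (x : R * R).
Hypotheses (rf : regular C f (grad f)) (rg : regular K g (grad g)).

Let C0 : 0 <= C. Proof. exact: regular_ge0 rf. Qed.
Let K0 : 0 <= K. Proof. exact: regular_ge0 rg. Qed.

Lemma integrable_P eta : 0 < eta ->
  mu2.-integrable (annulus eta) (EFin \o P_integrand f g x).
Proof.
move=> eta0; apply: (bounded_annulus_integrable (M := (K + K) / eta ^+ 3)).
  exact: (measurable_P_integrand f rg).
move=> al Aal; apply: annulus_ratio_le => //.
rewrite normrM; apply: le_trans (ler_piMr _ (normr_jap3V_le1 _)) _ => //.
exact: (normr_delta_le rg).
Qed.

Lemma integrable_Rem eta : 0 < eta ->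
  mu2.-integrable (annulus eta) (EFin \o Rem_integrand (symbol f) g x).
Proof.
move=> eta0.
apply: (bounded_annulus_integrable (M := (24 * C * (K + K)) / eta ^+ 3)).
  exact: (measurable_Rem_integrand rf rg).
move=> al Aal; apply: annulus_ratio_le => //.
have al0 := annulus_punctured eta0 Aal.
rewrite normrM; apply: ler_pM => //; first exact: (symbol_le_cst rf).
exact: (normr_delta_le rg).
Qed.

Lemma normr_jap3VB_le2 (a b : R) : `|jap3V a - jap3V b| <= 2.
Proof.
apply: le_trans (ler_normB _ _) _; rewrite (_ : 2 = 1 + 1)//.
by apply: lerD; exact: normr_jap3V_le1.
Qed.

Lemma V_integrandE al : V_integrand f x al =
  (2^-1 * (jap3V (Delta (- al) f x) - jap3V (Delta al f x)) * al.1 / enorm al ^+ 3,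
   2^-1 * (jap3V (Delta (- al) f x) - jap3V (Delta al f x)) * al.2 / enorm al ^+ 3).
Proof. by rewrite /V_integrand [LHS]surjective_pairing /=; congr pair; exact: mulrAC. Qed.

Lemma V_numerator_le eta al (t : R) : annulus eta al -> `|t| <= enorm al ->
  `|2^-1 * (jap3V (Delta (- al) f x) - jap3V (Delta al f x)) * t| <= eta^-1.
Proof.
move=> Aal tal; rewrite normrM -[leRHS]mul1r; apply: ler_pM => //; last first.
  exact: le_trans tal (annulus_enorm_le Aal).
rewrite normrM ger0_norm// mulrC ler_pdivrMr// mul1r.
exact: normr_jap3VB_le2.
Qed.

Lemma integrable_V1 eta : 0 < eta ->
  mu2.-integrable (annulus eta) (EFin \o (fun al => (V_integrand f x al).1)).
Proof.
move=> eta0; apply: (bounded_annulus_integrable (M := eta^-1 / eta ^+ 3)).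
  exact: (measurable_V_integrand1 rf).
move=> al Aal; rewrite V_integrandE; apply: annulus_ratio_le => //.
exact: V_numerator_le Aal (normr_fst_enorm al).
Qed.

Lemma integrable_V2 eta : 0 < eta ->
  mu2.-integrable (annulus eta) (EFin \o (fun al => (V_integrand f x al).2)).
Proof.
move=> eta0; apply: (bounded_annulus_integrable (M := eta^-1 / eta ^+ 3)).
  exact: (measurable_V_integrand2 rf).
move=> al Aal; rewrite V_integrandE; apply: annulus_ratio_le => //.
exact: V_numerator_le Aal (normr_snd_enorm al).
Qed.

Lemma normr_dot_grad_annulus_le eta al y : annulus eta al ->
  `|dot al (grad g y)| <= eta^-1 * K.
Proof.
move=> Aal; have [_ G0 _ _] := rg; apply: le_trans (normr_dot_le _ _) _.
by apply: ler_pM; rewrite ?enorm_ge0// annulus_enorm_le.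
Qed.

Lemma integrable_transport eta : 0 < eta ->
  mu2.-integrable (annulus eta) (EFin \o transport_integrand f g x).
Proof.
move=> eta0; apply: (bounded_annulus_integrable (M := (eta^-1 * K) / eta ^+ 3)).
  exact: (measurable_transport g rf).
move=> al Aal; apply: annulus_ratio_le => //.
rewrite normrM; apply: le_trans (ler_piMr _ (normr_jap3V_le1 _)) _ => //.
exact: normr_dot_grad_annulus_le Aal.
Qed.

Lemma ibp_defect_bounded eta : 0 < eta -> exists M, forall al, annulus eta al ->
  `|ibp_defect f g x al| <= M.
Proof.
move=> eta0.
exists ((eta^-1 * K + (K + K) * (1 + 3 * (C + (C + C)))) / eta ^+ 3) => al Aal.
have al0 := annulus_punctured eta0 Aal.
apply: annulus_ratio_le => //; apply: le_trans (ler_normB _ _) _.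
rewrite normrM [X in _ + X]normrM; apply: lerD.
  apply: le_trans (ler_piMr _ (normr_jap3V_le1 _)) _ => //.
  exact: normr_dot_grad_annulus_le Aal.
apply: ler_pM => //; first exact: (normr_delta_le rg).
apply: le_trans (ler_normD _ _) _; apply: lerD; first exact: normr_jap3V_le1.
rewrite -mulrA normrM (ger0_norm (ler0n _ 3)) ler_wpM2l// normrM.
apply: le_trans (ler_piMl _ (normr_mul_jap5V_le1 _)) _ => //.
apply: le_trans (ler_normB _ _) _; apply: lerD.
  exact: (normr_dir_grad_le1 rf).
exact: (normr_Delta_le rf).
Qed.

Lemma integrable_ibp_defect eta : 0 < eta ->
  mu2.-integrable (annulus eta) (EFin \o ibp_defect f g x).
Proof.
move=> eta0; have [M hM] := ibp_defect_bounded eta0.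
by apply: (bounded_annulus_integrable (M := M)) => //; exact: (measurable_ibp_defect rf rg).
Qed.

Lemma delta_second_le al (u : R * R -> R) (B : R) : regular B u (grad u) ->
  `|delta al u x + delta (- al) u x| <= (B + B) * enorm al ^+ 2.
Proof. by move=> ru; have := regular_second_difference ru x al; rewrite /delta opprK. Qed.

Lemma delta_second_le_cst al (u : R * R -> R) (B : R) : regular B u (grad u) ->
  `|delta al u x + delta (- al) u x| <= 4 * B.
Proof.
move=> ru; rewrite (_ : 4 * B = (B + B) + (B + B)); last by ring.
by apply: le_trans (ler_normD _ _) _; apply: lerD; exact: (normr_delta_le ru).
Qed.

(** Opposite increments of [g] add up to a second difference, and the kernel is
    even. *)
Lemma cvg_P : cvg ((\int[mu2]_(al in annulus eta) P_integrand f g x al)%R @[eta --> 0^'+]).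
Proof.
apply: (pv_symmetric_cvg (K := 2 * (4 * K))).
- exact: (measurable_P_integrand f rg).
- exact: integrable_P.
move=> al al0.
rewrite (_ : _ + _ = (delta al g x + delta (- al) g x) *
    jap3V (dot (direction al) (grad f x)) / enorm al ^+ 3); last first.
  by rewrite /P_integrand enormN directionN dotNl japN -!mulrDl.
apply: pv_majorant_le => //; rewrite normrM.
  apply: le_trans (ler_piMr _ (normr_jap3V_le1 _)) _ => //.
  apply: le_trans (delta_second_le al rg) _; rewrite ler_wpM2r ?sqr_ge0//.
  by have := K0; lra.
apply: le_trans (ler_piMr _ (normr_jap3V_le1 _)) _ => //.
exact: delta_second_le_cst.
Qed.

(** The symbol and the increment both vanish at first order at the origin. *)
Lemma cvg_Rem :
  cvg ((\int[mu2]_(al in annulus eta) Rem_integrand (symbol f) g x al)%R @[eta --> 0^'+]).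
Proof.
have CK0 : 0 <= C * K by exact: mulr_ge0.
apply: (pv_symmetric_cvg (K := 2 * (96 * (C * K)))).
- exact: (measurable_Rem_integrand rf rg).
- exact: integrable_Rem.
have far al : al != 0 -> `|symbol f al x * delta al g x| <= 48 * (C * K).
  move=> al0; rewrite normrM (_ : 48 * (C * K) = 24 * C * (K + K)); last by ring.
  by apply: ler_pM => //; [exact: (symbol_le_cst rf)|exact: (normr_delta_le rg)].
have near al : al != 0 -> `|symbol f al x * delta al g x| <= 48 * (C * K) * enorm al ^+ 2.
  move=> al0; rewrite normrM.
  apply: (@le_trans _ _ (9 * C * enorm al * ((K + K) * enorm al))).
    by apply: ler_pM => //; [exact: (symbol_le_enorm rf)|exact: (regular_lipschitz rg)].
  rewrite (_ : 9 * _ * _ * _ = 18 * (C * K) * enorm al ^+ 2); last by ring.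
  by rewrite ler_wpM2r ?sqr_ge0//; lra.
move=> al al0; have Nal0 : - al != 0 by rewrite oppr_eq0.
rewrite (_ : _ + _ = (symbol f al x * delta al g x +
    symbol f (- al) x * delta (- al) g x) / enorm al ^+ 3); last first.
  by rewrite /Rem_integrand enormN -mulrDl.
apply: pv_majorant_le => //; apply: le_trans (ler_normD _ _) _.
  have := near al al0; have := near _ Nal0; rewrite enormN; lra.
have := far al al0; have := far _ Nal0; lra.
Qed.

(** [jap3V] is even, so that only [Delta_{-al} f + Delta_al f], a second
    difference divided by [|al|], matters. *)
Lemma V_sym_le al (t : R) : al != 0 -> `|t| <= enorm al ->
  `|(jap3V (Delta (- al) f x) - jap3V (Delta al f x)) * t / enorm al ^+ 3| <=
  2 * (12 * C) * pv_majorant al.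
Proof.
move=> al0 tal; have n0 : 0 < enorm al by rewrite enorm_gt0.
have b : `|(jap3V (Delta (- al) f x) - jap3V (Delta al f x)) * t| <=
    3 * `|delta al f x + delta (- al) f x|.
  rewrite normrM -(jap3VN (Delta (- al) f x)).
  apply: (@le_trans _ _ (3 * `|- Delta (- al) f x - Delta al f x| * enorm al)).
    by apply: ler_pM => //; exact: jap3V_lipschitz.
  rewrite -mulrA ler_wpM2l//.
  rewrite (_ : - Delta (- al) f x - _ = - ((delta al f x + delta (- al) f x) / enorm al)).
    by rewrite normrN normrM normfV (gtr0_norm n0) divfK// gt_eqF.
  by rewrite /Delta /delta enormN; field; rewrite gt_eqF.
apply: pv_majorant_le => //; apply: le_trans b _.
  have := delta_second_le al rf; have : 0 <= C * enorm al ^+ 2 by rewrite mulr_ge0 ?sqr_ge0.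
  by lra.
by have := delta_second_le_cst al rf; lra.
Qed.

Lemma cvg_V1 :
  cvg ((\int[mu2]_(al in annulus eta) (V_integrand f x al).1)%R @[eta --> 0^'+]).
Proof.
apply: (pv_symmetric_cvg (K := 2 * (12 * C))).
- exact: (measurable_V_integrand1 rf).
- exact: integrable_V1.
move=> al al0; rewrite (_ : _ + _ =
    (jap3V (Delta (- al) f x) - jap3V (Delta al f x)) * al.1 / enorm al ^+ 3).
  exact: V_sym_le (normr_fst_enorm al).
by rewrite !V_integrandE /= opprK enormN -mulrDl; congr (_ / _); field.
Qed.

Lemma cvg_V2 :
  cvg ((\int[mu2]_(al in annulus eta) (V_integrand f x al).2)%R @[eta --> 0^'+]).
Proof.
apply: (pv_symmetric_cvg (K := 2 * (12 * C))).
- exact: (measurable_V_integrand2 rf).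
- exact: integrable_V2.
move=> al al0; rewrite (_ : _ + _ =
    (jap3V (Delta (- al) f x) - jap3V (Delta al f x)) * al.2 / enorm al ^+ 3).
  exact: V_sym_le (normr_snd_enorm al).
by rewrite !V_integrandE /= opprK enormN -mulrDl; congr (_ / _); field.
Qed.

Lemma cvg_ibp_defect :
  (\int[mu2]_(al in annulus eta) ibp_defect f g x al)%R @[eta --> 0^'+] --> 0.
Proof.
pose B := ((K + K) * 3 + (K + K) * (3 * (C + C))) * pi.
have cB : eta * B @[eta --> 0^'+] --> 0.
  rewrite -[X in _ --> X](mul0r B); apply: cvgM; last exact: cvg_cst.
  exact: cvg_within.
apply: norm_cvg0; apply: (squeeze_cvgr _ (cvg_cst 0) cB).
near=> eta.
have eta0 : 0 < eta by near: eta; exact: nbhs_right_gt.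
have eta1 : eta < 1 by near: eta; exact: nbhs_right_lt.
rewrite normr_ge0/=; have [M hM] := ibp_defect_bounded eta0.
rewrite /B mulrC mulrAC.
apply: (polar_annulus_le _ eta0 hM); first exact: (measurable_ibp_defect rf rg).
by move=> w w1; exact: (ibp_defect_radial_le x rf rg w1 eta0 eta1).
Unshelve. all: by end_near. Qed.

(** The transport term is odd up to the asymmetry of [<Delta_al f>], and its
    symmetrisation is the drift. *)
Lemma transport_integral eta : 0 < eta ->
  \int[mu2]_(al in annulus eta) transport_integrand f g x al =
  - ((grad g x).1 * \int[mu2]_(al in annulus eta) (V_integrand f x al).1 +
     (grad g x).2 * \int[mu2]_(al in annulus eta) (V_integrand f x al).2).
Proof.
move=> eta0; have mA := measurable_annulus_leb2 eta.
have iT := integrable_transport eta0.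
have [iTN ETN] := annulus_Rintegral_reflect iT.
have i1 := integrable_V1 eta0; have i2 := integrable_V2 eta0.
have i3 := RintegrableZl mA (grad g x).1 i1.
have i4 := RintegrableZl mA (grad g x).2 i2.
have E : \int[mu2]_(al in annulus eta)
      (transport_integrand f g x al + transport_integrand f g x (- al)) =
    \int[mu2]_(al in annulus eta) (- 2 * ((grad g x).1 * (V_integrand f x al).1 +
      (grad g x).2 * (V_integrand f x al).2)).
  apply: eq_Rintegral => al /set_mem Aal.
  have n0 : enorm al != 0 by rewrite enorm_eq0 (annulus_punctured eta0).
  by rewrite /transport_integrand V_integrandE enormN dotNl /dot /=; field.
move: E; rewrite RintegralD// ETN RintegralZl//; last exact: RintegrableD.
rewrite RintegralD// !RintegralZl// => E.
by lra.
Qed.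

Lemma L_integrandE eta al : 0 < eta -> annulus eta al -> L_integrand f g x al =
  transport_integrand f g x al - ibp_defect f g x al - P_integrand f g x al -
  Rem_integrand (symbol f) g x al.
Proof.
move=> eta0 Aal.
have n0 : enorm al != 0 by rewrite enorm_eq0 (annulus_punctured eta0).
rewrite /L_integrand (regular_grad_Delta rg) dotZr dotBr.
rewrite /transport_integrand /ibp_defect /P_integrand /Rem_integrand /symbol.
rewrite -!/(jap3V _).
by field.
Qed.

Lemma integrable_L eta : 0 < eta ->
  mu2.-integrable (annulus eta) (EFin \o L_integrand f g x).
Proof.
move=> eta0; have mA := measurable_annulus_leb2 eta.
have h := integrableB mA (integrableB mA (integrableB mA (integrable_transport eta0)
  (integrable_ibp_defect eta0)) (integrable_P eta0)) (integrable_Rem eta0).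
by apply: eq_integrable h => // al /set_mem Aal; rewrite /= (L_integrandE eta0 Aal).
Qed.

Lemma L_integral eta : 0 < eta ->
  \int[mu2]_(al in annulus eta) L_integrand f g x al =
  - ((grad g x).1 * \int[mu2]_(al in annulus eta) (V_integrand f x al).1 +
     (grad g x).2 * \int[mu2]_(al in annulus eta) (V_integrand f x al).2) -
  \int[mu2]_(al in annulus eta) ibp_defect f g x al -
  \int[mu2]_(al in annulus eta) P_integrand f g x al -
  \int[mu2]_(al in annulus eta) Rem_integrand (symbol f) g x al.
Proof.
move=> eta0; have mA := measurable_annulus_leb2 eta.
have i1 := integrable_transport eta0; have i2 := integrable_ibp_defect eta0.
have i3 := integrable_P eta0; have i4 := integrable_Rem eta0.
have i5 := integrableB mA i1 i2; have i6 := integrableB mA i5 i3.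
rewrite -transport_integral// -RintegralB// -RintegralB// -RintegralB//.
by apply: eq_Rintegral => al /set_mem Aal; rewrite (L_integrandE eta0 Aal).
Qed.

End convergence.

Theorem proposition3p1 (R : realType) (f : R * R -> R) (hf : Hinfty f) :
  exists M : R * R -> R * R -> R,
    (forall al x : R * R, al != 0 ->
      `|M al x| <=
        6 * `|Delta al f x - dot (direction al) (grad f x)|
        + 3 * enorm (grad (delta al f) x)) /\
    (forall g : R * R -> R, Hinfty g -> forall x : R * R,
      [/\ convergent (L_integrand f g x),
          convergent (P_integrand f g x),
          convergent (fun al => (V_integrand f x al).1) /\
          convergent (fun al => (V_integrand f x al).2),
          convergent (Rem_integrand M g x) &
          L f g x = P f g x + dot (V f x) (grad g x) + Rem M g x]).
Proof.
have [C rf] := Hinfty_regular hf.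
exists (symbol f); split => [al x al0|g hg x]; first exact: (symbol_le rf).
have [K rg] := Hinfty_regular hg.
have /cvg_ex[lP cP] := cvg_P (f := f) (x := x) rg.
have /cvg_ex[lR cR] := cvg_Rem (x := x) rf rg.
have /cvg_ex[l1 c1] := cvg_V1 (x := x) rf.
have /cvg_ex[l2 c2] := cvg_V2 (x := x) rf.
have cD := cvg_ibp_defect x rf rg.
have cL : (\int[@leb2 R]_(al in annulus eta) L_integrand f g x al)%R @[eta --> 0^'+] -->
    - ((grad g x).1 * l1 + (grad g x).2 * l2) - 0 - lP - lR.
  have c : (- ((grad g x).1 * \int[@leb2 R]_(al in annulus eta) (V_integrand f x al).1 +
       (grad g x).2 * \int[@leb2 R]_(al in annulus eta) (V_integrand f x al).2) -
     \int[@leb2 R]_(al in annulus eta) ibp_defect f g x al -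
     \int[@leb2 R]_(al in annulus eta) P_integrand f g x al -
     \int[@leb2 R]_(al in annulus eta) Rem_integrand (symbol f) g x al)%R
     @[eta --> 0^'+] --> - ((grad g x).1 * l1 + (grad g x).2 * l2) - 0 - lP - lR.
    apply: cvgB => //; apply: cvgB => //; apply: cvgB => //; apply: cvgN.
    by apply: cvgD; apply: cvgM => //; exact: cvg_cst.
  apply: cvg_trans c; apply: near_eq_cvg; near=> eta.
  by rewrite (L_integral x rf rg)//; near: eta; exact: nbhs_right_gt.
split.
- right; split; first exact: (integrable_L _ rf rg).
  by apply/cvg_ex; exists (- ((grad g x).1 * l1 + (grad g x).2 * l2) - 0 - lP - lR).
- right; split; first exact: (integrable_P _ _ rg).
  by apply/cvg_ex; exists lP.
- split; right; split; [exact: (integrable_V1 _ rf)| |exact: (integrable_V2 _ rf)|].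
  + by apply/cvg_ex; exists l1.
  + by apply/cvg_ex; exists l2.
- right; split; first exact: (integrable_Rem _ rf rg).
  by apply/cvg_ex; exists lR.
rewrite /L /P /V /Rem (pv_intE cL) (pv_intE cP) (pv_intE c1) (pv_intE c2) (pv_intE cR).
by rewrite dotZl /dot /=; ring.
Unshelve. all: by end_near. Qed.
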